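(* Let $\mathcal G$ be a finite connected simple graph with edge lengths, with associated metric graph $S$ of total length $\zeta$, and let $M>0$ be an integer. For any $\varepsilon>0$ there exists $n_1$ such that for all $n\ge n_1$, $$\mathbb P^n_M\big(\beta(f_L)\le \beta^*(S,M)-\varepsilon\big)<\exp(-n\varepsilon+2\log^2 n),$$ and $$\mathbb P^n_M\Big(\sup_{0\le t<\zeta}\big|D^L_n(t)\ominus R(\{N_n,N_n-1,\dots,\lceil N_n(1-t/\zeta)\rceil\})\big|<\varepsilon n\Big)>1-\varepsilon .$$ Here $L$ is the random labeling of the subdivision graph $\mathcal G_n$ (uniform among labelings with exactly $M$ peaks), $R=L^{-1}$, $f_L$ is the flooding associated with $L$, $D_n^L(t)=\mathcal V_n\cap f_L(t)$, $\ominus$ is the symmetric difference and $|\cdot|$ of a finite set is its cardinality.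
   Context: **Metric graphs.** $\mathcal G=(\mathcal V,\mathcal E)$ is a finite connected simple graph with a length function $\ell:\mathcal E\to(0,\infty)$. Each edge is given an arbitrary orientation. $S$ is the quotient of $\bigcup_{e\in\mathcal E}\{e\}\times[0,\ell(e)]$ obtained by identifying points representing the same vertex ($(e,0)$ is the initial vertex of $e$, $(e,\ell(e))$ the terminal one); points are written $(e,x)$. $S$ carries the shortest-path metric and its topology; $\zeta=\sum_e\ell(e)$. **Normal vectors.** For each edge $e$ there are two symbols $e^+,e^-$ with $\mathrm{sign}(e^{\pm})=\pm1$, and $(e,s)+t\mathbf w=(e,s+\mathrm{sign}(\mathbf w)t)$ for $\mathbf w\in\{e^+,e^-\}$ whenever $0\le s+\mathrm{sign}(\mathbf w)t\le \ell(e)$. $e^+$ is anchored at a point $p$ if $p=(e,s)$ with $0\le s<\ell(e)$; $e^-$ is anchored at $p$ if $p=(e,s)$ with $0<s\le\ell(e)$. For a closed set $A\subset S$ with finitely many components and $p\in\partial A$, $\mathbf w$ is an outward normal vector to $A$ at $p$ if $\mathbf w$ is anchored at $p$ and for some $t_1>0$, $p+t\mathbf w\notin A$ for all $t\in(0,t_1)$. **Floodings.** A flooding is a family $(f(t),t\ge0)$ of increasing closed subsets of $S$, each with finitely many components, for which there are times $0=t_0<t_1<\dots<t_{\mathbf k(f)}<\infty$ such that $f(t)=S$ for $t\ge t_{\mathbf k(f)}$, and for $k=1,\dots,\mathbf k(f)$: $f(t_{k-1})\ne S$; $\mathbf w^k_1,\dots,\mathbf w^k_{m_k}$ are all outward normal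 vectors at all points of $\partial f(t_{k-1})$, with $\mathbf w^k_j\in\{(e^k_j)^+,(e^k_j)^-\}$ anchored at the boundary point $(e^k_j,r^k_j)$; there are $z^k_j\ge0$ with $\sum_{j=1}^{m_k}z^k_j=1$; $t_k$ is the infimum of $t>t_{k-1}$ such that for some $j$, $r^k_j+\mathrm{sign}(\mathbf w^k_j)z^k_j(t-t_{k-1})\notin[0,\ell(e^k_j)]$, or for some $j_1\neq j_2$ with $e^k_{j_1}=e^k_{j_2}$, $r^k_{j_1}+\mathrm{sign}(\mathbf w^k_{j_1})z^k_{j_1}(t-t_{k-1})=r^k_{j_2}+\mathrm{sign}(\mathbf w^k_{j_2})z^k_{j_2}(t-t_{k-1})$; and, with $x^k_j(t)=(e^k_j,r^k_j)+(t-t_{k-1})z^k_j\mathbf w^k_j$, for $t\in[t_{k-1},t_k]$ one has $f(t)=f(t_{k-1})\cup\{x^k_j(s):1\le j\le m_k,\ t_{k-1}\le s\le t\}$. The moving segments are called arms. $\mathcal F^M$ is the set of floodings such that $f(0)$ consists of $M$ distinct points ($M$ sources); then $t_{\mathbf k(f)}=\zeta$. $\mathcal F^{\le M}=\bigcup_{1\le K\le M}\mathcal F^K$. **Entropy.** With $0\log0=0$, $\beta(f)=-\sum_{k=1}^{\mathbf k(f)}(t_k-t_{k-1})\sum_{j=1}^{m_k}z^k_j\log z^k_j$, and $\beta^*(S,M)=\sup\{\beta(f):f\in\mathcal F^{\le M}\}$. **Subdivision graphs.** For $n\ge1$, $\mathcal G_n=(\mathcal V_n,\mathcal E_n)$ is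 obtained by replacing each edge $e$ of $\mathcal G$ by a path with $\lceil n\ell(e)\rceil$ edges, each of length $\ell(e)/\lceil n\ell(e)\rceil$; $\mathcal V_n$ is viewed as a subset of $S$ and $\mathcal E_n$ as a set of segments in $S$. $N_n=|\mathcal V_n|$. **Labelings.** A labeling of $\mathcal G_n$ is a bijection $L:\mathcal V_n\to\{1,\dots,N_n\}$; $R=L^{-1}$. A vertex $v$ is a peak of $L$ if $L(v)>L(y)$ for all neighbors $y$ of $v$. $\mathbb P^n_M$ is the uniform distribution on labelings of $\mathcal G_n$ having exactly $M$ peaks. **The flooding $f_L$ of $S$ associated with a labeling $L$ of $\mathcal G_n$ with $M$ peaks.** For $0\le k\le N_n-1$ let $C_k=R(\{N_n,N_n-1,\dots,N_n-k\})$. Let $k_0=0$ and let $0<k_1<\dots<k_\alpha$ be all $k>0$ such that at least one of the following holds: (i) $R(N_n-k)$ is a vertex of $\mathcal G$; (ii) $C_k$ contains all vertices of $\mathcal V_n$ belonging to some edge $e$ of $\mathcal G$ but $C_{k-1}$ does not, or, more generally, $R(N_n-k)$ is an interior vertex of an edge of $\mathcal G$ and both its neighbors in $\mathcal G_n$ lie in $C_{k-1}$ (two arms meet in the interior of an edge); (iii) $R(N_n-k)$ is a peak. Let $t_{k_i}$ be the total length of all edges of $\mathcal G_n$ both of whose endpoints belong to $C_{k_i}$. Then $f_L(t_{k_i})$ is the union of the set of all peaks of $L$ and of all edges of $\mathcal G_n$ (as segments of $S$) both of whose endpoints belong to $C_{k_i}$, $0\le i\le\alpha$; between consecutive distinct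 times $t_{k_{i-1}}<t_{k_i}$ every arm moves along its edge at constant speed from its position at time $t_{k_{i-1}}$ to its position at time $t_{k_i}$ (two arms meeting in the interior of an edge at time $t_{k_i}$ meet at the vertex $R(N_n-k_i)$). Repeated times are discarded, and $\beta(f_L)=-\sum_{i}(t_{k_i}-t_{k_{i-1}})\sum_{j}z^{k_i}_j\log z^{k_i}_j$ (with $0\log0=0$), where the outer sum is over the consecutive distinct times $t_{k_{i-1}}<t_{k_i}$ and $z^{k_i}_j$ are the constant speeds of the arms of $f_L$ on $[t_{k_{i-1}},t_{k_i}]$. *)

(* Defs.v *)
From HB Require Import structures.
From mathcomp Require Import all_boot all_order all_algebra.
From mathcomp Require Import mathcomp_extra boolp classical_sets functions.
From mathcomp Require Import cardinality reals topology exp.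
From mathcomp Require Import lra.

Set Implicit Arguments.
Unset Strict Implicit.
Unset Printing Implicit Defensive.

Import Order.TTheory GRing.Theory Num.Theory.
Local Open Scope classical_set_scope.
Local Open Scope ring_scope.

(** * Metric graphs *)

Definition joins (V E : finType) (src tgt : E -> V) (e : E) : rel V :=
  fun u v => ((src e == u) && (tgt e == v)) || ((src e == v) && (tgt e == u)).

(* A finite connected simple graph with an orientation and a length of each
   edge.  There is at least one edge: the metric space below is glued from the
   edges, and its total length is a divisor in the results about it. *)
Record metric_graph (R : realType) := MetricGraph {
  vtx : finType;
  edg : finType;
  src : edg -> vtx;
  tgt : edg -> vtx;
  len : edg -> R;
  no_loop : forall e, src e != tgt e;
  no_multi : forall e e', joins src tgt e (src e') (tgt e') -> e = e';
  len_gt0 : forall e, 0 < len e;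
  graph_connected :
    forall u v, connect (fun u v => [exists e, joins src tgt e u v]) u v;
  edg_gt0 : (0 < #|edg|)%N
}.

Section MetricSpace.
Variables (R : realType) (G : metric_graph R).

Definition total_len : R := \sum_(e : edg G) len e.

Definition inner (q : edg G * R) : bool := 0 < q.2 < len q.1.

(* The quotient of the disjoint union of the {e} x [0, len e] by the gluing of
   the endpoints that represent the same vertex, in normal form: a class is
   either a vertex or one point (e, x) with 0 < x < len e.  The quotient map is
   [pt], see [pt_surj] and [pt_eqP]. *)
Definition mspace : Type := (vtx G + {q : edg G * R | inner q})%type.

HB.instance Definition _ :=
  Choice.copy mspace (vtx G + {q : edg G * R | inner q})%type.

(* Outside [0, len e], x is read as the nearest endpoint. *)
Definition pt (e : edg G) (x : R) : mspace :=
  if insub (e, x) is Some q then inr q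
  else inl (if x <= 0 then src e else tgt e).

Definition endpoint (e : edg G) (x : R) : option (vtx G) :=
  if x == 0 then Some (src e) else
  if x == len e then Some (tgt e) else None.

Lemma pt0 e : pt e 0 = inl (src e).
Proof. by rewrite /pt insubF ?lexx // /inner /= ltxx. Qed.

Lemma ptl e : pt e (len e) = inl (tgt e).
Proof. by rewrite /pt insubF ?leNgt ?len_gt0 // /inner /= ltxx andbF. Qed.

Lemma pt_inner e x (h : inner (e, x)) : pt e x = inr (Sub (e, x) h).
Proof. by rewrite /pt insubT. Qed.

Lemma range_cases e x : 0 <= x <= len e ->
  [\/ x = 0, x = len e | inner (e, x)].
Proof.
rewrite /inner /= => /andP[x0 xl].
have [->|nx0] := eqVneq x 0; first by constructor 1.
have [->|nxl] := eqVneq x (len e); first by constructor 2.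
by constructor 3; rewrite !lt_neqAle eq_sym nx0 x0 nxl xl.
Qed.

Lemma vtx_edge (v : vtx G) : exists e, (src e == v) || (tgt e == v).
Proof.
have /card_gt0P[e0 _] := edg_gt0 G.
have [<-|nv] := eqVneq (src e0) v; first by exists e0; rewrite eqxx.
have /connectP[[|u p] /=] := graph_connected v (src e0).
  by move=> _ /eqP; rewrite (negbTE nv).
case/andP=> /existsP[e /orP[]/andP[/eqP h1 /eqP h2]] _ _; exists e.
  by rewrite h1 eqxx.
by rewrite h2 eqxx orbT.
Qed.

Lemma pt_surj (p : mspace) : exists e x, 0 <= x <= len e /\ p = pt e x.
Proof.
case: p => [v|[[e x] h]].
  have [e /orP[]/eqP <-] := vtx_edge v; exists e.
    by exists 0; rewrite pt0 lexx ltW // len_gt0.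
  by exists (len e); rewrite ptl lexx ltW // len_gt0.
exists e, x; rewrite (pt_inner h); split; last by congr inr; apply: val_inj.
by move: h; rewrite /inner /= => /andP[h1 h2]; rewrite !ltW.
Qed.

Lemma ptE e x : 0 <= x <= len e ->
  (exists v, pt e x = inl v /\ endpoint e x = Some v) \/
  (exists h : inner (e, x), pt e x = inr (Sub (e, x) h) /\
    endpoint e x = None).
Proof.
move=> /range_cases[->|->|h]; rewrite /endpoint.
- by left; exists (src e); rewrite pt0 eqxx.
- by left; exists (tgt e); rewrite ptl eqxx gt_eqF ?len_gt0.
- right; exists h; rewrite (pt_inner h); split=> //.
  by move: h => /andP[/= h1 h2]; rewrite gt_eqF // lt_eqF.
Qed.

Lemma pt_eqP e x e' x' : 0 <= x <= len e -> 0 <= x' <= len e' ->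
  pt e x = pt e' x' <->
  (e, x) = (e', x') \/
  exists v, endpoint e x = Some v /\ endpoint e' x' = Some v.
Proof.
move=> r r'; split; last first.
  case=> [[-> ->] //|[v [h h']]].
  have [[w [-> hw]]|[? [_]]] := ptE r; last by rewrite h.
  have [[w' [-> hw']]|[? [_]]] := ptE r'; last by rewrite h'.
  by move: hw hw'; rewrite h h' => -[<-] [<-].
have [[v [-> hv]]|[h [-> _]]] := ptE r;
  have [[v' [-> hv']]|[h' [-> _]]] := ptE r' => //.
- by move=> [vv]; right; exists v; rewrite hv hv' vv.
- by move=> /(congr1 (fun q => if q is inr u then val u else (e, x))) /=; left.
Qed.

(* A route runs through finitely many segments [x, y], each inside one edge e,
   listed as the triples (e, x, y). *)
Fixpoint is_route (p q : mspace) (c : seq (edg G * R * R)) : Prop :=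
  if c is (e, x, y) :: c' then
    [/\ 0 <= x <= len e, 0 <= y <= len e, p = pt e x & is_route (pt e y) q c']
  else p = q.

Definition route_len (c : seq (edg G * R * R)) : R :=
  \sum_(s <- c) `|s.1.2 - s.2|.

Definition path_dist (p q : mspace) : R :=
  inf [set route_len c | c in [set c | is_route p q c]].

Lemma route_len_cat c c' : route_len (c ++ c') = route_len c + route_len c'.
Proof. by rewrite /route_len big_cat. Qed.

Lemma route_len_ge0 c : 0 <= route_len c.
Proof. exact: sumr_ge0. Qed.

Lemma route_cat p q r c c' :
  is_route p q c -> is_route q r c' -> is_route p r (c ++ c').
Proof.
by elim: c p => [p -> //|[[e x] y] c ih p /= [? ? ? /ih h]] /h.
Qed.

Lemma route_rev p q c : is_route p q c ->
  exists2 c', is_route q p c' & route_len c' = route_len c.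
Proof.
elim: c p => [p ->|[[e x] y] c ih p /= [rx ry -> /ih[c' h hl]]].
  by exists [::].
exists (c' ++ [:: (e, y, x)]); first by apply: (route_cat h).
by rewrite route_len_cat hl /route_len !big_cons big_nil addr0 addrC distrC.
Qed.

Lemma routes_exist p q : exists c, is_route p q c.
Proof.
have ll (e : edg G) : 0 <= len e <= len e by rewrite lexx ltW ?len_gt0.
have l0 (e : edg G) : 0 <= (0 : R) <= len e by rewrite lexx ltW ?len_gt0.
have toV (r : mspace) : exists v c, is_route r (inl v) c.
  have [e [x [rx ->]]] := pt_surj r; exists (src e), [:: (e, x, 0)] => /=.
  by rewrite pt0.
have VV (u v : vtx G) : exists c, is_route (inl u) (inl v) c.
  have /connectP[s] := graph_connected u v.
  elim: s u => [u _ -> |w s ih u /= /andP[/existsP[e he] hs] hv].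
    by exists [::].
  have [c hc] := ih _ hs hv.
  case/orP: he hc => /andP[/eqP <- /eqP <-] hc.
    by exists ((e, 0, len e) :: c) => /=; rewrite pt0 ptl.
  by exists ((e, len e, 0) :: c) => /=; rewrite pt0 ptl.
have [u [c hc]] := toV p; have [v [c' hc']] := toV q.
have [d hd] := VV u v; have [c'' hc'' _] := route_rev hc'.
by exists (c ++ (d ++ c'')); apply: route_cat hc _; apply: route_cat hd _.
Qed.

Lemma path_dist_le p q c : is_route p q c -> path_dist p q <= route_len c.
Proof.
move=> h; apply: ge_inf; last by exists c.
by exists 0 => _ [d _ <-]; exact: route_len_ge0.
Qed.

Lemma path_dist_ge p q a :
  (forall c, is_route p q c -> a <= route_len c) -> a <= path_dist p q.
Proof.
move=> h; apply: lb_le_inf; last by move=> _ [c hc <-]; exact: h.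
by have [c hc] := routes_exist p q; exists (route_len c), c.
Qed.

Lemma path_distxx p : path_dist p p = 0.
Proof.
apply/eqP; rewrite eq_le; apply/andP; split.
  by have := @path_dist_le p p [::] erefl; rewrite /route_len big_nil.
by apply: path_dist_ge => c _; exact: route_len_ge0.
Qed.

Lemma path_dist_sym p q : path_dist p q = path_dist q p.
Proof.
have H (r s : mspace) : path_dist r s <= path_dist s r.
  apply: path_dist_ge => c /route_rev[c' h <-]; exact: path_dist_le.
by apply/eqP; rewrite eq_le !H.
Qed.

Lemma path_dist_triangle q p r :
  path_dist p r <= path_dist p q + path_dist q r.
Proof.
rewrite -lerBlDr; apply: path_dist_ge => c hc.
rewrite lerBlDr -lerBlDl; apply: path_dist_ge => c' hc'.
rewrite lerBlDl -route_len_cat; apply: path_dist_le; exact: route_cat hc'.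
Qed.

(* A function that is 1-Lipschitz along each edge bounds path_dist below. *)
Lemma path_dist_lip (g : mspace -> R) :
  (forall e x y, 0 <= x <= len e -> 0 <= y <= len e ->
     g (pt e y) <= g (pt e x) + `|x - y|) ->
  forall p q, g q - g p <= path_dist p q.
Proof.
move=> gl p q; apply: path_dist_ge => c; elim: c p => [p <-|[[e x] y] c ih p].
  by rewrite subrr route_len_ge0.
move=> /= [rx ry -> /ih]; rewrite /route_len big_cons /=.
by have := gl _ _ _ rx ry => h1 h2; lra.
Qed.

Let min_lip (a b c d u : R) : a <= b + u -> c <= d + u ->
  Num.min a c <= Num.min b d + u.
Proof. by move=> ab cd; rewrite addr_minl le_min !ge_min ab cd orbT. Qed.

Lemma path_dist_vtx_pos v q : path_dist (inl v) q = 0 -> inl v = q.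
Proof.
move=> d0.
have [m m0 mle] : exists2 m : R, 0 < m & forall e : edg G, m <= len e.
  have : exists2 m : R, 0 < m & forall e, e \in enum (edg G) -> m <= len e.
    elim: (enum _) => [|a s [m m0 hm]]; first by exists 1.
    exists (Num.min m (len a)); first by rewrite lt_min m0 len_gt0.
    move=> e; rewrite inE ge_min => /predU1P[->|/hm ->//].
    by rewrite lexx orbT.
  by case=> m m0 hm; exists m => // e; apply: hm; rewrite mem_enum.
pose h (e : edg G) (x : R) := Num.min m
  (Num.min (if src e == v then x else m) (if tgt e == v then len e - x else m)).
pose g (p : mspace) := match p with
  | inl u => if u == v then 0 else m
  | inr u => h (val u).1 (val u).2 end.
have gE (e : edg G) (x : R) : 0 <= x <= len e -> g (pt e x) = h e x.
  move=> /range_cases[->|->|r]; rewrite ?pt0 ?ptl ?pt_inner //= /h.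
    have am : (if src e == v then 0 else m) <= m by case: ifP => // _; exact: ltW.
    have mB : m <= (if tgt e == v then len e - 0 else m).
      by case: ifP => // _; rewrite subr0.
    by rewrite (min_l (le_trans am mB)) min_r.
  rewrite subrr.
  have am : (if tgt e == v then 0 else m) <= m by case: ifP => // _; exact: ltW.
  have mB : m <= (if src e == v then len e else m) by case: ifP.
  by rewrite (min_r (le_trans am mB)) min_r.
have gl (e : edg G) (x y : R) : 0 <= x <= len e -> 0 <= y <= len e ->
   g (pt e y) <= g (pt e x) + `|x - y|.
  move=> rx ry; rewrite !gE //; have n0 := normr_ge0 (x - y).
  apply: min_lip; first by rewrite lerDl.
  apply: min_lip; case: ifP => _; rewrite ?lerDl //.
    by rewrite -lerBlDl distrC ler_norm.
  by rewrite -lerBlDl opprB addrC addrA subrK ler_norm.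
have := path_dist_lip gl (inl v) q; rewrite d0 /= eqxx subr0.
have [e [x [rx ->]]] := pt_surj q; rewrite gE // /h !ge_min leNgt m0 /=.
move=> {gl gE}; case/orP; case: eqP => [<-|_]; rewrite ?(leNgt m) ?m0 //.
  by move: rx => /andP[x0 _] x0'; rewrite (@le_anti _ _ x 0) ?pt0 // x0 x0'.
move: rx => /andP[_ xl]; rewrite subr_le0 => xl'.
by rewrite (@le_anti _ _ x (len e)) ?ptl // xl xl'.
Qed.

Lemma path_dist_inner_pos e0 x0 q : inner (e0, x0) ->
  path_dist (pt e0 x0) q = 0 -> pt e0 x0 = q.
Proof.
move=> /andP[/= x0gt x0lt] d0.
pose m := Num.min x0 (len e0 - x0).
have m0 : 0 < m by rewrite lt_min subr_gt0 x0gt.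
pose h (e : edg G) (x : R) := if e == e0 then Num.min m `|x - x0| else m.
pose g (p : mspace) := match p with
  | inl u => m
  | inr u => h (val u).1 (val u).2 end.
have gE (e : edg G) (x : R) : 0 <= x <= len e -> g (pt e x) = h e x.
  move=> /range_cases[->|->|r]; rewrite ?pt0 ?ptl ?pt_inner //= /h.
    case: eqP => // _; rewrite sub0r normrN gtr0_norm // min_l //.
    by rewrite ge_min lexx.
  case: eqP => // ->; rewrite gtr0_norm ?subr_gt0 // min_l //.
  by rewrite ge_min lexx orbT.
have gl (e : edg G) (x y : R) : 0 <= x <= len e -> 0 <= y <= len e ->
   g (pt e y) <= g (pt e x) + `|x - y|.
  move=> rx ry; rewrite !gE // /h; have n0 := normr_ge0 (x - y).
  case: ifP => _; last by rewrite lerDl.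
  apply: min_lip; first by rewrite lerDl.
  by rewrite [leRHS]addrC (distrC x y) ler_distD.
have rx0 : 0 <= x0 <= len e0 by rewrite !ltW.
have := path_dist_lip gl (pt e0 x0) q; rewrite d0.
have [e [x [rx ->]]] := pt_surj q; rewrite !gE // /h eqxx subrr normr0.
rewrite (min_r (ltW m0)) subr0; case: eqP => [->|_]; last by rewrite leNgt m0.
by rewrite ge_min leNgt m0 /= normr_le0 subr_eq0 => /eqP ->.
Qed.

Lemma path_dist_pos p q : path_dist p q = 0 -> p = q.
Proof.
case: p => [v|[[e x] h]]; first exact: path_dist_vtx_pos.
have -> : inr (exist _ (e, x) h) = pt e x :> mspace.
  by rewrite (pt_inner h); congr inr; apply: val_inj.
exact: path_dist_inner_pos.
Qed.

HB.instance Definition _ := isMetric.Build R mspace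
  path_distxx path_dist_pos path_dist_sym path_dist_triangle.

End MetricSpace.

(** * Floodings *)

Section Flooding.
Variables (R : realType) (G : metric_graph R).

(* (e, true, s) is e^+ anchored at (e, s) and (e, false, s) is e^- anchored
   there; as G has no loops, a point is (e, s) for at most one s. *)
Definition normal : Type := (edg G * bool * R)%type.

HB.instance Definition _ := Choice.copy normal (edg G * bool * R)%type.

Definition nedge (w : normal) : edg G := w.1.1.
Definition nsign (w : normal) : R := if w.1.2 then 1 else - 1.
Definition nbase (w : normal) : R := w.2.

(* The coordinate of nbase w + t w on the edge of w. *)
Definition nmove (w : normal) (t : R) : R := nbase w + nsign w * t.

Definition anchored (w : normal) : bool :=
  if w.1.2 then 0 <= nbase w < len (nedge w) else 0 < nbase w <= len (nedge w).

Definition boundary (A : set (mspace G)) : set (mspace G) := closure A `\` A°.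

Definition outward_normal (A : set (mspace G)) (w : normal) : Prop :=
  [/\ anchored w, boundary A (pt (nedge w) (nbase w)) &
      exists2 t1, 0 < t1 & forall t, 0 < t < t1 ->
        0 <= nmove w t <= len (nedge w) /\ ~ A (pt (nedge w) (nmove w t))].

Definition finitely_many_components (A : set (mspace G)) : Prop :=
  finite_set [set connected_component A p | p in A].

(* The phase number k, for k < fl_steps, lasts from fl_time k to fl_time k.+1;
   fl_arms k lists its arms and fl_speed k gives their speeds. *)
Record flooding_data := FloodingData {
  fl_steps : nat;
  fl_time : nat -> R;
  fl_arms : nat -> seq normal;
  fl_speed : nat -> normal -> R
}.

Definition arm_coord (F : flooding_data) (k : nat) (w : normal) (t : R) : R :=
  nmove w (fl_speed F k w * (t - fl_time F k)).

Definition phase_ends (F : flooding_data) (k : nat) : set R :=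
  [set t | fl_time F k < t /\
    ((exists2 w, w \in fl_arms F k &
        ~~ (0 <= arm_coord F k w t <= len (nedge w))) \/
     (exists w1 w2, [/\ w1 \in fl_arms F k, w2 \in fl_arms F k, w1 != w2,
        nedge w1 = nedge w2 & arm_coord F k w1 t = arm_coord F k w2 t]))].

Definition swept (F : flooding_data) (k : nat) (t : R) : set (mspace G) :=
  [set p | exists w s, [/\ w \in fl_arms F k, fl_time F k <= s <= t &
                           p = pt (nedge w) (arm_coord F k w s)]].

Definition is_phase (f : R -> set (mspace G)) (F : flooding_data) (k : nat) :=
  let A := f (fl_time F k) in
  [/\ fl_time F k < fl_time F k.+1 /\ A <> setT,
      uniq (fl_arms F k) /\
        (forall w, w \in fl_arms F k <-> outward_normal A w),
      (forall w, w \in fl_arms F k -> 0 <= fl_speed F k w) /\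
        \sum_(w <- fl_arms F k) fl_speed F k w = 1,
      fl_time F k.+1 = inf (phase_ends F k) &
      forall t, fl_time F k <= t <= fl_time F k.+1 ->
        f t = A `|` swept F k t].

Definition is_flooding (f : R -> set (mspace G)) (F : flooding_data) : Prop :=
  [/\ forall t, 0 <= t -> closed (f t) /\ finitely_many_components (f t),
      forall s t, 0 <= s -> s <= t -> f s `<=` f t,
      fl_time F 0 = 0,
      forall k, (k < fl_steps F)%N -> is_phase f F k &
      forall t, fl_time F (fl_steps F) <= t -> f t = setT].

Definition flooding_entropy (F : flooding_data) : R :=
  - \sum_(k < fl_steps F) (fl_time F k.+1 - fl_time F k) *
      \sum_(w <- fl_arms F k) fl_speed F k w * ln (fl_speed F k w).

(* The family f determines its times, arms and speeds, hence its entropy. *)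
Definition max_entropy (M : nat) : R :=
  sup [set b | exists f F, [/\ is_flooding f F,
                 exists2 K, (1 <= K <= M)%N & (f 0 #= `I_K)%card &
                 b = flooding_entropy F]].

End Flooding.

(** * Subdivisions and labelings *)

Section Subdivision.
Variables (R : realType) (G : metric_graph R) (n : nat).

Definition nat_ceil (x : R) : nat := `|Num.ceil x|%N.

Definition pieces (e : edg G) : nat := nat_ceil (n%:R * len e).

Definition piece_len (e : edg G) : R := len e / (pieces e)%:R.

(* The vertices of G, and pieces e - 1 new ones on each edge e. *)
Definition svtx : finType := (vtx G + {e : edg G & 'I_(pieces e).-1})%type.

(* The vertices svert e 0, ..., svert e (pieces e) of the path replacing e. *)
Definition svert (e : edg G) (i : nat) : svtx :=
  if i == 0%N then inl (src e) else
  if insub i.-1 is Some j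
  then inr (existT (fun e => 'I_(pieces e).-1) e j)
  else inl (tgt e).

Definition sedg : finType := {e : edg G & 'I_(pieces e)}.

Definition ssrc (d : sedg) : svtx := svert (tag d) (tagged d).
Definition stgt (d : sedg) : svtx := svert (tag d) (tagged d).+1.

Definition neighbors : rel svtx := fun u v => [exists d, joins ssrc stgt d u v].

Definition spt (e : edg G) (i : nat) : mspace G := pt e (i%:R * piece_len e).

Definition spoint (v : svtx) : mspace G :=
  match v with
  | inl u => inl u
  | inr (existT e j) => spt e j.+1
  end.

Definition segment (d : sedg) : set (mspace G) :=
  [set p | exists2 x, (tagged d)%:R * piece_len (tag d) <= x <=
                      (tagged d).+1%:R * piece_len (tag d) & p = pt (tag d) x].

Definition original (v : svtx) : bool := if v is inl _ then true else false.

Definition on_edge (e : edg G) : {set svtx} :=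
  [set svert e i | i : 'I_(pieces e).+1]%SET.

(* With 'I_N for the labels 1, ..., N: the label of v is label L v. *)
Definition labeling : finType := {ffun svtx -> 'I_#|svtx|}.

Definition label (L : labeling) (v : svtx) : nat := (L v).+1.

Definition peaks (L : labeling) : {set svtx} :=
  [set v | [forall y, neighbors v y ==> (label L y < label L v)%N]]%SET.

(* An injective L is a bijection, both sides having the same cardinality. *)
Definition labelings (M : nat) : {set labeling} :=
  [set L : labeling | injectiveb L & #|peaks L| == M]%SET.

Definition prob (M : nat) (P : pred labeling) : R :=
  #|[set L in labelings M | P L]%SET|%:R / #|labelings M|%:R.

(* R({N, N - 1, ..., j}) for the inverse R of L and N = #|svtx|. *)
Definition top_labels (L : labeling) (j : nat) : {set svtx} :=
  [set v | (j <= label L v)%N]%SET.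

(** ** The flooding of a labeling *)

Section LabelingFlooding.
Variable L : labeling.

Definition occupied (k : nat) : {set svtx} := top_labels L (#|svtx| - k).

(* v = R(N - k), the vertex that joins [occupied] at k *)
Definition newest (k : nat) (v : svtx) : bool :=
  (label L v == #|svtx| - k)%N.

Definition event (k : nat) : bool :=
  [|| [exists v, newest k v && original v],
      [exists e, (on_edge e \subset occupied k) &&
                 ~~ (on_edge e \subset occupied k.-1)],
      [exists v, [&& newest k v, ~~ original v &
         [forall y, neighbors v y ==> (y \in occupied k.-1)]]] |
      [exists v, newest k v && (v \in peaks L)]].

(* k_0 = 0 < k_1 < ... < k_alpha *)
Definition events : seq nat := 0%N :: [seq k <- iota 1 #|svtx|.-1 | event k].

Definition ev (i : nat) : nat := nth 0%N events i.

Definition filled (k : nat) (d : sedg) : bool :=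
  (ssrc d \in occupied k) && (stgt d \in occupied k).

Definition ev_time (k : nat) : R := \sum_(d | filled k d) piece_len (tag d).

Definition ev_state (k : nat) : set (mspace G) :=
  [set p | (exists2 v, v \in peaks L & p = spoint v) \/
           (exists2 d, filled k d & segment d p)].

(* The arm (e, b, a) starts from svert e a and moves along e, towards the
   terminal vertex iff b. *)
Definition larm : finType := {e : edg G & (bool * 'I_(pieces e).+1)%type}.

Definition adir (w : larm) : bool := (tagged w).1.
Definition astart (w : larm) : nat := (tagged w).2.

Definition room (w : larm) : nat :=
  if adir w then (pieces (tag w) - astart w)%N else astart w.

Definition avert (w : larm) (i : nat) : svtx :=
  svert (tag w) (if adir w then astart w + i else astart w - i)%N.

Definition arms_at (k : nat) : {set larm} :=
  [set w | [&& (0 < room w)%N, avert w 0 \in occupied k :|: peaks L &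
               avert w 1 \notin occupied k]]%SET.

(* The number of edges of the subdivision covered by the arm w up to the event
   k: it advances through consecutive occupied vertices, and not beyond
   R(N - k), where two arms meeting at k stop. *)
Definition advance (k : nat) (w : larm) : nat :=
  \max_(d < (room w).+1 |
        [forall i : 'I_d, (avert w i.+1 \in occupied k) &&
                          ((i.+1 < d)%N ==> ~~ newest k (avert w i.+1))]) d.

(* The speed of w between the events k and k'. *)
Definition aspeed (k k' : nat) (w : larm) : R :=
  (advance k' w)%:R * piece_len (tag w) / (ev_time k' - ev_time k).

Definition acoord (k k' : nat) (w : larm) (t : R) : R :=
  (astart w)%:R * piece_len (tag w) +
  (if adir w then 1 else - 1) * (aspeed k k' w * (t - ev_time k)).

Definition label_flooding (t : R) : set (mspace G) :=
  [set p | (exists k, [/\ k \in events, ev_time k <= t & ev_state k p]) \/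
           (exists i w s, [/\ (i.+1 < size events)%N,
              ev_time (ev i) < ev_time (ev i.+1),
              w \in arms_at (ev i),
              ev_time (ev i) <= s <= t /\ t <= ev_time (ev i.+1) &
              p = pt (tag w) (acoord (ev i) (ev i.+1) w s)])].

Definition label_entropy : R :=
  - \sum_(i < (size events).-1 | ev_time (ev i) < ev_time (ev i.+1))
      (ev_time (ev i.+1) - ev_time (ev i)) *
      \sum_(w in arms_at (ev i))
        aspeed (ev i) (ev i.+1) w * ln (aspeed (ev i) (ev i.+1) w).

(* D_n^L(t) *)
Definition flooded (t : R) : {set svtx} :=
  [set v | `[< label_flooding t (spoint v) >]]%SET.

(* |D_n^L(t) (-) R({N, ..., ceil (N (1 - t / total_len))})| *)
Definition discrepancy (t : R) : nat :=
  let T := top_labels L (nat_ceil (#|svtx|%:R * (1 - t / total_len G))) in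
  #|((flooded t :\: T) :|: (T :\: flooded t))%SET|.

End LabelingFlooding.
End Subdivision.

(* Main.v *)
Require Import Defs.
From mathcomp Require Import all_boot all_order all_algebra all_fingroup.
From mathcomp Require Import boolp classical_sets reals sequences exp.
From mathcomp Require Import functions cardinality topology.
From mathcomp Require Import zify ring lra.

Set Implicit Arguments.
Unset Strict Implicit.
Unset Printing Implicit Defensive.

Import Order.TTheory GRing.Theory Num.Theory.

(** The proof counts labelings by the interleavings that they realize. Read a labeling from its
    largest label downwards: the vertices join one at a time. An event is the joining of a vertex of
    the original graph, of a peak, or of a vertex all of whose neighbors have joined before (two
    arms meet). Any other vertex has exactly one earlier neighbor ([non_event]), so it prolongs
    exactly one arm by one piece. Arms are opened only at original vertices and peaks, and every
    meeting closes two of them; hence the numbers of events and of arms are bounded in terms of the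
    graph and M alone ([card_evtx], [card_arms_at]).

    Between two consecutive events the joining vertices split into one chain per arm, and each chain
    joins in order. Interleaving the chains of a phase in any other way gives precisely the
    labelings with the same peaks, the same events and the same occupied sets at the events
    ([sorted_same_schedule], [same_schedule_sorted]). The size of such a class is a product of
    multinomial coefficients, one per phase, and Stirling's formula bounds its logarithm by n times
    the entropy of the flooding of the labeling, plus O(log n) ([class_size_le]). A class is
    described by boundedly many data, each with polynomially many values, so there are polynomially
    many classes ([max_classes_le]). Therefore the labelings of entropy at most b number at most
    exp(n b + O(log n)) ([card_low_entropy]).

    Conversely, take a flooding f with K sources, K at most M. Let the vertices join in the order of
    the phases that cover them and, inside a phase, in the order in which each arm sweeps them. The
    same count gives at least exp(n b - O(log n)) labelings, with b the entropy of f
    ([flood_class_size]), and each has at most K peaks, because distinct peaks lie at or next to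
    distinct sources ([card_peaks_flood]). Giving the top label to a vertex far from all peaks
    creates one more peak at the price of a polynomial factor ([card_labelings_S]). So the labelings
    with exactly M peaks number at least exp(n [max_entropy] - O(log n)) ([labelings_lower]).
    Dividing the two counts yields the first claim: what remains is exp(-n eps + O(log n)), and
    O(log n) is eventually below 2 log^2 n.

    For the second claim, fix a class. A uniform member is a uniform interleaving of the chains in
    each phase, so the share of a chain among the first vertices of its block behaves as in sampling
    without replacement, with variance at most the length of the chain ([block_concentration]).
    Chebyshev's inequality at a bounded number of thresholds shows that, outside an event of
    probability O(1/n), all chains advance in proportion to the phase, up to a small multiple of n
    ([card_irregular]). The flooding of the labeling moves its arms at constant speed, that is, also
    in proportion. Its vertices thus differ from the top labels only near the tips of the boundedly
    many arms, together with a bounded error that comes from comparing covered length with the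
    number of joined vertices ([nfilled_bounds], [discrepancy_le]). *)

(** * Permutations that preserve the fibres of a map *)

Section FibrePerm.
Import fintype finset.
Local Open Scope nat_scope.
Local Open Scope set_scope.
Variables (X K : finType) (g : X -> K).

Definition fibre_perm : {set {perm X}} :=
  [set s : {perm X} | [forall x, g (s x) == g x]]%SET.

Lemma fibre_permP (s : {perm X}) :
  reflect (forall x, g (s x) = g x) (s \in fibre_perm).
Proof. by rewrite inE; apply: (iffP forallP) => h x; apply/eqP. Qed.

Let above (r : seq K) : {set X} := [set x | g x \in r]%SET.

(** Induction on the list of values: a fibre-preserving permutation supported above [k :: r] is, in
    exactly one way, the product of one supported above [r] and one supported on the fibre of
    [k]. *)
Lemma card_fibre_perm_seq (r : seq K) : uniq r ->
  #|[set s in fibre_perm | perm_on (above r) s]%SET| =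
  \prod_(k <- r) (#|[set x | g x == k]%SET|)`!.
Proof.
elim: r => [_|k r ih /= /andP[kr ur]].
  rewrite big_nil; apply/eqP/cards1P; exists 1%g; apply/setP => s.
  rewrite !inE; apply/andP/eqP => [[_ /subsetP h]|->].
    apply/permP => x; rewrite perm1; apply/eqP/negPn/negP => hx.
    by have := h x hx; rewrite inE.
  split; first by apply/forallP => x; rewrite perm1.
  by apply/subsetP => x; rewrite inE perm1 eqxx.
rewrite big_cons mulnC -(ih ur).
rewrite -(card_perm [set x | g x == k]%SET) -[#|perm_on _|]cardsE -cardsX.
set D := finset.setX _ _.
have D1 p : p \in D -> forall x, g x \in r -> p.2 x = x.
  case: p => s t /setXP[_]; rewrite inE /= => ht x xr.
  apply: (out_perm ht); rewrite inE; apply: contra kr => /eqP <- //.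
have D2 p : p \in D -> forall x, g x \notin r -> p.1 x = x.
  case: p => s t /setXP[]; rewrite inE /= => /andP[_ hs] _ x xr.
  by apply: (out_perm hs); rewrite inE.
have D3 p : p \in D -> forall x, g (p.1 x) = g x.
  by case: p => s t /setXP[]; rewrite inE /= => /andP[/fibre_permP hs _].
have D4 p : p \in D -> forall x, g (p.2 x) = g x.
  case: p => s t /setXP[_]; rewrite inE /= => ht x.
  have [xk|xk] := eqVneq (g x) k; last by rewrite (out_perm ht) // inE.
  by have := perm_closed x ht; rewrite !inE xk eqxx => /eqP.
rewrite -(card_in_imset (f := fun p : {perm X} * {perm X} => (p.1 * p.2)%g)).
  apply: eq_card => s; apply/idP/imsetP => [|[p pD ->]]; last first.
    rewrite inE; apply/andP; split.
      by apply/fibre_permP => x; rewrite permM D4 // D3.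
    apply/subsetP => x; rewrite inE permM; rewrite !inE.
    apply: contraR; rewrite negb_or => /andP[xk xr].
    case: p pD => s' t /= pD; rewrite (D2 _ pD) //.
    by case/setXP: pD => _; rewrite inE => ht; rewrite (out_perm ht) // inE.
  rewrite inE => /andP[/fibre_permP hs os].
  have nA (P : pred K) : s \in ('N([set x | P (g x)]%SET | 'P))%g.
    by apply/astabsP => x; rewrite !inE /= apermE hs.
  (* The factors are the restrictions of [s], which stabilizes every union of fibres. *)
  exists (restr_perm (above r) s, restr_perm [set x | g x == k]%SET s).
    apply/setXP; split; last by rewrite finset.in_set; exact: restr_perm_on.
    rewrite finset.in_set; apply/andP; split; last exact: restr_perm_on.
    apply/fibre_permP => x.
    have [xr|xr] := boolP (x \in above r).
      by rewrite restr_permE ?nA // hs.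
    by rewrite (out_perm (restr_perm_on _ _)).
  apply/permP => x; rewrite permM /=.
  have [xr|xr] := boolP (x \in above r).
    rewrite (restr_permE (nA (fun z => z \in r))) //.
    rewrite (out_perm (restr_perm_on _ _)) // inE hs.
    by apply: contra kr => /eqP <-; move: xr; rewrite inE.
  rewrite (out_perm (restr_perm_on _ s) (x := x)) //.
  have [xk|xk] := boolP (x \in [set x | g x == k]%SET).
    by rewrite (restr_permE (nA (fun z => z == k))).
  rewrite (out_perm (restr_perm_on _ s)) // (out_perm os) //.
  by move: xr xk; rewrite !inE negb_or => -> ->.
move=> p p' pD pD' /= e.
have e' x : p.2 (p.1 x) = p'.2 (p'.1 x) by rewrite -!permM e.
rewrite [p]surjective_pairing [p']surjective_pairing; congr pair.
  apply/permP => x; have [xr|xr] := boolP (g x \in r).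
    by have := e' x; rewrite (D1 _ pD) ?D3 // (D1 _ pD') ?D3.
  by rewrite (D2 _ pD) // (D2 _ pD').
apply/permP => x; have [xr|xr] := boolP (g x \in r).
  by rewrite (D1 _ pD) // (D1 _ pD').
by have := e' x; rewrite (D2 _ pD) // (D2 _ pD').
Qed.

Lemma card_fibre_perm :
  #|fibre_perm| = \prod_(k : K) (#|[set x | g x == k]%SET|)`!.
Proof.
have := card_fibre_perm_seq (enum_uniq K); rewrite big_enum /= => <-.
apply: eq_card => s; rewrite [in RHS]inE andbC.
suff -> : perm_on (above (enum K)) s by [].
by apply/subsetP => x; rewrite !inE mem_enum.
Qed.

End FibrePerm.

Lemma card_ord_lt n m : (m <= n)%N -> #|[set l : 'I_n | (l < m)%N]%SET| = m.
Proof.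
move=> mn; rewrite -sum1dep_card big_ord_narrow //.
by rewrite sum_nat_const card_ord muln1.
Qed.

Lemma card_ord_ge n m : #|[set l : 'I_n | (m <= l)%N]%SET| = (n - m)%N.
Proof.
have -> : [set l : 'I_n | (m <= l)%N]%SET = (~: [set l : 'I_n | (l < m)%N])%SET.
  by apply/setP => l; rewrite !inE leqNgt.
rewrite cardsCs finset.setCK card_ord; have [mn|nm] := leqP m n.
  by rewrite card_ord_lt.
rewrite (_ : [set _ | _]%SET = [set: 'I_n]%SET) ?cardsT ?card_ord; first by lia.
by apply/setP => l; rewrite !inE (ltn_trans _ nm).
Qed.

(** * Schedules: successive blocks made of interleaved chains, and the labelings that follow them *)

Section Schedule.
Import fintype finset.
Local Open Scope nat_scope.
Variables (X I : finType) (B : nat).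
Local Notation N := #|X|.
Local Notation lab := {ffun X -> 'I_N}.

(** Blocks join one after the other. Inside a block, the elements with the same [arm] form a chain
    that joins in increasing order of [pos], and different chains interleave freely. Labelings and
    floodings are both turned into schedules, so that one count serves for both bounds. *)
Record schedule := Schedule {
  blk : X -> 'I_B;
  arm : X -> I;
  pos : X -> nat
}.

Variable S : schedule.

Definition chain_of (x : X) := (blk S x, arm S x).

Hypothesis pos_inj : forall x y,
  chain_of x = chain_of y -> pos S x = pos S y -> x = y.

Definition compat : {set lab} := [set L : lab | injectiveb L &
  [forall x, forall y, (blk S x < blk S y) ==> (L y < L x)]]%SET.

Definition sorted_labs : {set lab} := [set L in compat |
  [forall x, forall y, (chain_of x == chain_of y) && (pos S x < pos S y) ==>
     (L y < L x)]]%SET.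

Lemma compatP (L : lab) : reflect (injective L /\
  forall x y, blk S x < blk S y -> L y < L x) (L \in compat).
Proof.
rewrite inE; apply: (iffP andP) => [[/injectiveP i /forallP h]|[i h]].
  by split=> // x y; have /forallP/(_ y)/implyP := h x.
split; first exact/injectiveP.
by apply/forallP => x; apply/forallP => y; apply/implyP/h.
Qed.

Lemma sorted_labsP (L : lab) : reflect (L \in compat /\
  forall x y, chain_of x = chain_of y -> pos S x < pos S y -> L y < L x)
  (L \in sorted_labs).
Proof.
rewrite [L \in sorted_labs]inE; apply: (iffP andP) => [[i /forallP h]|[i h]].
  split=> // x y e p; have /forallP/(_ y)/implyP := h x.
  by apply; rewrite e eqxx.
split=> //; apply/forallP => x; apply/forallP => y.
by apply/implyP => /andP[/eqP]; exact: h.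
Qed.

Definition lperm (L : lab) (s : {perm X}) : lab := [ffun x => L (s x)].

Lemma lpermM L s t : lperm (lperm L s) t = lperm L (t * s)%g.
Proof. by apply/ffunP => x; rewrite !ffunE permM. Qed.

Lemma lperm1 L : lperm L 1%g = L.
Proof. by apply/ffunP => x; rewrite ffunE perm1. Qed.

Lemma lperm_inj (L : lab) : injective L -> injective (lperm L).
Proof.
move=> iL s t e; apply/permP => x; apply: iL.
by have := congr1 (fun f : lab => f x) e; rewrite !ffunE.
Qed.

Local Notation Y := (fibre_perm (blk S)).
Local Notation H := (fibre_perm chain_of).

Lemma chain_perm_sub s : s \in H -> s \in Y.
Proof.
by move=> /fibre_permP h; apply/fibre_permP => x; case: (h x).
Qed.

Lemma fibre_permM (K : finType) (g : X -> K) s t :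
  s \in fibre_perm g -> t \in fibre_perm g -> (s * t)%g \in fibre_perm g.
Proof.
move=> /fibre_permP hs /fibre_permP ht; apply/fibre_permP => x.
by rewrite permM ht hs.
Qed.

Lemma fibre_permV (K : finType) (g : X -> K) s :
  s \in fibre_perm g -> (s^-1)%g \in fibre_perm g.
Proof.
move=> /fibre_permP hs; apply/fibre_permP => x.
by rewrite -{2}(permKV s x) hs.
Qed.

Lemma compat_perm L s : L \in compat -> s \in Y -> lperm L s \in compat.
Proof.
move=> /compatP[iL hL] /fibre_permP hs; apply/compatP; split.
  by move=> x y; rewrite !ffunE => /iL /perm_inj.
by move=> x y xy; rewrite !ffunE hL // !hs.
Qed.

(** The compatible labelings form a single orbit of the block-preserving permutations: the labels
    used by an initial union of blocks are forced to be the largest ones. *)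
Lemma compat_lperm L0 L : L0 \in compat -> L \in compat ->
  exists2 s, s \in Y & L = lperm L0 s.
Proof.
move=> /compatP[i0 h0] /compatP[iL hL].
have bij0 : bijective L0 by apply: inj_card_bij => //; rewrite card_ord.
case: bij0 => g gK Kg.
have is_inj : injective (g \o L) by move=> x y /= /(can_inj Kg) /iL.
exists (perm is_inj); last first.
  by apply/ffunP => x; rewrite ffunE permE /= Kg.
pose s := perm is_inj.
have Ls x : L0 (s x) = L x by rewrite permE /= Kg.
(* the labels of the blocks before b are the same top labels in L and in L0 *)
pose F b := [set x | blk S x < b]%SET.
have top (L' : lab) b : injective L' -> (forall x y, blk S x < blk S y -> L' y < L' x) ->
    L' @: F b = [set l : 'I_N | N - #|F b| <= l]%SET.
  move=> i' h'; apply/eqP; rewrite eqEcard; apply/andP; split; last first.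
    by rewrite (card_imset _ i') card_ord_ge subKn ?max_card.
  apply/subsetP => l /imsetP[x xF ->]; rewrite inE.
  have -> : N - #|F b| = #|~: (L' @: F b)|.
    by rewrite -[in LHS](card_ord N) -(cardsC (L' @: F b)) card_imset // addKn.
  rewrite -[X in _ <= X](card_ord_lt (ltnW (ltn_ord (L' x)))).
  apply: subset_leq_card; apply/subsetP => l'; rewrite !inE => hl.
  have c : #|'I_N| <= #|X| by rewrite card_ord.
  have /codomP[y ey] := inj_card_onto i' c l'.
  move: hl xF; rewrite ey mem_imset // !inE -leqNgt => by_ xb.
  by apply: h'; apply: leq_trans xb by_.
apply/fibre_permP => x; apply/val_inj/eqP.
have same b : (blk S (s x) < b) = (blk S x < b).
  have E (L' : lab) (i' : injective L') z : (L' z \in L' @: F b) = (blk S z < b).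
    by rewrite mem_imset // inE.
  by rewrite -(E _ i0) -(E _ iL) Ls !top.
by rewrite eqn_leq -ltnS same ltnSn -ltnS -same ltnSn.
Qed.

(** Among the elements moved by [h], take one of least position. Its image and its preimage both
    come later in the chain, and sortedness of the two labelings then orders the same pair of labels
    in opposite ways. *)
Lemma sorted_unique L h : L \in sorted_labs -> h \in H ->
  lperm L h \in sorted_labs -> h = 1%g.
Proof.
move=> /sorted_labsP[_ sL] /fibre_permP hH /sorted_labsP[_ sLh].
apply/permP => x0; rewrite perm1; apply/eqP/negPn/negP => hx0.
case: (@arg_minnP _ x0 (fun x => h x != x) (pos S) hx0) => x hx min.
have lt y : chain_of y = chain_of x -> y != x -> h y != y -> pos S x < pos S y.
  move=> cy yx hy; rewrite ltn_neqAle min // andbT.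
  by apply: contra yx => /eqP /(pos_inj (esym cy)) ->.
have xhx : pos S x < pos S (h x).
  by apply: lt => //; apply: contra hx => /eqP /perm_inj /eqP.
have l1 := sL x (h x) (esym (hH x)) xhx.
pose z := (h^-1)%g x; have hz : h z = x by rewrite /z permKV.
have zx : z != x by apply: contra hx => /eqP zx; rewrite -{1}zx hz.
have l2 := sLh x z; rewrite !ffunE hz in l2.
have cz : chain_of x = chain_of z by rewrite -hz hH.
have := l2 cz; rewrite lt // ?hz 1?eq_sym // => /(_ isT) l3.
by have := ltn_trans l1 l3; rewrite ltnn.
Qed.

(** The step, counted from 0, at which [x] joins when elements are taken in decreasing order of
    label. *)
Definition ltime (L : lab) (x : X) : nat := N.-1 - L x.

Lemma ltime_lt L x y : (ltime L x < ltime L y) = (L y < L x).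
Proof.
rewrite /ltime; have := ltn_ord (L x); have := ltn_ord (L y); lia.
Qed.

Lemma ltime_inj (L : lab) : injective L -> injective (ltime L).
Proof.
move=> iL x y e; apply: iL; apply: ord_inj; apply/eqP.
have [lt|gt|//] := ltngtP (L x) (L y).
  by move: lt; rewrite -ltime_lt e ltnn.
by move: gt; rewrite -ltime_lt e ltnn.
Qed.

(* Rearrangement: among the relabelings of L along the chains, one that
   maximizes the sum of pos * ltime has no inversion. *)
Lemma sorted_exists L : L \in compat ->
  exists2 h, h \in H & lperm L h \in sorted_labs.
Proof.
move=> cL; have h1 : (1%g : {perm X}) \in H by apply/fibre_permP => x; rewrite perm1.
pose F (h : {perm X}) := \sum_x pos S x * ltime L (h x).
case: (@arg_maxnP _ _ (fun h => h \in H) F h1) => h hH hmax.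
exists h => //; apply/sorted_labsP; split.
  by apply: compat_perm => //; apply: chain_perm_sub.
move=> x y cxy pxy; rewrite !ffunE -ltime_lt ltnNge; apply/negP => le.
have nxy : x != y by apply: contraTneq pxy => ->; rewrite ltnn.
have lt : ltime L (h y) < ltime L (h x).
  rewrite ltn_neqAle le andbT; apply: contra nxy => /eqP e.
  have /compatP[iL _] := cL.
  by rewrite (perm_inj (ltime_inj iL e)).
pose h' := (tperm x y * h)%g.
have h'H : h' \in H.
  apply: fibre_permM => //; apply/fibre_permP => z.
  by case: tpermP => // ->.
have := hmax _ h'H; apply/negP; rewrite -ltnNge /F.
rewrite (bigD1 x) //= (bigD1 y) 1?eq_sym //= [X in _ < X](bigD1 x) //=.
rewrite [X in _ < _ + X](bigD1 y) 1?eq_sym //= !permM tpermL tpermR.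
rewrite (eq_bigr (fun z => pos S z * ltime L (h' z))); last first.
  by move=> z /andP[zx zy]; rewrite permM tpermD // eq_sym.
set r := \sum_(_ | _) _; rewrite !addnA ltn_add2r.
move: pxy lt; move: (pos S x) (pos S y) (ltime L (h x)) (ltime L (h y)).
move=> a b c d /subnK <- /subnK <-; set u := b - _; set v := c - _; clearbody u v.
nia.
Qed.

(** A compatible labeling is, in exactly one way, a sorted one rearranged along the chains. A
    property that such rearrangements respect is therefore as frequent among sorted labelings as
    among compatible ones; this carries the variance estimate over to the sorted labelings. *)
Lemma card_sorted_compat (P : pred lab) :
  (forall L h, L \in compat -> h \in H -> P (lperm L h) = P L) ->
  #|[set L in sorted_labs | P L]%SET| * #|H| = #|[set L in compat | P L]%SET|.
Proof.
move=> PH; rewrite -cardsX -(card_in_imset (f := fun p : lab * {perm X} => lperm p.1 p.2)).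
  apply: eq_card => L; apply/imsetP/idP => [[[L' h]]|].
    rewrite finset.in_setX finset.in_set => /andP[/andP[/sorted_labsP[cL _] PL hH]] -> /=.
    rewrite finset.in_set PH //; rewrite PL compat_perm //; exact: chain_perm_sub.
  rewrite inE => /andP[cL PL]; have [h hH sL] := sorted_exists cL.
  exists (lperm L h, (h^-1)%g); last by rewrite lpermM mulVg lperm1.
  rewrite finset.in_setX /=; apply/andP; split; last exact: fibre_permV.
  by rewrite finset.in_set sL PH.
move=> [L h] [L' h']; rewrite !finset.in_setX /= !(finset.in_set (fun L => (L \in sorted_labs) && P L)).
move=> /andP[/andP[sL _] hH] /andP[/andP[sL' _] hH'] e.
have e2 : L' = lperm L (h'^-1 * h)%g.
  by rewrite -lpermM e lpermM mulVg lperm1.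
have : (h'^-1 * h)%g = 1%g.
  apply: (sorted_unique sL); last by rewrite -e2.
  by apply: fibre_permM => //; apply: fibre_permV.
move=> e3; move: e2; rewrite e3 lperm1 => ->; congr pair.
by rewrite -[h']mulg1 -e3 mulKVg.
Qed.

Lemma card_sorted_perm : #|sorted_labs| * #|H| = #|compat|.
Proof.
have := @card_sorted_compat xpredT (fun _ _ _ _ => erefl).
have e (A : {set lab}) : [set L in A | xpredT L]%SET = A.
  by apply/setP => L'; rewrite inE andbT.
by rewrite !e.
Qed.

Lemma card_compat L : L \in compat -> #|compat| = #|Y|.
Proof.
move=> cL; have /compatP[iL _] := cL.
rewrite -(card_imset (mem Y) (lperm_inj iL)); apply: eq_card => L'.
apply/idP/imsetP => [cL'|[s sY ->]]; last exact: compat_perm.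
by have [s sY ->] := compat_lperm cL cL'; exists s.
Qed.

(** Hence the sorted labelings are counted by a product of multinomial coefficients, one for each
    block: they are the interleavings of the chains. *)
Lemma card_sorted L : L \in compat ->
  #|sorted_labs| * (\prod_(c : 'I_B * I) (#|[set x | chain_of x == c]%SET|)`!) =
  \prod_(b : 'I_B) (#|[set x | blk S x == b]%SET|)`!.
Proof.
by move=> cL; rewrite -!card_fibre_perm -(card_compat cL) card_sorted_perm.
Qed.

(** * Concentration of a subset of a block, by second moments *)

Section Concentration.
Local Open Scope ring_scope.
Variables (R : realFieldType) (L0 : lab) (cL0 : L0 \in compat).
Variables (b : 'I_B) (t : nat).
Let block := [set x | blk S x == b]%SET.
Let A : R := #|block|%:R.
Let q : R := #|[set x in block | (ltime L0 x < t)%N]%SET|%:R.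
(** The indicator of joining before [t], centred, and scaled by the size of the block to avoid a
    division. The count [q] is the same for every compatible labeling, although it is read off
    [L0]. *)
Let D (L : lab) x : R := A * (ltime L x < t)%N%:R - q.

Let card_early (L : lab) (c : {set X}) : #|[set x in c | (ltime L x < t)%N]%SET|%:R =
  \sum_(x in c) (ltime L x < t)%N%:R :> R.
Proof.
rewrite -sum1_card natr_sum [LHS](eq_bigl (fun x => (x \in c) && (ltime L x < t)%N)).
  by rewrite big_mkcondr; apply: eq_bigr => x _; case: ifP.
by move=> x; rewrite inE.
Qed.

Let sum_D L : L \in compat -> \sum_(x in block) D L x = 0.
Proof.
move=> cL; rewrite sumrB -mulr_sumr -card_early sumr_const -(mulr_natl q).
rewrite (_ : #|[set x in block | (ltime L x < t)%N]%SET|%:R = q) ?subrr //.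
have [s /fibre_permP sY ->] := compat_lperm cL0 cL.
congr _%:R; rewrite -[RHS](card_imset _ (@perm_inj _ s^-1%g)).
apply: eq_card => x; apply/idP/imsetP => [|[y + ->]]; rewrite !inE /ltime ffunE.
  by move=> h; exists (s x); rewrite ?permK // !inE sY /ltime.
by rewrite permKV -{1}(permKV s y) sY.
Qed.

Let cov (x y : X) : R := \sum_(L in compat) D L x * D L y.

(** Transposing two elements of the block permutes the compatible labelings. *)
Let cov_swap x y y' : y \in block -> y' \in block -> y != x -> y' != x ->
  cov x y = cov x y'.
Proof.
rewrite !inE => /eqP yb /eqP yb' yx yx'; rewrite /cov.
have tY : tperm y y' \in Y.
  by apply/fibre_permP => z; case: tpermP => // ->; rewrite yb yb'.
have inv : involutive (fun L => lperm L (tperm y y')).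
  by move=> L; rewrite lpermM tperm2 lperm1.
rewrite (reindex_inj (inv_inj inv)) /=; apply: eq_big => [L|L cL].
  apply/idP/idP => h; last exact: compat_perm.
  by rewrite -[L]inv; apply: compat_perm.
congr (_ * _); first by rewrite /D /ltime ffunE tpermD.
by rewrite /D /ltime ffunE tpermL.
Qed.

(** The covariances of [x] with the whole block sum to zero, the diagonal one is nonnegative, and
    all others are equal. *)
Let cov_le0 x y : x \in block -> y \in block -> y != x -> cov x y <= 0.
Proof.
move=> xb yb yx.
have : \sum_(z in block) cov x z = 0.
  rewrite exchange_big /= big1 // => L cL.
  by rewrite -mulr_sumr sum_D // mulr0.
rewrite (bigD1 x) //= (eq_bigr (fun=> cov x y)); last first.
  by move=> z /andP[zb zx]; apply: cov_swap.
rewrite sumr_const => e.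
have : cov x y *+ #|[pred z in block | z != x]| <= 0.
  have : 0 <= cov x x by apply: sumr_ge0 => L _; rewrite -expr2 sqr_ge0.
  by move: e; set u := _ *+ _; set v := cov x x => e v0; lra.
rewrite pmulrn_lle0 //; apply/card_gt0P; exists y.
by rewrite inE /= yb yx.
Qed.

(** Negative correlation leaves only the diagonal terms of the second moment, and each centred
    indicator is at most [A] in absolute value. *)
Lemma block_concentration (c : {set X}) : c \subset block ->
  \sum_(L in compat)
     (A * #|[set x in c | (ltime L x < t)%N]%SET|%:R - #|c|%:R * q) ^+ 2
  <= #|compat|%:R * #|c|%:R * A ^+ 2.
Proof.
move=> /subsetP cb.
have -> : \sum_(L in compat)
     (A * #|[set x in c | (ltime L x < t)%N]%SET|%:R - #|c|%:R * q) ^+ 2 =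
     \sum_(x in c) \sum_(y in c) cov x y.
  rewrite (eq_bigr (fun L => \sum_(x in c) \sum_(y in c) D L x * D L y)).
    rewrite exchange_big; apply: eq_bigr => x _.
    by rewrite exchange_big.
  move=> L _; under eq_bigr do rewrite -mulr_sumr.
  rewrite -mulr_suml -expr2; congr (_ ^+ 2).
  by rewrite sumrB -mulr_sumr -card_early sumr_const -(mulr_natl q).
have -> : #|compat|%:R * #|c|%:R * A ^+ 2 = \sum_(x in c) #|compat|%:R * A ^+ 2.
  rewrite sumr_const -[RHS]mulr_natl; ring.
apply: ler_sum => x xc; rewrite (bigD1 x) //= -[leRHS]addr0 lerD //; last first.
  rewrite -oppr_ge0 -sumrN; apply: sumr_ge0 => y /andP[yc yx].
  by rewrite oppr_ge0 cov_le0 ?cb.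
rewrite /cov mulr_natl -sumr_const; apply: ler_sum => L cL.
rewrite -expr2 -(real_normK (num_real (D L x))) lerXn2r ?nnegrE ?normr_ge0 ?ler0n //.
have qA : q <= A.
  rewrite ler_nat; apply: subset_leq_card; apply/subsetP => z.
  by rewrite inE => /andP[].
have q0 : 0 <= q by [].
rewrite /D; case: (_ < _)%N => /=; rewrite ?mulr1 ?mulr0.
  by rewrite ger0_norm ?subr_ge0 // gerBl.
by rewrite sub0r normrN ger0_norm.
Qed.

End Concentration.

End Schedule.

(** * Estimates for x ln x and Stirling's formula *)

Section EntropyFunction.
Local Open Scope ring_scope.
Variable R : realType.
Implicit Types x y B c : R.

Lemma ln_le_subr1 x : 0 < x -> ln x <= x - 1.
Proof. by move=> x0; have := expR_ge1Dx (ln x); rewrite lnK //; lra. Qed.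

Lemma ln_ge_subV x : 0 < x -> 1 - x^-1 <= ln x.
Proof.
by move=> x0; have := @ln_le_subr1 x^-1; rewrite invr_gt0 lnV // => /(_ x0); lra.
Qed.

Definition xlnx x : R := x * ln x.

Lemma xlnx0 : xlnx 0 = 0. Proof. exact: mul0r. Qed.

Lemma xlnx_ge x : 0 <= x -> x - 1 <= xlnx x.
Proof.
rewrite le0r => /predU1P[->|x0]; first by rewrite xlnx0; lra.
have := ln_ge_subV x0; rewrite -(ler_pM2l x0) /xlnx mulrBr mulr1 mulfV //.
by rewrite gt_eqF.
Qed.

Lemma xlnx_superadd x y : 0 <= x -> 0 <= y -> xlnx x + xlnx y <= xlnx (x + y).
Proof.
rewrite le0r => /predU1P[->|x0]; first by rewrite xlnx0 !add0r.
rewrite le0r => /predU1P[->|y0]; first by rewrite xlnx0 !addr0.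
have h1 : ln x <= ln (x + y) by rewrite ler_ln ?posrE ?lerDl ?addr_gt0 // ltW.
have h2 : ln y <= ln (x + y) by rewrite ler_ln ?posrE ?lerDr ?addr_gt0 // ltW.
rewrite /xlnx mulrDl lerD // ler_pM2l //.
Qed.

Lemma xlnx_tangent x y : 0 <= x -> 0 < y ->
  xlnx y + (x - y) * (1 + ln y) <= xlnx x.
Proof.
rewrite le0r => /predU1P[->|x0] y0; first by rewrite xlnx0 /xlnx; nra.
have xy : 0 < y / x by rewrite divr_gt0.
have := ln_le_subr1 xy; rewrite lnM ?posrE ?invr_gt0 // lnV //.
rewrite -(ler_pM2l x0) mulrBr mulrBr mulr1 mulrCA mulfV ?gt_eqF // /xlnx.
by nra.
Qed.

(** Perturbing the argument by [c] costs only O(ln B). For y below x this is superadditivity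
    together with x ln x being at least -1; otherwise it is the tangent line at y. *)
Lemma xlnx_near x y B c : 0 <= x -> 0 <= y -> y <= B -> 1 <= B ->
  `|x - y| <= c -> xlnx y <= xlnx x + 1 + c * (1 + ln B).
Proof.
move=> x0 y0 yB B1 xyc.
have lnB : 0 <= ln B by rewrite ln_ge0.
have c0 : 0 <= c by apply: le_trans xyc.
have p : 0 <= c * (1 + ln B) by rewrite mulr_ge0 // addr_ge0.
have [yx|xy] := leP y x.
  have := @xlnx_superadd y (x - y) y0; rewrite subr_ge0 [y + _]addrC subrK => /(_ yx).
  have := @xlnx_ge (x - y); rewrite subr_ge0 => /(_ yx).
  by move: p; set u := c * _; lra.
have y1 : 0 < y by apply: le_lt_trans xy.
have := xlnx_tangent x0 y1.
have lnyB : ln y <= ln B by rewrite ler_ln ?posrE //; apply: lt_le_trans yB.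
have : y - x <= c by apply: le_trans xyc; rewrite distrC ler_norm.
have : 0 <= y - x by lra.
have : (y - x) * (1 + ln y) <= (y - x) * (1 + ln B) by rewrite ler_wpM2l; lra.
have : (y - x) * (1 + ln B) <= c * (1 + ln B) -> True by [].
move=> _ h1 h0 h2.
have : (y - x) * (1 + ln B) <= c * (1 + ln B) by rewrite ler_wpM2r // addr_ge0.
by move: h1; move: (ln B) (ln y) => u v; nra.
Qed.

(** The increment of x ln x - x between x and x + 1 is at most ln (x + 1), because x ln ((x + 1) /
    x) is at most 1. *)
Lemma ln_fact_ge (a : nat) : xlnx a%:R - a%:R <= ln (a`!)%:R.
Proof.
elim: a => [|a ih]; first by rewrite xlnx0 fact0 ln1 subrr.
rewrite factS natrM lnM ?posrE ?ltr0n ?fact_gt0 //.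
apply: le_trans (lerD (lexx _) ih).
case: a {ih} => [|a]; first by rewrite xlnx0 /xlnx ln1; lra.
rewrite /xlnx -[a.+2%:R]natr1; set x := a.+1%:R; have x0 : 0 < x by [].
have := @ln_le_subr1 ((x + 1) / x).
rewrite divr_gt0 ?addr_gt0 // => /(_ isT).
rewrite lnM ?posrE ?invr_gt0 ?addr_gt0 // lnV ?posrE //.
rewrite mulrDl mulfV ?gt_eqF // mul1r [_ + x^-1]addrC addrK.
rewrite -(ler_pM2l x0) mulfV ?gt_eqF //.
by move: (ln (x + 1)) (ln x) => u v; nra.
Qed.

(** By induction with ln a in place of ln B; the bound [B] makes the error uniform and covers a =
    0. *)
Lemma ln_fact_le (a : nat) B : a%:R <= B -> 1 <= B ->
  ln (a`!)%:R <= xlnx a%:R - a%:R + 1 + ln B.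
Proof.
move=> aB B1; case: a aB => [|a] aB.
  by rewrite xlnx0 fact0 ln1; have := ln_ge0 B1; lra.
suff : ln (a.+1`!)%:R <= xlnx a.+1%:R - a.+1%:R + 1 + ln a.+1%:R :> R.
  have : ln a.+1%:R <= ln B by rewrite ler_ln ?posrE // (lt_le_trans _ aB).
  by lra.
elim: a {aB B1} => [|a ih]; first by rewrite /xlnx factS fact0 muln1 ln1; lra.
rewrite factS natrM lnM ?posrE ?ltr0n ?fact_gt0 //.
apply: le_trans (lerD (lexx _) ih) _.
rewrite /xlnx -[a.+2%:R]natr1; set x := a.+1%:R; have x0 : 0 < x by [].
have x1 : 0 < x + 1 by rewrite addr_gt0.
have := @ln_le_subr1 (x / (x + 1)); rewrite divr_gt0 // => /(_ isT).
rewrite lnM ?posrE ?invr_gt0 // lnV ?posrE //.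
have -> : x / (x + 1) - 1 = - (x + 1)^-1.
  by rewrite -[X in _ - X](@mulfV _ (x + 1)) ?gt_eqF //; ring.
rewrite -(ler_pM2l x1) mulrN mulfV ?gt_eqF //.
by move: (ln (x + 1)) (ln x) => u v; nra.
Qed.

End EntropyFunction.

(** * The subdivision graph *)

Section SubdivisionGraph.
Import fintype finset.
Local Open Scope nat_scope.
Variables (R : realType) (G : metric_graph R) (n : nat).
Hypothesis n_gt0 : 0 < n.
Local Notation pieces := (@pieces R G n).
Local Notation svtx := (@svtx R G n).
Local Notation svert := (@svert R G n).
Local Notation neighbors := (@neighbors R G n).

Lemma nat_ceilP (x : R) : (0 <= x -> x <= (nat_ceil x)%:R < x + 1)%R.
Proof.
move=> x0; rewrite /nat_ceil natr_absz.
have c0 : (0 <= Num.ceil x)%R by rewrite ceil_ge0; apply: lt_le_trans x0; rewrite ltrN10.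
have /andP[h1 h2] := ceil_itv x; rewrite ger0_norm // h2 /=.
by move: h1; rewrite intrB ltrBlDr.
Qed.

Lemma pieces_bounds e :
  (n%:R * len e <= (pieces e)%:R < n%:R * len e + 1)%R.
Proof. by apply: nat_ceilP; rewrite mulr_ge0 // ltW // len_gt0. Qed.

Lemma pieces_gt0 e : 0 < pieces e.
Proof.
have /andP[h _] := pieces_bounds e; rewrite -(@ltr0n R).
by apply: lt_le_trans h; rewrite mulr_gt0 ?ltr0n ?len_gt0.
Qed.

Lemma svert0 e : svert e 0 = inl (src e). Proof. by []. Qed.

Lemma svert_end e i : pieces e <= i -> svert e i = inl (tgt e).
Proof.
move=> pi; rewrite /Defs.svert; have := pieces_gt0 e.
case: i pi => [|i] pi p0; first by lia.
by rewrite /= insubF //; apply/negbTE; rewrite -leqNgt; lia.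
Qed.

Lemma svert_inner e i : 0 < i -> i < pieces e ->
  exists2 j : 'I_(pieces e).-1, j.+1 = i &
    svert e i = inr (existT (fun e => 'I_(pieces e).-1) e j).
Proof.
case: i => // i _ pi; have h : i < (pieces e).-1 by lia.
by exists (Ordinal h) => //; rewrite /Defs.svert /= insubT.
Qed.

Lemma original_svert e i : original (svert e i) = (i == 0) || (pieces e <= i).
Proof.
have [->|i0] := posnP i; first by [].
have [pi|ip] := leqP (pieces e) i; first by rewrite svert_end // orbT.
by have [j _ ->] := svert_inner i0 ip.
Qed.


Lemma svert_inner_inj e i e' i' : 0 < i -> i < pieces e ->
  svert e i = svert e' i' -> e = e' /\ i = i'.
Proof.
move=> i0 ip h; have := congr1 (@original R G n) h.
rewrite !original_svert eqn0Ngt i0 leqNgt ip /=.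
have [//|i'0] := posnP i'; have [//|ip'] := leqP (pieces e') i' => _.
move: h; have [j <- ->] := svert_inner i0 ip; have [j' <- ->] := svert_inner i'0 ip'.
pose f (v : svtx) := if v is inr (existT e j) then Some (e, j.+1) else None.
by move=> /(congr1 f) [ee jj]; split; [exact: ee | rewrite jj].
Qed.

Lemma svert_inj e i j : i <= pieces e -> j <= pieces e ->
  svert e i = svert e j -> i = j.
Proof.
move=> ip jp h; have p0 := pieces_gt0 e.
have [/andP[i0 ilt]|ni] := boolP (0 < i < pieces e).
  by have [] := svert_inner_inj i0 ilt h.
have [/andP[j0 jlt]|nj] := boolP (0 < j < pieces e).
  by have [] := svert_inner_inj j0 jlt (esym h).
have {ni} : i = 0 \/ i = pieces e by lia.
have {nj} : j = 0 \/ j = pieces e by lia.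
have st : inl (src e) <> inl (tgt e) :> svtx.
  by move=> [] /eqP; apply/negP/no_loop.
move=> [ej|ej] [ei|ei]; move: h; rewrite ei ej ?svert0 ?svert_end //.
by move=> /esym.
Qed.

(** Presents new vertices as [svert e i] with i strictly inside the path, which hides the dependent
    pairs of their encoding. *)
Variant svtx_spec : svtx -> Prop :=
  | SvtxOriginal u : svtx_spec (inl u)
  | SvtxInner e i : 0 < i -> i < pieces e -> svtx_spec (svert e i).

Lemma svtxP v : svtx_spec v.
Proof.
case: v => [u|[e j]]; first exact: SvtxOriginal.
have h : j.+1 < pieces e by have := ltn_ord j; lia.
have [j' jj' e'] := svert_inner (ltn0Sn j) h.
rewrite (_ : inr _ = svert e j.+1); first exact: SvtxInner.
by rewrite e'; congr (inr (existT _ _ _)); apply: ord_inj; lia.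
Qed.

Lemma svtx_on_edge v : exists e i, i <= pieces e /\ v = svert e i.
Proof.
case: (svtxP v) => [u|e i i0 ip]; last by exists e, i; rewrite ltnW.
have [e /orP[]/eqP <-] := vtx_edge u.
  by exists e, 0.
by exists e, (pieces e); rewrite svert_end.
Qed.

Lemma neighborsP u v : reflect
  (exists e i, i < pieces e /\
     (u = svert e i /\ v = svert e i.+1 \/ u = svert e i.+1 /\ v = svert e i))
  (neighbors u v).
Proof.
apply: (iffP existsP) => [[[e i] h]|[e [i [ip h]]]].
  exists e, i; split; first exact: ltn_ord.
  by case/orP: h => /andP[/eqP <- /eqP <-]; [left|right].
exists (existT _ e (Ordinal ip)); rewrite /joins /ssrc /stgt /=.
by case: h => [[-> ->]|[-> ->]]; rewrite !eqxx ?orbT.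
Qed.

Lemma neighbors_sym : symmetric neighbors.
Proof.
move=> u v; apply/neighborsP/neighborsP => -[e [i [ip h]]];
  exists e, i; split=> //; tauto.
Qed.

Lemma neighbors_irr v : neighbors v v = false.
Proof.
apply/negbTE/negP => /neighborsP[e [i [ip h]]].
have : svert e i = svert e i.+1 by case: h => [[<- <-]|[<- <-]].
by move=> /svert_inj; lia.
Qed.

Lemma neighbors_svert e i : i < pieces e -> neighbors (svert e i) (svert e i.+1).
Proof. by move=> ip; apply/neighborsP; exists e, i; split=> //; left. Qed.

Lemma neighbors_inner e i v : 0 < i -> i < pieces e ->
  neighbors (svert e i) v = (v == svert e i.-1) || (v == svert e i.+1).
Proof.
move=> i0 ip; apply/idP/idP; last first.
  case/orP => /eqP ->; last exact: neighbors_svert.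
  by rewrite neighbors_sym -{2}(prednK i0) neighbors_svert //; lia.
case/neighborsP => e' [i' [ip' [[h ->]|[h ->]]]].
  by have [<- <-] := svert_inner_inj i0 ip h; rewrite eqxx orbT.
by have [<- ->] := svert_inner_inj i0 ip h; rewrite /= eqxx.
Qed.

Definition edge_from (v : svtx) : {set edg G * bool} :=
  [set p | [exists i : 'I_(pieces p.1), v == if p.2 then svert p.1 i else svert p.1 i.+1]]%SET.

(* A vertex has at most one neighbor along each edge in each direction. *)
Lemma degree_le v : #|[set y | neighbors v y]%SET| <= #|edg G|.*2.
Proof.
pose f (p : edg G * bool) : svtx :=
  if [pick i : 'I_(pieces p.1) | v == if p.2 then svert p.1 i else svert p.1 i.+1] is Some i
  then (if p.2 then svert p.1 i.+1 else svert p.1 i) else v.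
have -> : #|edg G|.*2 = #|{: edg G * bool}| by rewrite card_prod card_bool muln2.
rewrite -cardsT; apply: leq_trans (leq_imset_card f _).
apply: subset_leq_card; apply/subsetP => y; rewrite inE => /neighborsP[e [i [ip h]]].
case: h => [[hv hy]|[hv hy]]; apply/imsetP.
  exists (e, true) => //; rewrite /f /=; case: pickP => [j /eqP|/(_ (Ordinal ip))].
    by rewrite hv hy => /svert_inj -> //; rewrite ltnW // ltn_ord.
  by rewrite /= hv eqxx.
exists (e, false) => //; rewrite /f /=; case: pickP => [j /eqP|/(_ (Ordinal ip))].
  by rewrite hv hy => h; have [->] := svert_inj ip (ltn_ord j) h.
by rewrite /= hv eqxx.
Qed.

Lemma card_svtx : #|svtx| + #|edg G| = #|vtx G| + \sum_e pieces e.
Proof.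
rewrite card_sum card_tagged sumnE big_map big_enum /= -addnA.
congr addn; rewrite -[#|edg G|]sum1_card -big_split /=; apply: eq_bigr => e _.
by rewrite card_ord addn1 prednK // pieces_gt0.
Qed.

(** Connectivity as a closure principle: closure under neighbors propagates along each path, and
    from one original vertex to another because the graph is connected. *)
Lemma svtx_ind_connected (C : {set svtx}) :
  (forall u v, neighbors u v -> u \in C -> v \in C) -> C != finset.set0 -> C = [set: svtx]%SET.
Proof.
move=> cl /set0Pn[v0 v0C].
have along e i j : i <= pieces e -> j <= pieces e -> svert e i \in C -> svert e j \in C.
  have up k : svert e k \in C -> forall m, k + m <= pieces e -> svert e (k + m) \in C.
    move=> kC; elim=> [|m ih] h; first by rewrite addn0.
    by rewrite addnS; apply: cl (ih _); rewrite ?neighbors_svert //; lia.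
  have dn k : svert e k \in C -> forall m, k <= pieces e -> svert e (k - m) \in C.
    move=> kC; elim=> [|m ih] h; first by rewrite subn0.
    have [km|km] := leqP k m; first by rewrite (_ : k - m.+1 = k - m) ?ih //; lia.
    apply: cl (ih h); rewrite neighbors_sym (_ : k - m = (k - m.+1).+1); last by lia.
    by rewrite neighbors_svert //; lia.
  move=> ip jp iC; have [ij|ji] := leqP i j.
    by rewrite -(subnKC ij) up // subnKC.
  by rewrite -(subKn (ltnW ji)) dn.
have [e0 [i0 [ip0 hv0]]] := svtx_on_edge v0; rewrite hv0 in v0C.
have src0 : inl (src e0) \in C by rewrite -svert0; apply: along v0C.
have orig u : inl u \in C.
  have /connectP[p hp ->] := graph_connected (src e0) u.
  elim: p (src e0) src0 hp => //= a p ih b bC /andP[/existsP[e he] hp].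
  apply: ih hp; case/orP: he => /andP[/eqP h1 /eqP h2].
    by rewrite -h2 -(svert_end (leqnn _)); apply: (along _ 0) => //; rewrite svert0 h1.
  rewrite -h1 -svert0; apply: (along _ (pieces e)) => //.
  by rewrite svert_end // h2.
apply/setP => v; rewrite inE; have [e [i [ip ->]]] := svtx_on_edge v.
by apply: (along _ 0) => //; rewrite svert0 orig.
Qed.

End SubdivisionGraph.

(** * Joining times and events of a labeling *)

Lemma ltn_succ_pred a m : (a < m -> a < 1 + m.-1)%N. Proof. lia. Qed.
Lemma ltn_of_iota a m : (0 < m -> 1 <= a < 1 + m.-1 -> a < m)%N. Proof. lia. Qed.
Lemma leq_pred_of_ltn a m : (a < m -> a <= m.-1)%N. Proof. lia. Qed.

Section LabelingTime.
Import fintype finset.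
Local Open Scope nat_scope.
Variables (R : realType) (G : metric_graph R) (n : nat).
Hypothesis n_gt0 : 0 < n.
Local Notation pieces := (@pieces R G n).
Local Notation svtx := (@svtx R G n).
Local Notation svert := (@svert R G n).
Local Notation neighbors := (@neighbors R G n).
Local Notation labeling := (@labeling R G n).
Local Notation larm := (@larm R G n).
Local Notation avert := (@avert R G n).
Local Notation room := (@room R G n).
Local Notation N := #|svtx|.

Section OneLabeling.
Variable L : labeling.
Hypothesis iL : injective L.
Local Notation tm := (@ltime svtx L).

Lemma occupiedE k v : (v \in occupied L k) = (tm v <= k).
Proof.
have aux a m : a < m -> (m - k <= a.+1) = (m.-1 - a <= k) by clear; lia.
by rewrite inE; apply: aux; exact: ltn_ord.
Qed.

Lemma newestE k v : newest L k v = (tm v == k).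
Proof.
have aux a m : a < m -> (a.+1 == m - k) = (m.-1 - a == k) by clear; lia.
by rewrite /newest; apply: aux; exact: ltn_ord.
Qed.

Lemma peaksE v : (v \in peaks L) = [forall y, neighbors v y ==> (tm v < tm y)].
Proof.
by rewrite inE; apply: eq_forallb => y; rewrite ltime_lt /label ltnS.
Qed.

Lemma tm_lt v : tm v < N.
Proof.
have aux a m : a < m -> m.-1 - a < m by clear; lia.
by apply: (aux (L v)); exact: ltn_ord.
Qed.

Lemma tm_inj : injective tm. Proof. exact: ltime_inj. Qed.

Lemma tm_surj k : k < N -> exists v, tm v = k.
Proof.
move=> kN; pose f v := Ordinal (tm_lt v).
have fi : injective f by move=> u v [] /tm_inj.
have c : #|'I_N| <= N by rewrite card_ord.
have /codomP[v hv] := inj_card_onto fi c (Ordinal kN).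
by exists v; rewrite -[RHS]/(nat_of_ord (Ordinal kN)) hv.
Qed.

(** Events seen from the vertex that causes them: an original vertex, a peak (which joins before all
    its neighbors), or a vertex that joins after all of them. *)
Definition evtx v : bool :=
  [|| original v, v \in peaks L | [forall y, neighbors v y ==> (tm y < tm v)]].

Lemma evtxE v : evtx v = [|| original v, v \in peaks L |
  [forall y, neighbors v y ==> (tm y < tm v)]].
Proof. by []. Qed.

(** If a vertex inside an edge completes that edge, both its neighbors lie on the edge and have
    joined already, so the clause on completed edges leads to the one on meeting arms. *)
Lemma eventE v : 0 < tm v -> event L (tm v) = evtx v.
Proof.
move=> v0; have nw (P : pred svtx) : [exists u, newest L (tm v) u && P u] = P v.
  apply/existsP/idP => [[u /andP[]]|Pv]; last by exists v; rewrite newestE eqxx.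
  by rewrite newestE => /eqP /tm_inj ->.
rewrite /event !nw /evtx.
have -> : [forall y, neighbors v y ==> (y \in occupied L (tm v).-1)] =
          [forall y, neighbors v y ==> (tm y < tm v)].
  by apply: eq_forallb => y; rewrite occupiedE -ltnS prednK.
have [//|ov] := boolP (original v); rewrite /= [X in _ || X = _]orbC.
apply: orb_idl => /existsP[e /andP[sub /subsetPn[u ue nu]]]; apply/orP; right; move: nu.
rewrite occupiedE -ltnNge prednK // => vu.
have uv : u = v.
  by apply: tm_inj; apply/eqP; rewrite eqn_leq vu -occupiedE (subsetP sub).
move: ue; rewrite uv => /imsetP[i _ vi].
have hi : 0 < i < pieces e by move: ov; rewrite vi original_svert //; lia.
have := hi; case/andP => i0 ip.
apply/forallP => y; apply/implyP; rewrite vi neighbors_inner // -vi => ny.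
have : y != v.
  have : neighbors v y by rewrite vi neighbors_inner // -vi.
  by apply: contraTneq => ->; rewrite neighbors_irr.
rewrite ltn_neqAle -(inj_eq tm_inj) => -> /=; rewrite -occupiedE.
apply: (subsetP sub); case/orP: ny => /eqP ->; apply/imsetP.
  have h : i.-1 < (pieces e).+1 by lia.
  by exists (Ordinal h).
have h : i.+1 < (pieces e).+1 by lia.
by exists (Ordinal h).
Qed.

Lemma evtx_first v : tm v = 0 -> evtx v.
Proof.
move=> v0; apply/or3P/Or32; rewrite peaksE; apply/forallP => y; apply/implyP => nvy.
rewrite v0 lt0n -v0 (inj_eq tm_inj); apply: contraTneq nvy => ->.
by rewrite neighbors_irr.
Qed.

Lemma mem_events v : (tm v \in events L) = evtx v.
Proof.
rewrite /events inE mem_filter mem_iota.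
have [v0|v0] := posnP (tm v); first by rewrite v0 evtx_first.
rewrite eventE //= (_ : _ < 1 + _); first by rewrite andbT.
by apply: ltn_succ_pred (tm_lt v).
Qed.

Lemma events_vtx k : k \in events L -> exists2 v, tm v = k & evtx v.
Proof.
move=> ke; have [v vk] : exists v, tm v = k.
  apply: tm_surj; move: ke; rewrite inE mem_filter mem_iota.
  have : 0 < N by apply/card_gt0P; have [v _] := card_gt0P (edg_gt0 G); exists (inl (src v)).
  by move=> N0 /predU1P[->//|/andP[_]]; exact: ltn_of_iota.
by exists v; rewrite -?mem_events ?vk.
Qed.

Lemma events_sorted : sorted ltn (events L).
Proof.
rewrite /events /= path_min_sorted; last first.
  by apply/allP => k; rewrite mem_filter mem_iota => /andP[_ /andP[]].
by apply: sorted_filter (iota_ltn_sorted _ _); apply: ltn_trans.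
Qed.

Lemma ev_ltn i j : i < j < size (events L) -> ev L i < ev L j.
Proof.
case/andP => ij js; rewrite /ev.
by apply: (sorted_ltn_nth ltn_trans 0 events_sorted); rewrite ?inE // (ltn_trans ij).
Qed.

Lemma ev_mono i j : i < size (events L) -> j < size (events L) -> (ev L i < ev L j) = (i < j).
Proof.
move=> hi hj; have [ij|ji|->] := ltngtP i j; last by rewrite ltnn.
  by rewrite ev_ltn ?ij.
by apply/negbTE; rewrite -leqNgt ltnW // ev_ltn ?ji.
Qed.

Lemma ev0 : ev L 0 = 0. Proof. by []. Qed.

Lemma mem_ev i : i < size (events L) -> ev L i \in events L.
Proof. exact: mem_nth. Qed.

Lemma ev_gap i v : i.+1 < size (events L) -> ev L i < tm v < ev L i.+1 -> ~~ evtx v.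
Proof.
move=> hi /andP[h1 h2]; rewrite -mem_events; apply/negP => /(nthP 0)[j hj].
rewrite -/(ev L j) => e; move: h1 h2; rewrite -e !ev_mono //; last exact: ltnW.
lia.
Qed.

(** The last vertex joins after all its neighbors, hence it is an event. *)
Lemma ev_last : ev L (size (events L)).-1 = N.-1.
Proof.
have N0 : 0 < N by apply/card_gt0P; have [v _] := card_gt0P (edg_gt0 G); exists (inl (src v)).
have [v vN] : exists v, tm v = N.-1 by apply: tm_surj; rewrite prednK.
have : tm v \in events L.
  rewrite mem_events; apply/or3P/Or33; apply/forallP => y; apply/implyP => nvy.
  have : y != v by apply: contraTneq nvy => ->; rewrite neighbors_irr.
  rewrite ltn_neqAle -(inj_eq tm_inj) => -> /=.
  by rewrite vN; apply: leq_pred_of_ltn (tm_lt y).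
case/(nthP 0) => j hj; rewrite -/(ev L j) => e.
have [lt|] := ltnP j (size (events L)).-1; last first.
  move=> h; rewrite (_ : (size _).-1 = j) ?e ?vN //.
  by apply/eqP; rewrite eqn_leq h (leq_pred_of_ltn hj).
have s : (size (events L)).-1 < size (events L) by [].
have := ev_ltn (i := j) (j := (size (events L)).-1); rewrite lt s => /(_ isT).
have [u <- _] := events_vtx (mem_ev s).
by rewrite e vN ltnNge (leq_pred_of_ltn (tm_lt u)).
Qed.

(* A vertex without event has exactly one earlier neighbor. *)
Lemma non_event v : ~~ evtx v -> exists e i, [/\ 0 < i, i < pieces e, v = svert e i &
  (tm (svert e i.-1) < tm v < tm (svert e i.+1)) ||
  (tm (svert e i.+1) < tm v < tm (svert e i.-1))].
Proof.
rewrite /evtx !negb_or => /and3P[]; case: (svtxP n_gt0 v) => // e i i0 ip _.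
rewrite peaksE negb_forall => /existsP[y]; rewrite negb_imply -leqNgt => /andP[ny ly].
rewrite negb_forall => /existsP[z]; rewrite negb_imply -leqNgt => /andP[nz lz].
exists e, i; split=> //.
have neq u : neighbors (svert e i) u -> tm (svert e i) != tm u.
  by move=> nu; rewrite (inj_eq tm_inj); apply: contraTneq nu => <-; rewrite neighbors_irr.
have {}ly : tm y < tm (svert e i) by rewrite ltn_neqAle ly eq_sym neq.
have {}lz : tm (svert e i) < tm z by rewrite ltn_neqAle lz neq.
move: ny nz ly lz; rewrite !neighbors_inner // => /orP[]/eqP -> /orP[]/eqP -> h1 h2;
  rewrite ?h1 ?h2 ?orbT //; have := ltn_trans h1 h2; by rewrite ltnn.
Qed.

End OneLabeling.
End LabelingTime.

(** * Arms, and the vertices that they reach between two events *)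

Section Arms.
Import fintype finset.
Local Open Scope nat_scope.
Variables (R : realType) (G : metric_graph R) (n : nat).
Hypothesis n_gt0 : 0 < n.
Local Notation pieces := (@pieces R G n).
Local Notation svtx := (@svtx R G n).
Local Notation svert := (@svert R G n).
Local Notation neighbors := (@neighbors R G n).
Local Notation labeling := (@labeling R G n).
Local Notation larm := (@larm R G n).
Local Notation avert := (@avert R G n).
Local Notation room := (@room R G n).
Implicit Types (w : larm).

Definition apos w (i : nat) : nat := if adir w then astart w + i else astart w - i.

Lemma avertE w i : avert w i = svert (tag w) (apos w i). Proof. by []. Qed.

Lemma astart_le w : astart w <= pieces (tag w).
Proof. by rewrite -ltnS /astart ltn_ord. Qed.

Lemma apos_le w i : i <= room w -> apos w i <= pieces (tag w).
Proof.
by rewrite /apos /room; have := astart_le w; case: (adir w); move: (pieces _) => p; lia.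
Qed.

Lemma apos_inner w i : 0 < i -> i < room w -> 0 < apos w i < pieces (tag w).
Proof.
by rewrite /apos /room; have := astart_le w; case: (adir w); move: (pieces _) => p; lia.
Qed.

Lemma avert_inj w i j : i <= room w -> j <= room w -> avert w i = avert w j -> i = j.
Proof.
move=> ir jr; rewrite !avertE => /(svert_inj n_gt0 (apos_le ir) (apos_le jr)).
move: ir jr; rewrite /apos /room; have := astart_le w.
by case: (adir w); move: (pieces _) => p; lia.
Qed.

Lemma avert_neighbors w i : i < room w -> neighbors (avert w i) (avert w i.+1).
Proof.
rewrite !avertE /apos /room; have := astart_le w; case: (adir w) => sp ir.
  by rewrite addnS neighbors_svert // -ltn_subRL.
rewrite neighbors_sym // (_ : astart w - i = (astart w - i.+1).+1); last by lia.
by apply: neighbors_svert => //; move: ir sp; move: (pieces _) => p; lia.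
Qed.

Lemma avert_inner w i u : 0 < i -> i < room w ->
  neighbors (avert w i) u = (u == avert w i.-1) || (u == avert w i.+1).
Proof.
move=> i0 ir; have /andP[p0 pp] := apos_inner i0 ir.
rewrite !avertE neighbors_inner //; move: i0 ir {p0 pp}; rewrite /apos /room.
case: (adir w) => i0 ir; last rewrite orbC.
  by rewrite addnS (_ : (astart w + i).-1 = astart w + i.-1) //; lia.
have -> : (astart w - i).-1 = astart w - i.+1 by lia.
by have -> : (astart w - i).+1 = astart w - i.-1 by lia.
Qed.

Lemma avert_room w : original (avert w (room w)).
Proof.
rewrite avertE original_svert // /apos /room; case: (adir w).
  by rewrite subnKC ?astart_le // leqnn orbT.
by rewrite subnn.
Qed.

Lemma avert_original w i : 0 < i -> i < room w -> ~~ original (avert w i).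
Proof.
move=> i0 ir; have /andP[p0 pp] := apos_inner i0 ir.
by rewrite avertE original_svert // negb_or -lt0n p0 -ltnNge.
Qed.

Lemma arm_between u v : neighbors u v ->
  exists w, [/\ 0 < room w, avert w 0 = u & avert w 1 = v].
Proof.
case/neighborsP => e [i [ip [[-> ->]|[-> ->]]]].
  have h : i < (pieces e).+1 by rewrite ltnW.
  exists (existT _ e (true, Ordinal h)); rewrite /Defs.room /Defs.avert /astart /=.
  by rewrite subn_gt0 addn0 addn1.
have h : i.+1 < (pieces e).+1 by [].
exists (existT _ e (false, Ordinal h)); rewrite /Defs.room /Defs.avert /astart /=.
by rewrite subn0 subn1.
Qed.

Lemma larm_eq w w' : tag w = tag w' -> adir w = adir w' -> astart w = astart w' -> w = w'.
Proof.
case: w w' => [e [b a]] [e' [b' a']] /= ee; rewrite /adir /astart /=.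
by subst e'; move=> /= -> /ord_inj ->.
Qed.

(* Two arms that enter the same inner vertex from the same side run along the
   same line. *)
Lemma arms_aligned w w' i j : i < room w -> j < room w' ->
  ~~ original (avert w i.+1) ->
  avert w i = avert w' j -> avert w i.+1 = avert w' j.+1 -> i <= j ->
  (forall k, k <= room w -> avert w k = avert w' (k + (j - i)) /\ k + (j - i) <= room w') /\
  (i = j -> w = w').
Proof.
move=> ir jr no e0 e1 ij.
have i1r : i.+1 < room w.
  rewrite ltn_neqAle ir andbT; apply: contraNneq no => ->; exact: avert_room.
have /andP[p0 pp] := apos_inner (ltn0Sn i) i1r.
have [te pe1] := svert_inner_inj n_gt0 p0 pp e1.
have pe0 : apos w i = apos w' j.
  apply: (svert_inj n_gt0 (e := tag w)); first exact: apos_le (ltnW ir).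
    by rewrite te; apply: apos_le (ltnW jr).
  by rewrite [in RHS]te.
have de : adir w = adir w'.
  move: pe0 pe1 p0 ir jr; rewrite /apos /room te.
  by case: (adir w); case: (adir w') => //; lia.
have ast : if adir w then astart w + i = astart w' + j else astart w + j = astart w' + i.
  move: pe0 pe1 p0 ir jr; rewrite /apos /room te de.
  by case: (adir w') => //; lia.
split=> [k kr|ij']; last first.
  by apply: larm_eq => //; move: ast; rewrite ij'; case: (adir w) => /addIn.
rewrite !avertE te; move: kr ast ij; rewrite /apos /room te de.
have := astart_le w; have := astart_le w'; rewrite te.
move: (pieces _) => p.
case: (adir w') => h1 h2 h3 h4 h5; split; try (congr svert); lia.
Qed.

Section Advance.
Variable L : labeling.
Hypothesis iL : injective L.
Local Notation tm := (@ltime svtx L).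
Local Notation evtx := (@evtx R G n L).

(** The condition maximized by [advance], in terms of joining times: the arm may end at the vertex
    of time [k] but not go past it. *)
Definition reach (k : nat) w (d : nat) : Prop :=
  forall i, i < d -> tm (avert w i.+1) <= k /\ (i.+1 < d -> tm (avert w i.+1) != k).

Lemma advance_le k w : advance L k w <= room w.
Proof. by apply/bigmax_leqP => d _; rewrite -ltnS. Qed.

Let condP k w d : reflect (reach k w d)
  [forall i : 'I_d, (avert w i.+1 \in occupied L k) &&
                    ((i.+1 < d) ==> ~~ newest L k (avert w i.+1))].
Proof.
apply: (iffP forallP) => [h i id|h i].
  have /andP[] := h (Ordinal id). rewrite occupiedE newestE /= => -> /implyP h2.
  by split=> // /h2.
have [h1 h2] := h i (ltn_ord i); rewrite occupiedE newestE h1 /=.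
exact/implyP.
Qed.

Lemma advance_reach k w : reach k w (advance L k w).
Proof.
rewrite /advance; have [|d dP ->] := @eq_bigmax_cond 'I_(room w).+1
  [pred d : 'I_(room w).+1 | [forall i : 'I_d, (avert w i.+1 \in occupied L k) &&
                    ((i.+1 < d) ==> ~~ newest L k (avert w i.+1))]] (fun d => d).
  by apply/card_gt0P; exists ord0; rewrite inE; apply/condP.
exact/condP.
Qed.

Lemma advance_max k w d : d <= room w -> reach k w d -> d <= advance L k w.
Proof.
move=> dr h; have dr' : d < (room w).+1 by [].
rewrite -[d]/(nat_of_ord (Ordinal dr')) /advance.
by apply: leq_bigmax_cond; apply/condP.
Qed.

Lemma arms_atP k w : reflect
  [/\ 0 < room w, (tm (avert w 0) <= k) || (avert w 0 \in peaks L) & k < tm (avert w 1)]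
  (w \in arms_at L k).
Proof.
rewrite [w \in _]inE finset.in_setU !occupiedE -ltnNge; exact: and3P.
Qed.

Variables k0 k1 : nat.
Hypothesis gap : forall v, k0 < tm v < k1 -> ~~ evtx v.
Local Notation adv := (advance L k1).

Lemma peak_evtx v : v \in peaks L -> evtx v.
Proof. by move=> h; apply/or3P/Or32. Qed.

(* Along an arm the vertices join in order, since a vertex without event has
   exactly one earlier neighbor. *)
Lemma chain_time w : w \in arms_at L k0 -> 0 < adv w -> tm (avert w 0) <= k0 /\
  forall j, j < adv w ->
   [/\ k0 < tm (avert w j.+1) <= k1, tm (avert w j) < tm (avert w j.+1) &
       j.+1 < adv w -> tm (avert w j.+1) < k1].
Proof.
move=> /arms_atP[r0 start k0lt] a0.
have reachw := @advance_reach k1 w; have ar := advance_le k1 w.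
have start0 : tm (avert w 0) <= k0.
  case/orP: start => // pk; rewrite leqNgt; apply/negP => k0p.
  have := pk; rewrite peaksE => /forallP/(_ (avert w 1)).
  rewrite (avert_neighbors r0) /= => lt.
  have /negP : ~~ evtx (avert w 0).
    by apply: gap; rewrite k0p /=; apply: leq_trans lt _; have [] := reachw _ a0.
  by apply; apply: peak_evtx.
split=> //; elim=> [|j ih] jadv.
  have [h1 h2] := reachw _ jadv; split.
  - by rewrite k0lt.
  - by apply: leq_ltn_trans k0lt.
  by move=> h; rewrite ltn_neqAle h1 h2.
have [/andP[h1 h2] h3 h4] := ih (ltnW jadv); have {}h4 := h4 jadv.
have [g1 g2] := reachw _ jadv.
have lt : tm (avert w j.+1) < tm (avert w j.+2).
  have jr : j.+1 < room w by apply: leq_trans ar.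
  have ne : ~~ evtx (avert w j.+1) by apply: gap; rewrite h1.
  have [e [i [i0 ip ve /orP H]]] := non_event n_gt0 iL ne.
  have nj := avert_inner _ (ltn0Sn j) jr.
  have nb : neighbors (avert w j.+1) (avert w j.+2) by rewrite nj eqxx orbT.
  have nb' : neighbors (avert w j.+1) (avert w j) by rewrite nj eqxx.
  have d : avert w j <> avert w j.+2.
    by move=> /(avert_inj _ _); move: jr; lia.
  move: nb nb' h3 H d; rewrite ve !neighbors_inner // => /orP[]/eqP -> /orP[]/eqP -> //;
    by move=> A [] /andP[B C] _ //; have := ltn_trans A _; lia.
split=> //; first by rewrite g1 andbT (ltn_trans h1).
by move=> h; rewrite ltn_neqAle g1 g2.
Qed.

(** Strong induction on the joining time. The vertex has an earlier neighbor u. If u was present at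
    [k0], an arm starts from u to [v]; otherwise u lies on some arm, and as [v] cannot be the vertex
    before u on that arm, which joined before u, it is the next one. *)
Lemma chain_exists v : k0 < tm v < k1 ->
  exists w j, [/\ w \in arms_at L k0, j < adv w & v = avert w j.+1].
Proof.
have [m] := ubnP (tm v); elim: m v => // m ih v; rewrite ltnS => tvm hv.
have /andP[vk0 vk1] := hv.
have [e [i [i0 ip ve /orP H]]] := non_event n_gt0 iL (gap hv).
have [u nuv tuv] : exists2 u, neighbors u v & tm u < tm v.
  have nb u : (u == svert e i.-1) || (u == svert e i.+1) -> neighbors u v.
    by rewrite neighbors_sym // ve neighbors_inner.
  by case: H => /andP[h _]; [exists (svert e i.-1)|exists (svert e i.+1)];
    rewrite ?nb ?eqxx ?orbT.
have [uk0|k0u] := leqP (tm u) k0.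
  have [w [r0 w0 w1]] := arm_between nuv.
  exists w, 0; split=> //.
    by apply/arms_atP; rewrite w0 w1 uk0.
  apply: advance_max => // -[|//] _; rewrite w1; split=> //.
  exact: ltnW.
have [||w [j [warm jadv uw]]] := ih u; first exact: leq_trans tvm.
  by rewrite k0u (ltn_trans tuv).
have a0 : 0 < adv w by apply: leq_ltn_trans jadv.
have [s0 /(_ j jadv)[hj1 hj2 hj3]] := chain_time warm a0.
have no : ~~ original u.
  have : ~~ evtx u by apply: gap; rewrite k0u (ltn_trans tuv).
  by apply: contra => o; apply/or3P/Or31.
have jr : j.+1 < room w.
  rewrite ltn_neqAle (leq_trans jadv (advance_le _ _)) andbT.
  by apply: contraNneq no => jr; rewrite uw jr avert_room.
move: nuv; rewrite uw avert_inner // => /orP[/eqP vw|/eqP vw].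
  by move: tuv hj2; rewrite uw vw /=; lia.
exists w, j.+1; split=> //; apply: advance_max => // q; rewrite ltnS => ij.
have [ilt|ji] := ltnP q j.+1.
  have [r1 r2] := advance_reach (leq_trans ilt jadv); split=> // _.
  have [|_ _ h3] := (chain_time warm a0).2 q; first by lia.
  have [lt|] := ltnP q.+1 (adv w); first by have := h3 lt; lia.
  move=> ge; have -> : q = j by lia.
  by rewrite -uw; lia.
have -> : q = j.+1 by lia.
by rewrite -vw; split; [exact: ltnW | lia].
Qed.

(** The unique earlier neighbor is the previous vertex on both arms, so the arms run along the same
    line in the same direction and can differ only in their starting points. *)
Lemma chain_unique w w' j j' : w \in arms_at L k0 -> w' \in arms_at L k0 ->
  j < adv w -> j' < adv w' -> avert w j.+1 = avert w' j'.+1 ->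
  tm (avert w j.+1) < k1 -> w = w' /\ j = j'.
Proof.
wlog jj : w w' j j' / j <= j'.
  move=> W wa wa' ja ja' e lt; have [le|le] := leqP j j'; first exact: W.
  by have [|-> ->] := W w' w j' j (ltnW le) wa' wa ja' ja (esym e); rewrite -?e.
move=> wa wa' ja ja' e lt.
have a0 : 0 < adv w by apply: leq_ltn_trans ja.
have a0' : 0 < adv w' by apply: leq_ltn_trans ja'.
have [s0 /(_ j ja)[/andP[h1 h2] h3 h4]] := chain_time wa a0.
have [s0' ct'] := chain_time wa' a0'.
have [h1' h2' _] := ct' j' ja'.
have ne : ~~ evtx (avert w j.+1) by apply: gap; rewrite h1.
have no : ~~ original (avert w j.+1) by apply: contra ne => o; apply/or3P/Or31.
have jr : j < room w := leq_trans ja (advance_le _ _).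
have jr' : j' < room w' := leq_trans ja' (advance_le _ _).
have e0 : avert w j = avert w' j'.
  have nb : neighbors (avert w j.+1) (avert w j) by rewrite neighbors_sym // avert_neighbors.
  have nb' : neighbors (avert w j.+1) (avert w' j').
    by rewrite e neighbors_sym // avert_neighbors.
  rewrite -e in h2'.
  have [x [i [i0 ip ve /orP H]]] := non_event n_gt0 iL ne.
  move: nb nb' h3 h2' H; rewrite ve !neighbors_inner // => /orP[]/eqP -> /orP[]/eqP -> //;
    by move=> A B [] /andP[C D]; lia.
have [al ww] := arms_aligned jr jr' no e0 e jj.
have [j'j|jlt] := leqP j' j.
  have ej : j = j' by apply/eqP; rewrite eqn_leq jj.
  by split; [apply: ww|].
(* Had [w'] started strictly behind [w], the base of [w] would be a vertex reached by [w'] after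
   [k0], yet it was occupied at [k0]. *)
have [e2 _] := al 0 isT; move: s0; rewrite e2 add0n.
have -> : j' - j = (j' - j).-1.+1 by lia.
have [|/andP[+ _] _ _] := ct' (j' - j).-1; first by lia.
by rewrite ltnNge => /negP.
Qed.

End Advance.
End Arms.

(** * Bounds on the numbers of events and arms that do not depend on n *)

Lemma source_balance_step (o d f1 i f0 m s : nat) : (o <= d -> f1 + i <= f0 + o ->
  f0 + m.*2 <= d * s -> f1 + (false.*2 + m.*2) <= d + d * s)%N.
Proof. by move: (d * s)%N => e; lia. Qed.
Lemma arms_balance_step (o d f1 i f0 m s b : nat) : (o + b.*2 <= i -> f1 + i <= f0 + o ->
  f0 + m.*2 <= d * s -> f1 + (b.*2 + m.*2) <= 0 + d * s)%N.
Proof. by move: (d * s)%N => e; lia. Qed.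

Section EventBounds.
Import fintype finset.
Local Open Scope nat_scope.
Variables (R : realType) (G : metric_graph R) (n : nat).
Hypothesis n_gt0 : 0 < n.
Local Notation pieces := (@pieces R G n).
Local Notation svtx := (@svtx R G n).
Local Notation svert := (@svert R G n).
Local Notation neighbors := (@neighbors R G n).
Local Notation labeling := (@labeling R G n).
Local Notation larm := (@larm R G n).
Local Notation avert := (@avert R G n).
Local Notation room := (@room R G n).
Local Notation sedg := (@sedg R G n).
Local Notation degs := (#|edg G|.*2).

Definition arms_from (v : svtx) : {set larm} :=
  [set w | (0 < room w) && (avert w 0 == v)]%SET.

Lemma card_arms_from v : #|arms_from v| <= degs.
Proof.
have -> : degs = #|{: edg G * bool}| by rewrite card_prod card_bool muln2.
rewrite -(card_in_imset (f := fun w : larm => (tag w, adir w))) ?max_card //.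
move=> w w'; rewrite !inE => /andP[_ /eqP h] /andP[_ /eqP h'] [te de].
apply: larm_eq => //; move: h; rewrite -h' !avertE te => /svert_inj h.
have := h n_gt0; rewrite /apos de; move: (@astart_le _ _ _ w) (@astart_le _ _ _ w').
by rewrite te; case: (adir w') => h1 h2; rewrite ?addn0 ?subn0; apply.
Qed.

Section OneLabeling.
Variable L : labeling.
Hypothesis iL : injective L.
Local Notation tm := (@ltime svtx L).
Local Notation evtx := (@evtx R G n L).

(** The directed edges that leave the joined set; unlike [arms_at], this leaves out the arms that
    wait at peaks which have not yet joined. *)
Definition front (k : nat) : {set larm} :=
  [set w | [&& 0 < room w, tm (avert w 0) <= k & k < tm (avert w 1)]]%SET.

Definition arms_in (v : svtx) : {set larm} :=
  [set w | [&& 0 < room w, avert w 1 == v & tm (avert w 0) < tm v]]%SET.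

Definition arms_out (v : svtx) : {set larm} :=
  [set w in arms_from v | tm v < tm (avert w 1)]%SET.

Lemma card_arms_out v : #|arms_out v| <= degs.
Proof.
apply: leq_trans (card_arms_from v); apply: subset_leq_card.
by apply/subsetP => w; rewrite inE => /andP[].
Qed.

Lemma front_step v : 0 < tm v ->
  #|front (tm v)| + #|arms_in v| <= #|front (tm v).-1| + #|arms_out v|.
Proof.
move=> v0; have sub : arms_in v \subset front (tm v).-1.
  apply/subsetP => w; rewrite !inE => /and3P[-> /eqP -> lt] /=.
  by rewrite -ltnS prednK // lt leqnn.
rewrite -(cardsID (arms_in v) (front (tm v).-1)) (finset.setIidPr sub).
rewrite addnC -addnA leq_add2l.
apply: leq_trans (leq_card_setU _ _); apply: subset_leq_card.
apply/subsetP => w; rewrite !inE => /and3P[r0 le lt].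
rewrite r0 /=; have [->|ne] := eqVneq (avert w 0) v; first by rewrite lt orbT.
have {}le : tm (avert w 0) < tm v.
  by rewrite ltn_neqAle le (inj_eq (tm_inj iL)) ne.
have -> : tm (avert w 0) <= (tm v).-1 by rewrite -ltnS prednK.
rewrite (leq_ltn_trans (leq_pred _) lt) le !andbT orbF.
by apply: contraTneq lt => ->; rewrite ltnn.
Qed.

Definition meet_vtx v : bool := ~~ original v && (v \notin peaks L) && evtx v.

(** A meeting vertex closes two arms and opens none; a vertex without event closes at least one and
    opens at most one. *)
Lemma arms_balance v : ~~ original v -> v \notin peaks L ->
  #|arms_out v| + (meet_vtx v).*2 <= #|arms_in v|.
Proof.
move=> ov pv; have [ev|ne] := boolP (evtx v).
  have all_lt y : neighbors v y -> tm y < tm v.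
    move: ev; rewrite /evtx (negbTE ov) (negbTE pv) /= => /forallP/(_ y)/implyP; exact.
  have -> : arms_out v = finset.set0.
    apply/setP => w; rewrite !inE; apply/negP => /andP[/andP[r0 /eqP w0] lt].
    have := all_lt (avert w 1); rewrite -w0 avert_neighbors // w0 => /(_ isT).
    by rewrite ltnNge (ltnW lt).
  rewrite cards0 add0n /meet_vtx ov pv ev /=.
  move: ov pv ev all_lt; case: (svtxP n_gt0 v) => // e i i0 ip _ _ _ all_lt.
  have nb1 : neighbors (svert e i) (svert e i.-1) by rewrite neighbors_inner // eqxx.
  have nb2 : neighbors (svert e i) (svert e i.+1) by rewrite neighbors_inner // eqxx orbT.
  have nb1' : neighbors (svert e i.-1) (svert e i) by rewrite neighbors_sym.
  have nb2' : neighbors (svert e i.+1) (svert e i) by rewrite neighbors_sym.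
  have [w1 [r1 s1 t1]] := arm_between nb1'.
  have [w2 [r2 s2 t2]] := arm_between nb2'.
  have w12 : w1 != w2.
    apply/eqP => w12; move: s1; rewrite w12 s2 => /svert_inj; lia.
  apply: (@leq_trans #|[set w1; w2]%SET|); first by rewrite cards2 w12.
  apply: subset_leq_card; apply/subsetP => w; rewrite !inE => /orP[]/eqP ->.
    by rewrite r1 s1 t1 eqxx all_lt.
  by rewrite r2 s2 t2 eqxx all_lt.
rewrite /meet_vtx (negbTE ne) andbF addn0.
have [e [i [i0 ip ve H]]] := non_event n_gt0 iL ne.
apply: (@leq_trans 1).
  apply/card_le1_eqP => w w'; rewrite !inE ve.
  move=> /andP[/andP[r0 /eqP w0] lt] /andP[/andP[r0' /eqP w0'] lt'].
  have [te pe] := svert_inner_inj n_gt0 i0 ip (esym w0).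
  have [te' pe'] := svert_inner_inj n_gt0 i0 ip (esym w0').
  have ast (w2 : larm) : i = (if adir w2 then astart w2 + 0 else astart w2 - 0) -> astart w2 = i.
    by case: (adir w2); rewrite ?addn0 ?subn0.
  have a1 := ast _ pe; have a2 := ast _ pe'.
  apply: larm_eq; rewrite ?a1 ?a2 -?te //.
  move: lt lt'; rewrite !avertE /apos a1 a2 -te -te' addn1 subn1.
  move: H; rewrite ve; case: (adir w); case: (adir w') => //; lia.
have [u nuv tuv] : exists2 u, neighbors u v & tm u < tm v.
  have nb u : (u == svert e i.-1) || (u == svert e i.+1) -> neighbors u v.
    by rewrite neighbors_sym // ve neighbors_inner.
  by case/orP: H => /andP[h _]; [exists (svert e i.-1)|exists (svert e i.+1)];
    rewrite ?nb ?eqxx ?orbT.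
have [w [r0 w0 w1]] := arm_between nuv.
by apply/card_gt0P; exists w; rewrite !inE r0 w0 w1 eqxx.
Qed.

Definition source_vtx v : bool := original v || (v \in peaks L).

(** A balance over time: a source opens at most [degs] frontier arms, no other vertex increases
    their number, and each meeting removes two. This bounds both the frontier and the number of
    meetings. *)
Lemma front_bound k : k < #|svtx| ->
  #|front k| + #|[set v | meet_vtx v & tm v <= k]%SET|.*2 <=
  degs * #|[set v | source_vtx v & tm v <= k]%SET|.
Proof.
elim: k => [|k ih] kN; have [v vk] := tm_surj iL kN.
  have pv : v \in peaks L.
    rewrite peaksE; apply/forallP => y; apply/implyP => nvy.
    rewrite vk lt0n -vk (inj_eq (tm_inj iL)).
    by apply: contraTneq nvy => ->; rewrite neighbors_irr.
  have -> : [set v | meet_vtx v & tm v <= 0]%SET = finset.set0.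
    apply/setP => u; rewrite !inE leqn0 -vk (inj_eq (tm_inj iL)).
    by apply/negP => /andP[/andP[/andP[_ +] _] /eqP uv]; rewrite uv pv.
  rewrite cards0 addn0; apply: leq_trans (leq_trans (card_arms_out v) _).
    apply: subset_leq_card; apply/subsetP => w; rewrite !inE.
    by rewrite leqn0 -vk (inj_eq (tm_inj iL)) => /and3P[-> -> ->].
  rewrite -{1}[degs]muln1 leq_mul2l; apply/orP; right; apply/card_gt0P; exists v.
  by rewrite inE /source_vtx pv orbT vk.
have step (P : pred svtx) : #|[set v | P v & tm v <= k.+1]%SET| =
    P v + #|[set v | P v & tm v <= k]%SET|.
  have -> : (P v : nat) = #|[set u | P u && (u == v)]%SET|.
    have [Pv|Pv] := boolP (P v).
      rewrite (_ : [set u | _]%SET = [set v]%SET) ?cards1 //; apply/setP => u; rewrite !inE.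
      by have [->|] := eqVneq u v; rewrite ?Pv // andbF.
    rewrite (_ : [set u | _]%SET = finset.set0) ?cards0 //; apply/setP => u; rewrite !inE.
    by have [->|] := eqVneq u v; rewrite ?(negbTE Pv) // andbF.
  rewrite -cardsUI [X in _ = _ + X](_ : _ = 0) ?addn0.
    apply: eq_card => u; rewrite !inE -(inj_eq (tm_inj iL)) vk -andb_orr.
    by congr andb; rewrite leq_eqVlt ltnS.
  apply/eqP; rewrite cards_eq0; apply/eqP/setP => u.
  rewrite !inE -(inj_eq (tm_inj iL)) vk.
  by apply/negP => /andP[/andP[_ /eqP ->] /andP[_]]; rewrite ltnn.
have := ih (ltnW kN); rewrite !step; have := @front_step v; rewrite vk => /(_ isT) /=.
rewrite doubleD mulnDr.
have [sv|sv] := boolP (source_vtx v).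
  have -> : meet_vtx v = false.
    by move: sv; rewrite /meet_vtx -negb_or /source_vtx => ->.
  by have := card_arms_out v; rewrite muln1; exact: source_balance_step.
have [ov pv] : ~~ original v /\ v \notin peaks L by apply/andP; rewrite -negb_or.
by have := arms_balance ov pv; rewrite muln0; exact: arms_balance_step.
Qed.

Definition source_bound := #|vtx G| + #|peaks L|.

Lemma card_source : #|[set v | source_vtx v]%SET| <= source_bound.
Proof.
have -> : [set v | source_vtx v]%SET = [set v | original v]%SET :|: peaks L.
  by apply/setP => v; rewrite !inE /source_vtx inE.
apply: leq_trans (leq_card_setU _ _) _; rewrite leq_add2r.
rewrite -(card_codom (f := inl : vtx G -> svtx)); last by move=> u v [].
apply: subset_leq_card; apply/subsetP => -[u _|b]; [exact: codom_f | by rewrite inE].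
Qed.

Definition event_bound := source_bound + degs * source_bound.

Lemma sub_source_bound k :
  degs * #|[set v | source_vtx v & tm v <= k]%SET| <= degs * source_bound.
Proof.
rewrite leq_mul2l; apply/orP; right; apply: leq_trans card_source.
by apply: subset_leq_card; apply/subsetP => v; rewrite !inE => /andP[].
Qed.

(** An event vertex is a source or a meeting, and [front_bound] at the last step bounds all the
    meetings. *)
Lemma card_evtx : #|[set v | evtx v]%SET| <= event_bound.
Proof.
have sub : [set v | evtx v]%SET \subset
    [set v | source_vtx v]%SET :|: [set v | meet_vtx v]%SET.
  apply/subsetP => v; rewrite !inE /meet_vtx -negb_or -/(source_vtx v) => ->.
  by rewrite andbT orbN.
apply: leq_trans (subset_leq_card sub) (leq_trans (leq_card_setU _ _) _).
rewrite leq_add ?card_source //.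
have N0 : 0 < #|svtx|.
  by apply/card_gt0P; have [v _] := card_gt0P (edg_gt0 G); exists (inl (src v)).
have k : #|svtx|.-1 < #|svtx| by rewrite prednK.
apply: leq_trans (sub_source_bound #|svtx|.-1); apply: leq_trans (front_bound k).
have -> : [set v | meet_vtx v & tm v <= #|svtx|.-1]%SET = [set v | meet_vtx v]%SET.
  by apply/setP => v; rewrite !inE -[tm v <= _]ltnS prednK // tm_lt // andbT.
by rewrite -addnn addnA leq_addl.
Qed.

Lemma size_events : size (events L) <= event_bound.
Proof.
apply: leq_trans card_evtx; rewrite cardE -(size_map tm).
apply: uniq_leq_size; first by apply: sorted_uniq (events_sorted L); [exact: ltn_trans|exact: ltnn].
move=> k /(events_vtx n_gt0 iL)[v <- ev]; apply/map_f.
by rewrite mem_enum inE.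
Qed.

(** The second term accounts for the arms at peaks still to join: [arms_at] lets arms start at every
    peak from the beginning. *)
Definition arm_bound := degs * source_bound + degs * #|peaks L|.

Lemma front_le k : k < #|svtx| -> #|front k| <= degs * source_bound.
Proof.
move=> kN; apply: leq_trans (sub_source_bound k); apply: leq_trans (front_bound kN).
exact: leq_addr.
Qed.

Lemma card_arms_at k : k < #|svtx| -> #|arms_at L k| <= arm_bound.
Proof.
move=> kN; have sub : arms_at L k \subset
    front k :|: \bigcup_(v in peaks L) arms_from v.
  apply/subsetP => w /arms_atP[r0 + lt]; rewrite !inE r0 lt andbT.
  case/orP => [-> //|pk]; apply/orP; right; apply/bigcupP.
  by exists (avert w 0); [rewrite inE | rewrite inE r0 eqxx].
apply: leq_trans (subset_leq_card sub) (leq_trans (leq_card_setU _ _) _).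
rewrite leq_add ?front_le // mulnC -sum_nat_const.
apply: (big_ind2 (fun (A : {set larm}) m => #|A| <= m)); first by rewrite cards0.
  by move=> A a B b hA hB; apply: leq_trans (leq_card_setU _ _) (leq_add hA hB).
by move=> v _; apply: card_arms_from.
Qed.

End OneLabeling.
End EventBounds.

(** * Covered length against the number of joined vertices *)

Lemma filled_step (f d k p m : nat) : (f <= d -> 0 < d -> k <= p + m -> p <= k + m ->
  k.+1 <= p + f + (m + d) /\ p + f <= k.+1 + (m + d))%N.
Proof. lia. Qed.
Lemma filled_step1 (k p m : nat) : (k <= p + m -> p <= k + m ->
  k.+1 <= p + 1 + m /\ p + 1 <= k.+1 + m)%N.
Proof. lia. Qed.

Section FilledEdges.
Import fintype finset.
Local Open Scope nat_scope.
Variables (R : realType) (G : metric_graph R) (n : nat).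
Hypothesis n_gt0 : 0 < n.
Local Notation pieces := (@pieces R G n).
Local Notation piece_len := (@piece_len R G n).
Local Notation svtx := (@svtx R G n).
Local Notation svert := (@svert R G n).
Local Notation neighbors := (@neighbors R G n).
Local Notation labeling := (@labeling R G n).
Local Notation sedg := (@sedg R G n).
Local Notation ssrc := (@ssrc R G n).
Local Notation stgt := (@stgt R G n).
Local Notation degs := (#|edg G|.*2).

Lemma piece_len_gt0 e : (0 < piece_len e)%R.
Proof. by rewrite divr_gt0 ?len_gt0 // ltr0n pieces_gt0. Qed.

Lemma pieces_piece_len e : ((pieces e)%:R * piece_len e = len e)%R.
Proof. by rewrite mulrC divfK // pnatr_eq0 -lt0n pieces_gt0. Qed.

Lemma piece_len_le1 e : (n%:R * piece_len e <= 1)%R.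
Proof.
rewrite mulrA ler_pdivrMr ?ltr0n ?pieces_gt0 // mul1r.
by have /andP[] := pieces_bounds n e.
Qed.

(** A piece is slightly shorter than 1/n. Since [pieces e] exceeds n times the length of e by less
    than 1, the loss accumulated along the whole edge is less than 1. *)
Lemma coord_bounds e (j : nat) : j <= pieces e ->
  (j%:R - 1 <= n%:R * (j%:R * piece_len e) <= j%:R)%R.
Proof.
move=> jp; rewrite mulrCA; apply/andP; split; last first.
  by rewrite -[leRHS]mulr1 ler_wpM2l // piece_len_le1.
have /andP[_ h] := pieces_bounds n e.
have q0 : (0 <= 1 - n%:R * piece_len e)%R by rewrite subr_ge0 piece_len_le1.
have : (j%:R * (1 - n%:R * piece_len e) <= (pieces e)%:R * (1 - n%:R * piece_len e))%R.
  by rewrite ler_wpM2r // ler_nat.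
rewrite mulrBr mulr1 mulrBr mulr1 [X in (_ <= _ - X)%R]mulrCA pieces_piece_len.
by move: h; move: (n%:R * len e)%R (j%:R * _)%R => u w; lra.
Qed.

Lemma sum_pieces_bounds : (n%:R * total_len G <= (\sum_e pieces e)%:R <=
   n%:R * total_len G + #|edg G|%:R)%R.
Proof.
rewrite natr_sum /total_len mulr_sumr; apply/andP; split.
  by apply: ler_sum => e _; have /andP[] := pieces_bounds n e.
rewrite -sum1_card natr_sum -big_split /=; apply: ler_sum => e _.
by have /andP[_ /ltW] := pieces_bounds n e.
Qed.

Lemma sum_sedg (f : edg G -> R) :
  (\sum_(d : sedg) f (tag d) = \sum_e (pieces e)%:R * f e)%R.
Proof.
rewrite (eq_bigr (fun e => \sum_(i < pieces e) f e)%R); last first.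
  by move=> e _; rewrite sumr_const card_ord mulr_natl.
by rewrite sig_big_dep /=; apply: eq_bigr => -[].
Qed.

Lemma sum_piece_len : (\sum_(d : sedg) piece_len (tag d) = total_len G)%R.
Proof. by rewrite sum_sedg; apply: eq_bigr => e _; exact: pieces_piece_len. Qed.

Section OneLabeling.
Variable L : labeling.
Hypothesis iL : injective L.
Local Notation tm := (@ltime svtx L).
Local Notation evtx := (@evtx R G n L).

Lemma filledE k d : filled L k d = (tm (ssrc d) <= k) && (tm (stgt d) <= k).
Proof. by rewrite /filled !occupiedE. Qed.

Definition filled_by (v : svtx) : {set sedg} :=
  [set d | ((ssrc d == v) && (tm (stgt d) < tm v)) ||
           ((stgt d == v) && (tm (ssrc d) < tm v))]%SET.

Lemma ends_inj (d d' : sedg) (v : svtx) : tag d = tag d' ->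
  (ssrc d == v) = (ssrc d' == v) -> (ssrc d == v) || (stgt d == v) ->
  (ssrc d' == v) || (stgt d' == v) -> d = d'.
Proof.
case: d d' => [e i] [e' i'] /= ee; subst e'; rewrite /Defs.ssrc /Defs.stgt /=.
move=> s1 s2 s3; congr existT; apply: ord_inj; move: s1 s2 s3.
have [<- /esym /eqP|ne /esym] := eqVneq (svert e i) v.
  by move=> /svert_inj -> //; rewrite ltnW // ltn_ord.
move=> -> /= /eqP <- /eqP /svert_inj h; have := h n_gt0 (ltn_ord _) (ltn_ord _).
by case.
Qed.

Lemma card_filled_by v : #|filled_by v| <= degs.
Proof.
have -> : degs = #|{: edg G * bool}| by rewrite card_prod card_bool muln2.
rewrite -(card_in_imset (f := fun d : sedg => (tag d, ssrc d == v))) ?max_card //.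
move=> d d'; rewrite !inE => h h' [te se].
apply: (ends_inj te se); [move: h|move: h'] => /orP[]/andP[-> _]; rewrite ?orbT //.
Qed.

Lemma card_filled_by_non_event v : ~~ evtx v -> #|filled_by v| = 1.
Proof.
move=> ne; have [e [i [i0 ip ve H]]] := non_event n_gt0 iL ne.
have h1 : i.-1 < pieces e by lia.
pose d1 : sedg := existT _ e (Ordinal h1); pose d2 : sedg := existT _ e (Ordinal ip).
have s1 : ssrc d1 = svert e i.-1 by [].
have t1 : stgt d1 = v by rewrite ve /Defs.stgt /= prednK.
have s2 : ssrc d2 = v by rewrite ve.
have t2 : stgt d2 = svert e i.+1 by [].
have tv u : neighbors v u -> (u == v) = false.
  by move=> nvu; apply: contraTF nvu => /eqP ->; rewrite neighbors_irr.
have n1 : (svert e i.-1 == v) = false by apply: tv; rewrite ve neighbors_inner // eqxx.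
have n2 : (svert e i.+1 == v) = false.
  by apply: tv; rewrite ve neighbors_inner // eqxx orbT.
have only d : d \in filled_by v -> (d == d1) || (d == d2).
  rewrite inE => hd; apply/orP.
  have td : tag d = e.
    case/orP: hd => /andP[/eqP + _]; rewrite ve /Defs.ssrc /Defs.stgt => /esym h.
      by have [] := svert_inner_inj n_gt0 i0 ip h.
    by have [] := svert_inner_inj n_gt0 i0 ip h.
  case/orP: hd => /andP[h _]; [right|left]; apply/eqP; apply: (@ends_inj _ _ v);
    rewrite ?td ?s1 ?s2 ?t1 ?t2 ?eqxx ?orbT ?h ?orbT ?n1 //.
  apply/negbTE/negP => /eqP h'; move/eqP: h; rewrite -h' /Defs.stgt /Defs.ssrc => /svert_inj.
  by move=> /(_ n_gt0 (ltn_ord _) (ltnW (ltn_ord _))); lia.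
have m1 : (d1 \in filled_by v) = (tm (svert e i.-1) < tm v).
  by rewrite inE s1 t1 n1 eqxx.
have m2 : (d2 \in filled_by v) = (tm (svert e i.+1) < tm v).
  by rewrite inE s2 t2 n2 eqxx /= orbF.
apply/eqP/cards1P; case/orP: H => /andP[a b].
  exists d1; apply/setP => d; rewrite [RHS]inE; apply/idP/eqP => [h|->]; last by rewrite m1.
  case/orP: (only _ h) => /eqP // d2e; move: h; rewrite d2e m2; lia.
exists d2; apply/setP => d; rewrite [RHS]inE; apply/idP/eqP => [h|->]; last by rewrite m2.
case/orP: (only _ h) => /eqP // d1e; move: h; rewrite d1e m1; lia.
Qed.

Definition nfilled (k : nat) : nat := #|[set d | filled L k d]%SET|.

Lemma ssrc_neq_stgt d : ssrc d != stgt d.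
Proof.
apply/eqP; rewrite /Defs.ssrc /Defs.stgt => /svert_inj h.
by have := h n_gt0 (ltnW (ltn_ord _)) (ltn_ord _); lia.
Qed.

Lemma nfilledS v : 0 < tm v -> nfilled (tm v) = nfilled (tm v).-1 + #|filled_by v|.
Proof.
move=> v0; rewrite /nfilled -[RHS]cardsUI.
rewrite [X in _ = _ + X](_ : _ = 0) ?addn0.
  apply: eq_card => d; rewrite !inE !filledE.
  have := ssrc_neq_stgt d; rewrite -(inj_eq (tm_inj iL)).
  rewrite -!(inj_eq (tm_inj iL)); lia.
apply/eqP; rewrite cards_eq0; apply/eqP/setP => d; rewrite !inE !filledE.
rewrite -!(inj_eq (tm_inj iL)); apply/negbTE; lia.
Qed.

Lemma nfilled0 : nfilled 0 = 0.
Proof.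
apply/eqP; rewrite cards_eq0; apply/eqP/setP => d; rewrite !inE filledE !leqn0.
have := ssrc_neq_stgt d; rewrite -(inj_eq (tm_inj iL)); lia.
Qed.

Lemma nfilled_mono k k' : k <= k' -> nfilled k <= nfilled k'.
Proof.
move=> kk; apply: subset_leq_card; apply/subsetP => d; rewrite !inE !filledE.
by move=> /andP[a b]; rewrite !(leq_trans _ kk).
Qed.

Definition fill_error := degs * event_bound L.

(** A vertex without event fills exactly one subdivision edge, any other at most [degs], and there
    are boundedly many events. *)
Lemma nfilled_bounds k : k < #|svtx| ->
  k <= nfilled k + fill_error /\ nfilled k <= k + fill_error.
Proof.
move=> kN.
suff h : k <= nfilled k + degs * #|[set v | evtx v & tm v <= k]%SET| /\
   nfilled k <= k + degs * #|[set v | evtx v & tm v <= k]%SET|.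
  have le : degs * #|[set v | evtx v & tm v <= k]%SET| <= fill_error.
    rewrite leq_mul2l; apply/orP; right; apply: leq_trans (card_evtx n_gt0 iL).
    by apply: subset_leq_card; apply/subsetP => v; rewrite !inE => /andP[].
  by case: h => h1 h2; split; [apply: leq_trans h1 _|apply: leq_trans h2 _]; rewrite leq_add2l.
elim: k kN => [|k ih] kN; first by rewrite nfilled0.
have [v vk] := tm_surj iL kN.
have d0 : 0 < degs by rewrite double_gt0; exact: edg_gt0.
have := nfilledS (v := v); rewrite vk => /(_ isT) /= ->.
have [h1 h2] := ih (ltnW kN).
have -> : [set u | evtx u & tm u <= k.+1]%SET =
   [set u | evtx u & tm u <= k]%SET :|: (if evtx v then [set v]%SET else finset.set0).
  apply/setP => u; rewrite !inE -/(evtx u) [tm u <= k.+1]leq_eqVlt ltnS -vk (inj_eq (tm_inj iL)).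
  have [->|uv] := eqVneq u v.
    by rewrite vk ltnn andbF /=; case: (boolP (evtx v)) => ev; rewrite !inE ?eqxx ?andbT ?(negbTE ev).
  by case: (evtx v); rewrite !inE ?(negbTE uv) ?orbF.
have dj : [disjoint [set u | evtx u & tm u <= k]%SET & (if evtx v then [set v]%SET else finset.set0)].
  rewrite finset.disjoints_subset; apply/subsetP => u; rewrite !inE => /andP[_ uk].
  case: (evtx v); rewrite !inE //; apply: contraTneq uk => ->; by rewrite vk ltnn.
rewrite cardsU (disjoint_setI0 dj) cards0 subn0.
have [ev|ev] := boolP (evtx v).
  by rewrite cards1 mulnDr muln1; apply: filled_step (card_filled_by v) d0 h1 h2.
by rewrite cards0 addn0 card_filled_by_non_event //; apply: filled_step1 h1 h2.
Qed.

(** Each filled piece has length at most 1/n, and the total rounding loss is at most 1 per original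
    edge. *)
Lemma ev_time_bounds k : (n%:R * ev_time L k <= (nfilled k)%:R <= n%:R * ev_time L k + #|edg G|%:R)%R.
Proof.
rewrite /ev_time mulr_sumr /nfilled -sum1_card natr_sum.
rewrite [X in (_ <= X <= _)%R](eq_bigl (filled L k)); last by move=> d; rewrite inE.
apply/andP; split; first by apply: ler_sum => d _; exact: piece_len_le1.
rewrite -lerBlDl -sumrB.
have sd : (\sum_(d : sedg) (1 - n%:R * piece_len (tag d)) <= #|edg G|%:R :> R)%R.
  rewrite (sum_sedg (fun e => 1 - n%:R * piece_len e)%R) -[leRHS]mulr1n -sumr_const.
  apply: ler_sum => e _; rewrite mulrBr mulr1 mulrCA pieces_piece_len.
  by have /andP[_ /ltW] := pieces_bounds n e; rewrite -lerBlDl.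
apply: le_trans sd; rewrite [leRHS](bigID (filled L k)) /= lerDl.
by apply: sumr_ge0 => d _; rewrite subr_ge0 piece_len_le1.
Qed.

Lemma ev_time_mono k k' : k <= k' -> (ev_time L k <= ev_time L k')%R.
Proof.
move=> kk; rewrite /ev_time [leRHS](bigID (filled L k)) /=.
rewrite [X in (_ <= X + _)%R](eq_bigl (filled L k)); last first.
  move=> d; rewrite !filledE; apply/andb_idl => /andP[a b].
  by rewrite !(leq_trans _ kk).
by rewrite lerDl; apply: sumr_ge0 => d _; rewrite ltW // piece_len_gt0.
Qed.

Lemma ev_time_lt k k' : k <= k' -> (ev_time L k < ev_time L k')%R = (nfilled k < nfilled k').
Proof.
move=> kk; have sub d : filled L k d -> filled L k' d.
  by rewrite !filledE => /andP[a b]; rewrite !(leq_trans _ kk).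
have subs : [set d | filled L k d]%SET \subset [set d | filled L k' d]%SET.
  by apply/subsetP => d; rewrite !inE; apply: sub.
have -> : ev_time L k' = (ev_time L k + \sum_(d in [set d | filled L k' d]%SET :\: [set d | filled L k d]%SET) piece_len (tag d))%R.
  rewrite /ev_time [LHS](bigID (filled L k)) /=; congr (_ + _)%R; apply: eq_bigl => d.
    by apply/andb_idl/sub.
  by rewrite !inE andbC.
have -> : (nfilled k < nfilled k') = (0 < #|[set d | filled L k' d]%SET :\: [set d | filled L k d]%SET|).
  by rewrite /nfilled -(cardsID [set d | filled L k d]%SET [set d | filled L k' d]%SET) (finset.setIidPr subs) -{1}[#|_|]addn0 ltn_add2l.
rewrite ltrDl; apply/idP/card_gt0P => [|[d dD]].
  apply: contraPP => no; rewrite big_pred0 ?ltxx // => d; apply/negP => h; apply: no; by exists d.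
rewrite (bigD1 d) //= ltr_wpDr ?piece_len_gt0 //.
by apply: sumr_ge0 => d' _; rewrite ltW // piece_len_gt0.
Qed.

(** Distinct times differ by at least one piece; this keeps phase durations away from 0, where the
    logarithm would be out of control. *)
Lemma ev_time_gap k k' : k <= k' -> nfilled k < nfilled k' ->
  exists e, (ev_time L k + piece_len e <= ev_time L k')%R.
Proof.
move=> kk lt; have /subsetPn[d] : ~~ ([set d | filled L k' d]%SET \subset [set d | filled L k d]%SET).
  by apply: contraL lt => /subset_leq_card; rewrite -leqNgt.
rewrite !inE => dk' dk; exists (tag d); rewrite /ev_time [leRHS](bigD1 d) //= [leLHS]addrC lerD2l.
rewrite [leRHS](bigID (filled L k)) /= (eq_bigl (fun d' => filled L k' d' && (d' != d) && filled L k d')).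
  by rewrite lerDl; apply: sumr_ge0 => d' _; rewrite ltW // piece_len_gt0.
move=> d'; apply/idP/idP => [h|/andP[]//]; rewrite h andbT.
rewrite (contraTneq _ h) ?andbT => [|->//]; move: h; rewrite !filledE => /andP[a b].
by rewrite !(leq_trans _ kk).
Qed.

Lemma ev_time0 : ev_time L 0 = 0%R.
Proof.
rewrite /ev_time big_pred0 // => d; apply/negbTE/negP => h.
by have := nfilled0; rewrite /nfilled => /eqP; rewrite cards_eq0 => /eqP/setP/(_ d); rewrite !inE h.
Qed.

Lemma ev_time_last : ev_time L #|svtx|.-1 = total_len G.
Proof.
rewrite -sum_piece_len; apply: eq_bigl => d; rewrite filledE.
have N0 : 0 < #|svtx| by apply/card_gt0P; exists (ssrc d).
by rewrite -ltnS -[tm (stgt d) <= _]ltnS prednK // !tm_lt.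
Qed.

Lemma filled_by_gt0 v : v \notin peaks L -> 0 < #|filled_by v|.
Proof.
rewrite peaksE negb_forall => /existsP[y]; rewrite negb_imply -leqNgt => /andP[nvy le].
have lt : tm y < tm v.
  rewrite ltn_neqAle le andbT (inj_eq (tm_inj iL)).
  by apply: contraTneq nvy => ->; rewrite neighbors_irr.
case/existsP: nvy => d; rewrite /joins => /orP[]/andP[/eqP h1 /eqP h2];
  by apply/card_gt0P; exists d; rewrite inE h1 h2 eqxx lt ?orbT.
Qed.

End OneLabeling.
End FilledEdges.

(** * The schedule of a labeling *)

Lemma count_sorted_ltn (s : seq nat) x i : sorted ltn s -> (i < size s)%N ->
  (i < count (fun k => (k < x)%N) s)%N = (nth 0%N s i < x)%N.
Proof.
elim: s i => //= a s ih i ps; have ss := path_sorted ps.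
have [ax|xa] := ltnP a x; first by case: i => [|i] //= hi; rewrite add1n ltnS ih.
rewrite add0n => hi; have ge k : k \in a :: s -> (x <= k)%N.
  rewrite inE => /predU1P[->//|ks]; apply: leq_trans xa (ltnW _).
  by have /allP/(_ k ks) := order_path_min ltn_trans ps.
rewrite (_ : count _ _ = 0%N) ?ltn0; last first.
  apply/eqP; rewrite -leqn0 leqNgt -has_count; apply/hasPn => k ks.
  by rewrite -leqNgt ge // inE ks orbT.
apply/esym/negbTE; rewrite -leqNgt ge //.
by case: i hi => [|i] hi /=; rewrite ?mem_head // inE mem_nth ?orbT.
Qed.

Lemma blk_ltn (a m : nat) (b : bool) : (a < m -> a.*2 + b < m.*2.+2)%N.
Proof. by case: b; lia. Qed.

Section LabelingSchedule.
Import fintype finset.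
Local Open Scope nat_scope.
Variables (R : realType) (G : metric_graph R) (n : nat).
Hypothesis n_gt0 : 0 < n.
Local Notation pieces := (@pieces R G n).
Local Notation svtx := (@svtx R G n).
Local Notation svert := (@svert R G n).
Local Notation neighbors := (@neighbors R G n).
Local Notation labeling := (@labeling R G n).
Local Notation larm := (@larm R G n).
Local Notation avert := (@avert R G n).
Local Notation room := (@room R G n).
Local Notation evtx L := (@evtx R G n L).
Local Notation tm L := (@ltime svtx L).
Local Notation nblk := (#|svtx|.*2.+2).

Definition ev_idx (L : labeling) v := count (fun k => k < tm L v) (events L).

Definition arm_of (L : labeling) v : option larm :=
  if evtx L v then None else
  [pick w in arms_at L (ev L (ev_idx L v).-1) |
     has (fun j => avert w j.+1 == v) (iota 0 (advance L (ev L (ev_idx L v)) w))].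

Definition arm_pos (L : labeling) v : nat :=
  if arm_of L v is Some w then index v [seq avert w j | j <- iota 0 (room w).+1] else 0.

(* The blocks are the single event vertices and the sets of vertices that join
   between two consecutive events. *)
Definition label_schedule (L : labeling) : schedule svtx (option larm) nblk :=
  Schedule (fun v => inord ((ev_idx L v).*2 + evtx L v) : 'I_nblk)
           (arm_of L) (arm_pos L).

(** Exactly the data at the events from which blocks, arms and positions can be recomputed. *)
Definition same_schedule (L L' : labeling) : Prop :=
  [/\ events L = events L', peaks L = peaks L',
      forall k, k \in events L -> occupied L k = occupied L' k &
      forall k, k \in events L -> newest L k =1 newest L' k].

Section OneLabeling.
Variable L : labeling.
Hypothesis iL : injective L.
Local Notation tml := (@ltime svtx L).

Lemma ev_idxE i v : i < size (events L) -> (i < ev_idx L v) = (ev L i < tml v).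
Proof. by move=> hi; rewrite /ev_idx count_sorted_ltn // events_sorted. Qed.

Lemma ev_idx_le v : ev_idx L v < size (events L).
Proof.
rewrite ltnNge; apply/negP => h.
have s0 : 0 < size (events L) by [].
have : ev L (size (events L)).-1 < tml v by rewrite -ev_idxE prednK.
by rewrite ev_last // ltnNge -ltnS prednK ?tm_lt // (leq_ltn_trans _ (tm_lt L v)).
Qed.

Lemma size_events_le : size (events L) <= #|svtx|.
Proof.
have N0 : 0 < #|svtx|.
  by apply/card_gt0P; have [v _] := card_gt0P (edg_gt0 G); exists (inl (src v)).
rewrite /= -[leqRHS](prednK N0) ltnS size_filter.
by apply: leq_trans (count_size _ _) _; rewrite size_iota.
Qed.

(** Block 2i is the phase that ends with event number i, and block 2i + 1 is the vertex of that
    event alone. *)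
Lemma blkE v : blk (label_schedule L) v = (ev_idx L v).*2 + evtx L v :> nat.
Proof.
by rewrite inordK // blk_ltn // (leq_trans (ev_idx_le v)) // size_events_le.
Qed.

Lemma tm_le_ev v : tml v <= ev L (ev_idx L v).
Proof. by rewrite leqNgt -ev_idxE ?ltnn // ev_idx_le. Qed.

Lemma evtx_tm v : evtx L v -> tml v = ev L (ev_idx L v).
Proof.
rewrite -mem_events // => /(nthP 0)[j hj]; rewrite -/(ev L j) => e.
suff -> : ev_idx L v = j by [].
apply/eqP; rewrite eqn_leq; apply/andP; split.
  by rewrite leqNgt ev_idxE // e ltnn.
have [//|lt] := leqP j (ev_idx L v).
by have := tm_le_ev v; rewrite -e leqNgt ev_mono ?ev_idx_le // lt.
Qed.

Lemma non_evtx_idx v : ~~ evtx L v ->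
  0 < ev_idx L v /\ ev L (ev_idx L v).-1 < tml v < ev L (ev_idx L v).
Proof.
move=> ne; have i0 : 0 < ev_idx L v.
  rewrite ev_idxE //= ev0 lt0n; apply: contra ne => /eqP; exact: evtx_first.
have p := leq_ltn_trans (leq_pred _) (ev_idx_le v).
split=> //; rewrite -(ev_idxE v p) prednK // leqnn /= ltn_neqAle tm_le_ev andbT; apply: contra ne => /eqP h.
by rewrite -mem_events // h mem_ev // ev_idx_le.
Qed.

Lemma idx_gap v u : 0 < ev_idx L v ->
  ev L (ev_idx L v).-1 < tml u < ev L (ev_idx L v) -> ~~ evtx L u.
Proof.
move=> i0; rewrite -{2}(prednK i0); apply: ev_gap => //.
by rewrite prednK // ev_idx_le.
Qed.

Lemma same_phase_idx u v : 0 < ev_idx L v ->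
  ev L (ev_idx L v).-1 < tml u < ev L (ev_idx L v) -> ev_idx L u = ev_idx L v.
Proof.
move=> i0 /andP[h1 h2]; apply/eqP; rewrite eqn_leq; apply/andP; split.
  by rewrite leqNgt ev_idxE ?ev_idx_le // -leqNgt ltnW.
by rewrite -(prednK i0) ev_idxE // (leq_trans _ (ev_idx_le v)) // prednK.
Qed.

Lemma arm_of_chain v w j : 0 < ev_idx L v ->
  let k0 := ev L (ev_idx L v).-1 in let k1 := ev L (ev_idx L v) in
  k0 < tml v < k1 -> w \in arms_at L k0 -> j < advance L k1 w -> v = avert w j.+1 ->
  arm_of L v = Some w /\ arm_pos L v = j.+1.
Proof.
move=> i0 k0 k1 hv wa ja vw; have ne : ~~ evtx L v by apply: (idx_gap i0).
have gap u : k0 < tml u < k1 -> ~~ evtx L u by apply: idx_gap.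
have aw : arm_of L v = Some w.
  rewrite /arm_of (negbTE ne); case: pickP => [w' /andP[wa' /hasP[j' + /eqP vw']]|].
    rewrite mem_iota add0n => ja'.
    have lt : tml (avert w j.+1) < k1 by rewrite -vw; case/andP: hv.
    have e : avert w j.+1 = avert w' j'.+1 by rewrite vw' -vw.
    by have [->] := chain_unique n_gt0 iL gap wa wa' ja ja' e lt.
  move=> /(_ w); rewrite wa /= => /negbT/hasPn/(_ j); rewrite mem_iota add0n => /(_ ja).
  by rewrite -vw eqxx.
split=> //; rewrite /arm_pos aw vw.
have jr : j.+1 < (room w).+1 by rewrite ltnS (leq_trans ja) // advance_le.
rewrite -{1}[j.+1](@nth_iota 0 0 (room w).+1) // -(nth_map 0 v) ?size_iota //.
rewrite index_uniq // ?size_map ?size_iota // map_inj_in_uniq ?iota_uniq //.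
by move=> a b; rewrite !mem_iota !add0n !ltnS => /= ar br; apply: (avert_inj n_gt0).
Qed.

Lemma arm_of_spec v : ~~ evtx L v -> exists w j,
  [/\ w \in arms_at L (ev L (ev_idx L v).-1), j < advance L (ev L (ev_idx L v)) w,
      v = avert w j.+1, arm_of L v = Some w & arm_pos L v = j.+1].
Proof.
move=> ne; have [i0 hv] := non_evtx_idx ne.
have [w [j [wa ja vw]]] := chain_exists n_gt0 iL (fun u => idx_gap i0) hv.
by exists w, j; have [a p] := arm_of_chain i0 hv wa ja vw.
Qed.

Lemma blk_eq u v : blk (label_schedule L) u = blk (label_schedule L) v ->
  evtx L u = evtx L v /\ ev_idx L u = ev_idx L v.
Proof.
move=> /(congr1 val) /=; rewrite !blkE => e.
have o := congr1 odd e; move: o e; rewrite !oddD !odd_double.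
case: (evtx L u); case: (evtx L v) => //= _; rewrite ?addn1 ?addn0.
  by move=> [] /double_inj.
by move=> /double_inj.
Qed.

Lemma label_schedule_inj x y :
  chain_of (label_schedule L) x = chain_of (label_schedule L) y ->
  pos (label_schedule L) x = pos (label_schedule L) y -> x = y.
Proof.
move=> [/(congr1 val)] /= bxy axy pxy; have [exy ixy] := @blk_eq x y (val_inj bxy).
have [ex|nx] := boolP (evtx L x).
  by apply: (tm_inj iL); rewrite !evtx_tm -?exy // ixy.
have ny : ~~ evtx L y by rewrite -exy.
have [w [j [_ _ ew aw pw]]] := arm_of_spec nx.
have [w' [j' [_ _ ew' aw' pw']]] := arm_of_spec ny.
move: axy pxy; rewrite /= aw aw' pw pw' => -[ww] [jj].
by rewrite ew ew' ww jj.
Qed.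

(** Blocks are cut by time, and [chain_time] says that the vertices of an arm join in order. *)
Lemma label_schedule_sorted : L \in sorted_labs (label_schedule L).
Proof.
apply/sorted_labsP; split.
  apply/compatP; split=> // u v; rewrite -ltime_lt !blkE => lt.
  have [iuv|ivu|iuv] := ltngtP (ev_idx L u) (ev_idx L v).
  - by apply: leq_ltn_trans (tm_le_ev u) _; rewrite -ev_idxE ?ev_idx_le.
  - by move: lt; case: (evtx L u); case: (evtx L v); lia.
  - move: lt; rewrite iuv ltn_add2l; case eu: (evtx L u); case evv : (evtx L v) => // _.
    rewrite (evtx_tm evv) -iuv; have [_ /andP[_ ->]] := non_evtx_idx (negbT eu).
    by [].
move=> u v cuv puv; rewrite -ltime_lt; case: cuv => /(congr1 val) /= buv auv.
have [exy ixy] := @blk_eq u v (val_inj buv).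
have [eu|nu] := boolP (evtx L u).
  by move: puv; rewrite /= /arm_pos /arm_of -exy eu.
have nv : ~~ evtx L v by rewrite -exy.
have [w [j [wa ja uw aw pw]]] := arm_of_spec nu.
have [w' [j' [wa' ja' vw' aw' pw']]] := arm_of_spec nv.
move: auv puv; rewrite /= aw aw' pw pw' ltnS => -[ww] jj; subst w'.
have [i0 hu] := non_evtx_idx nu.
have [_ ct] := chain_time n_gt0 iL (fun u => idx_gap i0) wa (leq_ltn_trans (leq0n _) ja).
rewrite uw vw'; rewrite -ixy in ja'; move: ja'.
elim: j' jj {vw' aw' pw' wa'} => // j' ih; rewrite ltnS leq_eqVlt => /predU1P[<-|jj] jj'.
  by have [] := ct _ jj'.
apply: ltn_trans (ih jj (ltnW jj')) _.
by have [] := ct _ jj'.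
Qed.

End OneLabeling.
End LabelingSchedule.

(** * Following the schedule of a labeling means having the same schedule *)

Section SameSchedule.
Import fintype finset.
Local Open Scope nat_scope.
Variables (R : realType) (G : metric_graph R) (n : nat).
Hypothesis n_gt0 : 0 < n.
Local Notation pieces := (@pieces R G n).
Local Notation svtx := (@svtx R G n).
Local Notation svert := (@svert R G n).
Local Notation neighbors := (@neighbors R G n).
Local Notation labeling := (@labeling R G n).
Local Notation larm := (@larm R G n).
Local Notation avert := (@avert R G n).
Local Notation room := (@room R G n).
Local Notation evtx L := (@evtx R G n L).
Local Notation tm L := (@ltime svtx L).
Local Notation nblk := (#|svtx|.*2.+2).


Lemma same_schedule_evtx (L L' : labeling) v : injective L -> injective L' ->
  same_schedule L L' -> evtx L v = evtx L' v.
Proof.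
move=> iL iL' [ee _ _ en].
have E (L0 : labeling) (i0 : injective L0) : evtx L0 v = has (fun k => newest L0 k v) (events L0).
  rewrite -mem_events //; apply/idP/hasP => [h|[k kE]].
    by exists (tm L0 v) => //; rewrite newestE.
  by rewrite newestE => /eqP ->.
rewrite !E // -ee; apply: eq_in_has => k kE; exact: en.
Qed.

Lemma same_schedule_ev_idx (L L' : labeling) v : same_schedule L L' -> ev_idx L v = ev_idx L' v.
Proof.
move=> [ee _ eo _]; rewrite /ev_idx -ee; apply: eq_in_count => k kE.
by rewrite ltnNge [RHS]ltnNge -!occupiedE eo.
Qed.

Lemma same_schedule_arms (L L' : labeling) k : same_schedule L L' -> k \in events L ->
  arms_at L k = arms_at L' k.
Proof. by move=> [_ ep eo _] kE; rewrite /arms_at ep eo. Qed.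

Lemma same_schedule_advance (L L' : labeling) k w : same_schedule L L' -> k \in events L ->
  advance L k w = advance L' k w.
Proof.
move=> [_ _ eo en] kE; rewrite /advance; apply: eq_bigl => d.
by apply: eq_forallb => i; rewrite eo // en.
Qed.

Lemma same_schedule_sym (L L' : labeling) : same_schedule L L' -> same_schedule L' L.
Proof.
move=> [ee ep eo en]; split=> [//|//|k|k]; rewrite -?ee => kE; first exact/esym/eo.
by move=> v; rewrite en.
Qed.

Lemma same_schedule_eq (L L' : labeling) : injective L -> injective L' -> same_schedule L L' ->
  label_schedule L = label_schedule L'.
Proof.
move=> iL iL' ss; have [ee _ _ _] := ss.
have ea : arm_of L = arm_of L'.
  apply: funext => v; rewrite /arm_of (same_schedule_evtx v iL iL' ss).
  have [//|nv] := boolP (evtx L' v); rewrite -(same_schedule_ev_idx v ss) /ev -ee.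
  have nv' : ~~ evtx L v by rewrite (same_schedule_evtx v iL iL' ss).
  have i1 := ev_idx_le n_gt0 iL v; have i2 := leq_ltn_trans (leq_pred _) i1.
  rewrite (same_schedule_arms ss) ?mem_nth //; apply: eq_pick => w /=.
  by rewrite (same_schedule_advance w ss) ?mem_nth.
have eb : (fun v => inord ((ev_idx L v).*2 + evtx L v) : 'I_nblk) =
          (fun v => inord ((ev_idx L' v).*2 + evtx L' v)).
  apply: funext => v.
  by rewrite (same_schedule_evtx v iL iL' ss) (same_schedule_ev_idx v ss).
have ep : arm_pos L = arm_pos L' by apply: funext => v; rewrite /arm_pos ea.
by rewrite /label_schedule eb ea ep.
Qed.

Lemma same_schedule_sorted (L L' : labeling) : injective L -> injective L' -> same_schedule L L' ->
  L' \in sorted_labs (label_schedule L).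
Proof.
by move=> iL iL' ss; rewrite (same_schedule_eq iL iL' ss) label_schedule_sorted.
Qed.

Section Sorted.
Variables L L' : labeling.
Hypothesis iL : injective L.
Hypothesis sL' : L' \in sorted_labs (label_schedule L).

Lemma sorted_inj : injective L'.
Proof. by case/sorted_labsP: sL' => /compatP[]. Qed.

Let iL' := sorted_inj.

(** The two labelings differ by a permutation inside blocks, and every event is a boundary between
    blocks. *)
Lemma sorted_ev i v : i < size (events L) -> (tm L' v <= ev L i) = (tm L v <= ev L i).
Proof.
move=> hi; have /sorted_labsP[cL' _] := sL'.
have /sorted_labsP[cL _] := label_schedule_sorted n_gt0 iL.
have [s /fibre_permP sY ->] := compat_lperm cL cL'.
have -> : tm (lperm L s) v = tm L (s v) by rewrite /ltime ffunE.
rewrite leqNgt -ev_idxE // [RHS]leqNgt -[in RHS]ev_idxE //.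
by have [_ ->] := blk_eq n_gt0 iL (sY v).
Qed.

Lemma sorted_evtx_tm v : evtx L v -> tm L' v = tm L v.
Proof.
move=> ev; have /sorted_labsP[cL' _] := sL'.
have /sorted_labsP[cL _] := label_schedule_sorted n_gt0 iL.
have [s /fibre_permP sY ->] := compat_lperm cL cL'.
have -> : tm (lperm L s) v = tm L (s v) by rewrite /ltime ffunE.
have [e1 e2] := blk_eq n_gt0 iL (sY v).
by rewrite !evtx_tm // ?e2 // e1.
Qed.

(** Under any interleaving of the chains of [L], a vertex without event still joins after the vertex
    behind it on its arm and before the one ahead. So no new event can appear. *)
Lemma sorted_chain_nbrs v : ~~ evtx L v -> exists w j,
  [/\ j.+1 < room w, v = avert w j.+1, tm L' (avert w j) < tm L' v
    & tm L' v < tm L' (avert w j.+2)].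
Proof.
move=> ne; have [w [j [wa ja vw aw pw]]] := arm_of_spec n_gt0 iL ne.
have [i0 hv] := non_evtx_idx n_gt0 iL ne.
have gap u := @idx_gap _ _ _ n_gt0 L iL v u i0.
have i1 := ev_idx_le n_gt0 iL v; have i2 := leq_ltn_trans (leq_pred _) i1.
set k0 := ev L _ in wa hv gap; set k1 := ev L _ in ja hv gap.
have [_ chS] := sorted_labsP _ _ sL'.
have no : ~~ original v by apply: contra ne => o; apply/or3P/Or31.
have jr : j.+1 < room w.
  rewrite ltn_neqAle (leq_trans ja (advance_le _ _ _)) andbT.
  by apply: contraNneq no => jr; rewrite vw jr avert_room.
have /andP[k0v vk1] := hv.
have chain u q : k0 < tm L u < k1 -> u = avert w q.+1 -> q < advance L k1 w ->
    chain_of (label_schedule L) u = chain_of (label_schedule L) v /\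
    pos (label_schedule L) u = q.+1.
  move=> hu uw qa; have iu := same_phase_idx n_gt0 iL i0 hu.
  have := @arm_of_chain _ _ _ n_gt0 L iL u w q; rewrite /= iu.
  move=> /(_ i0 hu wa qa uw) [au pu]; split=> //.
  by rewrite /chain_of /= aw au iu (negbTE (gap _ hu)) (negbTE ne).
have [s0 ct] := chain_time n_gt0 iL gap wa (leq_ltn_trans (leq0n _) ja).
exists w, j; split=> //.
  case: j ja vw pw jr => [|j] ja vw pw jr.
    have h : tm L' (avert w 0) <= k0 by rewrite sorted_ev.
    apply: leq_ltn_trans h _; rewrite ltnNge sorted_ev // -ltnNge //.
  have [/andP[a b] _ c] := ct j (ltnW ja).
  have [|cu pu] := chain (avert w j.+1) j _ erefl (ltnW ja); first by rewrite a c.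
  rewrite ltime_lt; apply: chS => //; by rewrite pu /= pw.
(* The vertex ahead joins at [k1] or later, and then block boundaries order the two; or it joins in
   the same phase, and then uniqueness of chains puts it next on the same arm. *)
have [k1y|yk1] := leqP k1 (tm L (avert w j.+2)).
  have vk1' : tm L' v <= k1 by rewrite sorted_ev // ltnW.
  have : avert w j.+2 != v.
    by apply: contraTneq k1y => ->; rewrite -ltnNge.
  move: k1y; rewrite leq_eqVlt => /predU1P[k1y|k1y] yv; last first.
    by apply: leq_ltn_trans vk1' _; rewrite ltnNge sorted_ev // -ltnNge.
  have ey : evtx L (avert w j.+2).
    by rewrite -(mem_events n_gt0 iL) -k1y /k1 mem_ev.
  have ty := sorted_evtx_tm ey.
  rewrite ltn_neqAle ty -k1y vk1' andbT; apply: contra yv => /eqP e.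
  by apply/eqP/(tm_inj iL'); rewrite e ty.
have nvy : neighbors v (avert w j.+2) by rewrite vw avert_inner // eqxx orbT.
have vy : tm L v < tm L (avert w j.+2).
  have [e [i [p0 pp ve /orP H]]] := non_event n_gt0 iL ne.
  have [_ h _] := ct j ja; rewrite -vw in h.
  have nvx : neighbors v (avert w j) by rewrite vw avert_inner // eqxx.
  have d : avert w j <> avert w j.+2.
    by move=> /(avert_inj n_gt0 (leq_trans (leqnSn _) (ltnW jr)) jr); lia.
  move: nvy nvx h H d; rewrite ve !neighbors_inner // => /orP[]/eqP -> /orP[]/eqP -> //;
    by move=> A [] /andP[B C] _ //; lia.
have hy : k0 < tm L (avert w j.+2) < k1 by rewrite yk1 andbT (ltn_trans k0v).
have [w' [j' [wa' ja' yw']]] := chain_exists n_gt0 iL gap hy.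
have vw' : v = avert w' j'.
  have [_ h _] := (chain_time n_gt0 iL gap wa' (leq_ltn_trans (leq0n _) ja')).2 j' ja'.
  have nyv : neighbors (avert w j.+2) v by rewrite neighbors_sym.
  have nyx : neighbors (avert w j.+2) (avert w' j').
    by rewrite yw' neighbors_sym avert_neighbors // (leq_trans ja') // advance_le.
  rewrite -yw' in h.
  have [e [i [p0 pp ve /orP H]]] := non_event n_gt0 iL (gap _ hy).
  move: nyv nyx h vy H; rewrite ve !neighbors_inner // => /orP[]/eqP -> /orP[]/eqP -> //;
    by move=> A B [] /andP[C D]; lia.
have [s0' _] := chain_time n_gt0 iL gap wa' (leq_ltn_trans (leq0n _) ja').
case: j' ja' yw' vw' => [|j'] ja' yw' vw'.
  by move: s0'; rewrite -vw' leqNgt k0v.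
have lt : tm L (avert w j.+1) < k1 by rewrite -vw.
have [|ww jj] := chain_unique n_gt0 iL gap wa wa' ja (ltnW ja') _ lt; first by rewrite -vw.
subst w' j'; have [cy py] := chain _ _ hy yw' ja'.
rewrite ltime_lt; apply: chS => //; by rewrite py /= pw.
Qed.

Lemma sorted_nbr_ev i v y : tm L v = ev L i -> i < size (events L) -> evtx L v ->
  (tm L' v < tm L' y) = (tm L v < tm L y) /\ (tm L' y < tm L' v) = (tm L y < tm L v).
Proof.
move=> vi hi evv; rewrite (sorted_evtx_tm evv) vi.
have le : (tm L' y <= ev L i) = (tm L y <= ev L i) by apply: sorted_ev.
split; first by rewrite ltnNge le -ltnNge.
rewrite !ltn_neqAle le; congr andb; rewrite -vi.
by rewrite -{1}(sorted_evtx_tm evv) (inj_eq (tm_inj iL')) (inj_eq (tm_inj iL)).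
Qed.

Lemma sorted_peaks : peaks L = peaks L'.
Proof.
apply/setP => v; have [ev|ne] := boolP (evtx L v).
  have vi := evtx_tm n_gt0 iL ev; have hi := ev_idx_le n_gt0 iL v.
  rewrite !peaksE; apply: eq_forallb => y.
  by have [-> _] := sorted_nbr_ev y vi hi ev.
rewrite (contraNF (@peak_evtx _ _ _ L v) ne); apply/esym/negbTE.
have [w [j [jr vw lt _]]] := sorted_chain_nbrs ne.
rewrite peaksE negb_forall; apply/existsP; exists (avert w j).
by rewrite negb_imply {1}vw neighbors_sym avert_neighbors ?(ltnW jr) //= -leqNgt ltnW.
Qed.

Lemma sorted_evtx v : evtx L' v = evtx L v.
Proof.
have [ev|ne] := boolP (evtx L v).
  have vi := evtx_tm n_gt0 iL ev; have hi := ev_idx_le n_gt0 iL v.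
  move: (ev); rewrite !evtxE -sorted_peaks => /or3P[->//|->|/forallP H]; first by rewrite orbT.
  apply/or3P/Or33/forallP => y; have := H y.
  by have [_ ->] := sorted_nbr_ev y vi hi ev.
apply/negbTE; have [w [j [jr vw lt1 lt2]]] := sorted_chain_nbrs ne.
rewrite !evtxE -sorted_peaks !negb_or; apply/and3P; split.
- by apply: contra ne => o; apply/or3P/Or31.
- by apply: contra ne; apply: peak_evtx.
rewrite negb_forall; apply/existsP; exists (avert w j.+2).
by rewrite negb_imply {1}vw avert_neighbors //= -leqNgt ltnW.
Qed.

(** With [same_schedule_sorted], this makes [sorted_labs (label_schedule L)] the equivalence class
    of [L] under [same_schedule]. *)
Lemma sorted_same_schedule : same_schedule L L'.
Proof.
have mem k : (k \in events L) = (k \in events L').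
  apply/idP/idP => kE.
    have [v vk ev] := events_vtx n_gt0 iL kE.
    by rewrite -vk -(sorted_evtx_tm ev) mem_events // sorted_evtx.
  have [v vk] := events_vtx n_gt0 iL' kE; rewrite sorted_evtx => ev.
  by rewrite -vk (sorted_evtx_tm ev) mem_events.
split.
- by apply: (irr_sorted_eq ltn_trans ltnn); rewrite ?events_sorted.
- exact: sorted_peaks.
- move=> k /(nthP 0)[i hi <-]; apply/setP => v.
  by rewrite !occupiedE -/(ev L i) sorted_ev.
move=> k kE v; rewrite !newestE; have [u uk eu] := events_vtx n_gt0 iL kE.
by rewrite -uk -{2}(sorted_evtx_tm eu) (inj_eq (tm_inj iL)) (inj_eq (tm_inj iL')).
Qed.

End Sorted.
End SameSchedule.


(** * Logarithms of multinomial coefficients against entropies *)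

Section MultinomialEntropy.
Local Open Scope ring_scope.
Variables (R : realType) (W : finType) (P : {pred W}).
(** Here [m] stands for the numbers of vertices in the chains, [x] for the lengths run by the arms
    in units of 1/n, [X] for the duration in the same units, and [B] bounds them all. *)
Variables (m : W -> nat) (x : W -> R) (X B c : R).
Let A := (\sum_(w in P) m w)%N.
Hypotheses (x_ge0 : forall w, w \in P -> 0 <= x w)
  (near : forall w, w \in P -> `|x w - (m w)%:R| <= c)
  (xB : forall w, w \in P -> x w <= B) (mB : forall w, w \in P -> (m w)%:R <= B)
  (AB : A%:R <= B) (XB : X <= B) (B_ge1 : 1 <= B) (X_gt0 : 0 < X).

Let lnB : 0 <= ln B. Proof. exact: ln_ge0. Qed.

Let sum_xlnx : - \sum_(w in P) x w * ln (x w / X) =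
  (\sum_(w in P) x w) * ln X - \sum_(w in P) xlnx (x w).
Proof.
rewrite mulr_suml -sumrB -sumrN; apply: eq_bigr => w wP; rewrite /xlnx.
have := x_ge0 wP; rewrite le0r => /predU1P[->|x0]; first by rewrite !mul0r subrr oppr0.
by rewrite ln_div ?posrE //; ring.
Qed.

Let ArE : A%:R = \sum_(w in P) (m w)%:R :> R. Proof. by rewrite natr_sum. Qed.

Let sum_near : `|A%:R - \sum_(w in P) x w| <= #|P|%:R * c.
Proof.
rewrite ArE -sumrB; apply: le_trans (ler_norm_sum _ _ _) _.
by rewrite mulr_natl -sumr_const; apply: ler_sum => w wP; rewrite distrC near.
Qed.

(** Stirling's formula replaces factorials by x ln x, and [xlnx_near] replaces counts by lengths at
    a cost of O(ln B) per chain. The duration [X] need only be close to the total count; being at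
    least 1/2 keeps its logarithm bounded below. *)
Lemma multinomial_le (c' : R) : 1 / 2 <= X -> `|X - A%:R| <= c' ->
  ln (A`!)%:R - \sum_(w in P) ln ((m w)`!)%:R <=
  - (\sum_(w in P) x w * ln (x w / X)) +
  (#|P|%:R * (1 + c *+ 2) + c' + c' ^+ 2 *+ 2 + 1) * (1 + ln B).
Proof.
move=> X2 XA; rewrite sum_xlnx; have l0 := lnB.
have h1 := ln_fact_le AB B_ge1.
have h2 : \sum_(w in P) (xlnx (x w) - (m w)%:R - (1 + c * (1 + ln B))) <=
    \sum_(w in P) ln ((m w)`!)%:R.
  apply: ler_sum => w wP; apply: le_trans (ln_fact_ge _ _).
  have := xlnx_near (ler0n _ (m w)) (x_ge0 wP) (xB wP) B_ge1.
  by move=> /(_ c); rewrite distrC => /(_ (near wP)); move: (c * _) => u; lra.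
rewrite !sumrB -ArE sumr_const -[_ *+ #|_|]mulr_natl in h2.
have sn := sum_near; set Y := \sum_(w in P) x w in sn *.
have lnX : `|ln X| <= 1 + ln B.
  rewrite ler_norml; apply/andP; split.
    have := ln_ge_subV X_gt0; have : X^-1 <= 2.
      rewrite -[2]invrK lef_pV2 ?posrE ?invr_gt0 //.
      by move: X2; rewrite mul1r.
    by lra.
  apply: (@le_trans _ _ (ln B)); last by rewrite lerDr.
  by rewrite ler_ln ?posrE // (lt_le_trans X_gt0).
have c'0 : 0 <= c' := le_trans (normr_ge0 _) XA.
have hA : xlnx A%:R <= Y * ln X + (#|P|%:R * c) * (1 + ln B) + c' + c' ^+ 2 *+ 2.
  have -> : Y * ln X = A%:R * ln X - (A%:R - Y) * ln X by ring.
  have d1 : (A%:R - Y) * ln X <= (#|P|%:R * c) * (1 + ln B).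
    apply: le_trans (ler_norm _) _; rewrite normrM; apply: ler_pM => //.
  suff : xlnx A%:R <= A%:R * ln X + c' + c' ^+ 2 *+ 2.
    by move: d1; move: (_ * (1 + _)) ((_ - _) * _) => u v; lra.
  have [->|A0] := posnP A.
    by rewrite xlnx0 mul0r add0r addr_ge0 // mulrn_wge0 // sqr_ge0.
  have A0' : 0 < A%:R :> R by rewrite ltr0n.
  have q0 : 0 < A%:R / X by rewrite divr_gt0.
  have := ln_le_subr1 q0; rewrite ln_div ?posrE // -(ler_pM2l A0') => d2.
  have AX : A%:R - X <= c' by apply: le_trans XA; rewrite distrC ler_norm.
  (* This controls A ln (A / X), since ln y is at most y - 1; the lower bound 1/2 on [X] turns c'^2
     / X into 2 c'^2. *)
  have d3 : A%:R * (A%:R / X - 1) <= c' + c' ^+ 2 *+ 2.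
    have -> : A%:R * (A%:R / X - 1) = A%:R * (A%:R - X) / X.
      by field; rewrite gt_eqF.
    rewrite ler_pdivrMr //.
    have : A%:R * (A%:R - X) <= (X + c') * c'.
      have [n0|p0] := leP 0 (A%:R - X).
        by apply: ler_pM => //; lra.
      apply: (@le_trans _ _ 0); first by rewrite pmulr_rle0 // ltW.
      by rewrite mulr_ge0 // addr_ge0 // ltW.
    have : 0 <= c' ^+ 2 * (X *+ 2 - 1) by rewrite mulr_ge0 ?sqr_ge0 //; lra.
    by rewrite !mulr2n; nra.
  by move: d2 d3; rewrite /xlnx mulrBr; move: (c' ^+ 2 *+ 2) (A%:R * (_ - _)) => u v; lra.
have e1 : 0 <= c' * ln B by rewrite mulr_ge0.
have e2 : 0 <= c' ^+ 2 * ln B by rewrite mulr_ge0 // sqr_ge0.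
have e3 : 0 <= #|P|%:R * ln B by rewrite mulr_ge0.
move: h1 h2 hA e1 e2 e3.
move: (\sum_(w in P) ln _) (\sum_(w in P) xlnx _) (xlnx _) (Y * _) (ln (_`!)%:R) => u1 u2 u3 u4 u5.
by move: (#|P|%:R) (ln B) (A%:R) => p l a; rewrite !mulr2n; lra.
Qed.

(** The converse estimate, for floodings, where the speeds sum to 1 and the duration is exactly the
    total length. *)
Lemma multinomial_ge : X = \sum_(w in P) x w ->
  - (\sum_(w in P) x w * ln (x w / X)) - (#|P|%:R * (2 + c *+ 2) + 1) * (1 + ln B) <=
  ln (A`!)%:R - \sum_(w in P) ln ((m w)`!)%:R.
Proof.
move=> XE; have l0 := lnB; rewrite sum_xlnx -XE -/(xlnx X).
have h1 := ln_fact_ge R A.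
have h2 : \sum_(w in P) ln ((m w)`!)%:R <=
    \sum_(w in P) (xlnx (x w) - (m w)%:R + (2 + ln B + c * (1 + ln B))).
  apply: ler_sum => w wP; apply: le_trans (ln_fact_le (mB wP) B_ge1) _.
  have := xlnx_near (x_ge0 wP) (ler0n _ (m w)) (mB wP) B_ge1 (near wP).
  by move: (c * _) => u; lra.
rewrite big_split /= sumrB -ArE sumr_const -[_ *+ #|_|]mulr_natl in h2.
have h3 : xlnx X <= xlnx A%:R + 1 + #|P|%:R * c * (1 + ln B).
  have sn := sum_near; rewrite -XE in sn.
  by apply: xlnx_near => //; exact: ltW.
have h4 : 0 <= #|P|%:R * ln B by rewrite mulr_ge0.
move: h1 h2 h3 h4 l0.
move: (\sum_(w in P) ln _) (\sum_(w in P) xlnx _) (xlnx _) (xlnx _) (ln (_`!)%:R) => u1 u2 u3 u4 u5.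
by move: (#|P|%:R) (ln B) (A%:R) => p l a; rewrite !mulr2n; lra.
Qed.

End MultinomialEntropy.


(** * Counting the vertices of a phase by blocks and chains *)

Section LnCard.
Import fintype finset.
Local Open Scope ring_scope.

Lemma ln_prod_fact (R : realType) (I : finType) (f : I -> nat) :
  ln (\prod_i (f i)`!)%N%:R = \sum_i ln ((f i)`!)%:R :> R.
Proof.
rewrite (big_morph (fun k : nat => k%:R : R) (natrM R) (erefl _)).
have [_ ->//] : 0 < \prod_i ((f i)`!)%:R :> R /\
    ln (\prod_i ((f i)`!)%:R) = \sum_i ln ((f i)`!)%:R :> R.
elim/big_ind2 : _ => [|x a y b [x0 hx] [y0 hy]|i _]; first by rewrite ln1.
  by rewrite mulr_gt0 // lnM ?posrE // hx hy.
by rewrite ltr0n fact_gt0.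
Qed.

Lemma ln_card_sorted (R : realType) (X I : finType) (B : nat) (S : schedule X I B) (L : {ffun X -> 'I_#|X|}) :
  (forall x y, chain_of S x = chain_of S y -> pos S x = pos S y -> x = y) ->
  L \in compat S ->
  ln (#|sorted_labs S|)%:R =
  \sum_b (ln ((#|[set x | blk S x == b]%SET|)`!)%:R -
          \sum_a ln ((#|[set x | chain_of S x == (b, a)]%SET|)`!)%:R) :> R.
Proof.
move=> inj cL; have := card_sorted inj cL; move/(congr1 (fun k : nat => ln (k%:R : R))).
have p (J : finType) (f : J -> nat) : (0 < \prod_i (f i)`!)%N.
  by rewrite prodn_gt0 // => i; rewrite fact_gt0.
have s0 : (0 < #|sorted_labs S|)%N.
  have := card_sorted inj cL; have := p _ (fun b : 'I_B => #|[set x | blk S x == b]%SET|).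
  by case: (#|sorted_labs S|) => //; rewrite mul0n => + h; rewrite -h.
rewrite natrM lnM ?posrE ?ltr0n // !ln_prod_fact.
rewrite sumrB pair_bigA /= => <-.
rewrite [X in _ = _ - X](eq_bigr (fun c : 'I_B * I => ln ((#|[set x | chain_of S x == c]%SET|)`!)%:R)).
  by rewrite addrK.
by case.
Qed.

End LnCard.

Section PhaseCounts.
Import fintype finset.
Local Open Scope nat_scope.
Variables (R : realType) (G : metric_graph R) (n : nat).
Hypothesis n_gt0 : 0 < n.
Local Notation pieces := (@pieces R G n).
Local Notation svtx := (@svtx R G n).
Local Notation svert := (@svert R G n).
Local Notation neighbors := (@neighbors R G n).
Local Notation labeling := (@labeling R G n).
Local Notation larm := (@larm R G n).
Local Notation avert := (@avert R G n).
Local Notation room := (@room R G n).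
Local Notation evtx L := (@evtx R G n L).
Local Notation tm L := (@ltime svtx L).
Local Notation nblk := (#|svtx|.*2.+2).



Section OneLabeling.
Variable L : labeling.
Hypothesis iL : injective L.
Local Notation tml := (@ltime svtx L).
Local Notation S := (label_schedule L).

Definition phase_block i : {set svtx} := [set v | ev L i < tml v < ev L i.+1]%SET.

Definition phase_chain i w : {set svtx} := [set v in phase_block i | arm_of L v == Some w]%SET.

Lemma phase_blockP i v : i.+1 < size (events L) ->
  (v \in phase_block i) = ~~ evtx L v && (ev_idx L v == i.+1).
Proof.
move=> hi; rewrite inE; apply/idP/andP => [h|[ne /eqP ie]].
  have ne := ev_gap n_gt0 iL hi h; split=> //; case/andP: h => h1 h2.
  rewrite eqn_leq ev_idxE ?(ltnW hi) // h1 andbT.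
  by rewrite leqNgt ev_idxE // -leqNgt ltnW.
by have [_] := non_evtx_idx n_gt0 iL ne; rewrite ie.
Qed.

Lemma blk_phase i : i.+1 < size (events L) ->
  [set v | blk S v == inord i.+1.*2]%SET = phase_block i.
Proof.
move=> hi; apply/setP => v; rewrite phase_blockP // inE.
have hN : i.+1.*2 < nblk.
  by have := leq_trans hi (size_events_le L); move: #|svtx| => N; lia.
apply/eqP/andP => [/(congr1 val) /=|[ne /eqP ie]]; last first.
  by apply: val_inj; rewrite /= blkE // inordK // ie (negbTE ne) addn0.
rewrite blkE // inordK //; case: (evtx L v) => h; split=> //; try (apply/eqP; lia); lia.
Qed.

Lemma chain_phase i w : i.+1 < size (events L) ->
  [set v | chain_of S v == (inord i.+1.*2, Some w)]%SET = phase_chain i w.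
Proof.
move=> hi; apply/setP => v; rewrite /phase_chain -blk_phase // !inE.
by rewrite -pair_eqE.
Qed.

Lemma card_tm_lt t : t <= #|svtx| -> #|[set v | tml v < t]%SET| = t.
Proof.
move=> tN; pose f v := Ordinal (tm_lt L v).
have fi : injective f by move=> u v [] /(tm_inj iL).
rewrite -(card_imset _ fi) -[RHS](card_ord_lt tN); apply: eq_card => k.
apply/imsetP/idP => [[v + ->]|]; rewrite !inE // => kt.
have [v vk] := tm_surj iL (ltn_ord k); exists v; last by apply: val_inj.
by rewrite inE vk.
Qed.

Lemma ev_lt i : i < size (events L) -> ev L i < #|svtx|.
Proof. by move=> hi; have [v <- _] := events_vtx n_gt0 iL (mem_ev hi); apply: tm_lt. Qed.

Lemma card_phase_block i t : i.+1 < size (events L) -> ev L i < t <= ev L i.+1 ->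
  #|[set v in phase_block i | tml v < t]%SET| = t - (ev L i).+1.
Proof.
move=> hi /andP[it ti]; have tN : t <= #|svtx| by apply: leq_trans ti (ltnW (ev_lt hi)).
rewrite -[in RHS](card_tm_lt tN) -[in RHS](@card_tm_lt (ev L i).+1 (leq_trans it tN)).
rewrite -cardsDS; last by apply/subsetP => v; rewrite !inE => /leq_trans; apply.
apply: eq_card => v; rewrite !inE -leqNgt; apply/andP/andP => [[/andP[-> _] ->]//|[a b]].
by rewrite a b (leq_trans b).
Qed.

Lemma card_phase_block_full i : i.+1 < size (events L) ->
  #|phase_block i| = ev L i.+1 - (ev L i).+1.
Proof.
move=> hi; rewrite -card_phase_block ?leqnn ?andbT ?ev_ltn ?ltnSn //.
by apply: eq_card => v; rewrite !inE; case: (tml v < _) => //; rewrite ?andbF ?andbT.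
Qed.

Section Phase.
Variable i : nat.
Hypothesis hi : i.+1 < size (events L).
Local Notation k0 := (ev L i).
Local Notation k1 := (ev L i.+1).

Let gap u : k0 < tml u < k1 -> ~~ evtx L u. Proof. exact: ev_gap. Qed.

Lemma phase_chain_mem w j : w \in arms_at L k0 -> j < advance L k1 w ->
  tml (avert w j.+1) < k1 ->
  avert w j.+1 \in phase_chain i w /\ arm_pos L (avert w j.+1) = j.+1.
Proof.
move=> wa ja lt; have [_ ct] := chain_time n_gt0 iL gap wa (leq_ltn_trans (leq0n _) ja).
have [/andP[h1 h2] _ _] := ct j ja.
have h : k0 < tml (avert w j.+1) < k1 by rewrite h1 lt.
have : avert w j.+1 \in phase_block i by rewrite inE.
move=> vb; have := vb; rewrite phase_blockP // => /andP[ne /eqP ie].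
have := @arm_of_chain _ _ _ n_gt0 L iL (avert w j.+1) w j; rewrite ie /= => /(_ isT h wa ja erefl) [a p].
by split=> //; rewrite inE vb a /=.
Qed.

Lemma phase_chain_spec w v : v \in phase_chain i w -> exists j,
  [/\ w \in arms_at L k0, j < advance L k1 w, v = avert w j.+1,
      arm_pos L v = j.+1 & tml v < k1].
Proof.
rewrite inE => /andP[vb /eqP aw]; have := vb; rewrite phase_blockP // => /andP[ne /eqP ie].
have [w' [j [wa ja vw aw' pv]]] := arm_of_spec n_gt0 iL ne.
move: wa ja vw; rewrite ie /=; move: aw; rewrite aw' => -[->] wa ja vw.
by exists j; split=> //; move: vb; rewrite inE => /andP[].
Qed.

Lemma card_phase_chain_le w : #|phase_chain i w| <= advance L k1 w.
Proof.
have [->|[v0 v0c]] := set_0Vmem (phase_chain i w); first by rewrite cards0.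
have [j0 [_ j0a _ _ _]] := phase_chain_spec v0c.
have a0 : 0 < advance L k1 w by apply: leq_ltn_trans j0a.
rewrite -[leqRHS]card_ord.
pose f v : 'I_(advance L k1 w) := insubd (Ordinal a0) (arm_pos L v).-1.
rewrite -(card_in_imset (f := f)) ?max_card // => u v uc vc.
have [j [_ ja uj pj _]] := phase_chain_spec uc; have [j' [_ ja' vj pj' _]] := phase_chain_spec vc.
move/(congr1 val); rewrite /f !val_insubd pj pj' ja ja' /= => jj.
by rewrite uj vj jj.
Qed.

(** Only the last vertex reached by the arm can be the event vertex at [k1], which belongs to the
    next block. *)
Lemma card_phase_chain_ge w : w \in arms_at L k0 -> (advance L k1 w).-1 <= #|phase_chain i w|.
Proof.
move=> wa; have [a1|a2] := leqP (advance L k1 w) 1; first by case: (advance _ _ _) a1 => [|[|]].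
have [_ ct] := chain_time n_gt0 iL gap wa (ltnW a2).
rewrite -[X in X <= _]card_ord.
pose f (j : 'I_(advance L k1 w).-1) := avert w j.+1.
have ja (j : 'I_(advance L k1 w).-1) : j.+1 < advance L k1 w by rewrite -ltn_predRL.
have fi : injective f.
  move=> j j' /(avert_inj n_gt0) h; apply: ord_inj; apply: succn_inj; apply: h.
    by rewrite (leq_trans (ltnW (ja j))) // advance_le.
  by rewrite (leq_trans (ltnW (ja j'))) // advance_le.
rewrite -(card_imset _ fi); apply: subset_leq_card; apply/subsetP => v /imsetP[j _ ->].
have [_ _ lt] := ct j (ltnW (ja j)).
by have [] := phase_chain_mem wa (ltnW (ja j)) (lt (ja j)).
Qed.

Lemma sum_phase_chain : \sum_(w in arms_at L k0) #|phase_chain i w| = #|phase_block i|.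
Proof.
rewrite -[RHS]sum1_card; under eq_bigr do rewrite -sum1_card.
transitivity (\sum_(w in arms_at L k0) \sum_(v in phase_block i) (arm_of L v == Some w : nat)).
  apply: eq_bigr => w _; rewrite [RHS](bigID (fun v => arm_of L v == Some w)) /=.
  rewrite [X in _ = _ + X]big1 ?addn0; last by move=> v /andP[_ /negbTE ->].
  by apply: eq_big => v; rewrite inE // => /andP[_ ->].
rewrite exchange_big; apply: eq_bigr => v vb /=.
have := vb; rewrite phase_blockP // => /andP[ne /eqP ie].
have [w [j [wa _ _ aw _]]] := arm_of_spec n_gt0 iL ne.
move: wa; rewrite ie /= => wa; rewrite (bigD1 w) //= aw eqxx big1 // => w' /andP[_ w'w].
by apply/eqP; rewrite eqb0; apply: contra w'w => /eqP[->].
Qed.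

End Phase.
End OneLabeling.
End PhaseCounts.


(** * The class of a labeling has size at most exp(n entropy + O(log n)) *)

Section ClassSize.
Import fintype finset.
Local Open Scope ring_scope.
Variables (R : realType) (G : metric_graph R) (n : nat).
Hypothesis n_gt0 : (0 < n)%N.
Hypothesis n_big : forall e : edg G, 1 <= n%:R * len e.
Local Notation pieces := (@pieces R G n).
Local Notation piece_len := (@piece_len R G n).
Local Notation svtx := (@svtx R G n).
Local Notation sedg := (@sedg R G n).
Local Notation labeling := (@labeling R G n).
Local Notation larm := (@larm R G n).
Local Notation nblk := (#|svtx|.*2.+2).

(** A crude common bound for all the counts that occur; [graph_size_le] shows it to be linear in
    n. *)
Definition graph_size : R := (#|svtx| + #|sedg|)%:R.

Lemma card_sedg : #|sedg| = (\sum_e pieces e)%N.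
Proof.
rewrite card_tagged sumnE big_map big_enum /=.
by apply: eq_bigr => e _; rewrite card_ord.
Qed.

Lemma pieces_le_sedg e : (pieces e <= #|sedg|)%N.
Proof. by rewrite card_sedg (bigD1 e) //= leq_addr. Qed.

Lemma graph_size_ge1 : 1 <= graph_size.
Proof.
rewrite /graph_size ler1n addn_gt0; apply/orP; right.
have [e _] := card_gt0P (edg_gt0 G).
exact: leq_trans (pieces_gt0 n_gt0 e) (pieces_le_sedg e).
Qed.

Lemma piece_len_ge e : 1 / 2 <= n%:R * piece_len e.
Proof.
rewrite mulrA ler_pdivlMr ?ltr0n ?pieces_gt0 //.
have /andP[_ h] := pieces_bounds n e; have := n_big e.
by move: h; move: (n%:R * len e) ((pieces e)%:R) => a b; lra.
Qed.

Lemma advance_coord (L : labeling) k (w : larm) :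
  (advance L k w)%:R - 1 <= n%:R * ((advance L k w)%:R * piece_len (tag w)) <= (advance L k w)%:R.
Proof.
apply: coord_bounds => //; apply: leq_trans (advance_le _ _ _) _.
by rewrite /room; case: adir; rewrite ?leq_subr ?astart_le.
Qed.

Section OneLabeling.
Variable L : labeling.
Hypothesis iL : injective L.
Local Notation S := (label_schedule L).

Definition length_error : R := (#|edg G| + fill_error L)%:R *+ 2 + 1.

Definition phase_const : R :=
  (arm_bound L)%:R * 3 + length_error + length_error ^+ 2 *+ 2 + 1.

Lemma length_error_ge0 : 0 <= length_error.
Proof. by rewrite /length_error !addr_ge0 // mulrn_wge0. Qed.

Lemma phase_const_ge0 : 0 <= phase_const.
Proof.
have h := length_error_ge0.
by rewrite /phase_const !addr_ge0 // ?mulr_ge0 // mulrn_wge0 // sqr_ge0.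
Qed.

Lemma length_bounds k : (k < #|svtx|)%N ->
  `|n%:R * ev_time L k - k%:R| <= #|edg G|%:R + (fill_error L)%:R.
Proof.
move=> kN; have [h1 h2] := nfilled_bounds n_gt0 iL kN.
have /andP[h3 h4] := ev_time_bounds n_gt0 L k.
have h1' : k%:R <= (nfilled L k)%:R + (fill_error L)%:R :> R by rewrite -natrD ler_nat.
have h2' : (nfilled L k)%:R <= k%:R + (fill_error L)%:R :> R by rewrite -natrD ler_nat.
have e0 : 0 <= #|edg G|%:R :> R by [].
by rewrite ler_norml; apply/andP; split; lra.
Qed.

Section Phase.
Variable i : nat.
Hypothesis hi : (i.+1 < size (events L))%N.
Local Notation k0 := (ev L i).
Local Notation k1 := (ev L i.+1).

Let hi0 : (i < size (events L))%N. Proof. exact: ltnW. Qed.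
Let lt01 : (k0 < k1)%N. Proof. by apply: ev_ltn; rewrite ltnSn. Qed.

Lemma phase_length :
  `|n%:R * (ev_time L k1 - ev_time L k0) - #|phase_block L i|%:R| <= length_error.
Proof.
rewrite card_phase_block_full // natrB // -natr1.
have h1 := length_bounds (ev_lt n_gt0 iL hi); have h0 := length_bounds (ev_lt n_gt0 iL hi0).
rewrite /length_error natrD mulrBr mulr2n; move: h1 h0; rewrite !ler_norml.
by move=> /andP[a b] /andP[c d]; apply/andP; split; lra.
Qed.

(** A vertex without event is not a peak, so it fills an edge when it joins and makes time advance.
    Repeated event times thus contribute nothing to the count. *)
Lemma phase_block_empty : ~~ (ev_time L k0 < ev_time L k1) -> phase_block L i = finset.set0.
Proof.
rewrite ev_time_lt ?(ltnW lt01) // => le; apply/setP => v; rewrite [RHS]inE.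
apply/negbTE; apply: contra le => vb; have := vb; rewrite phase_blockP // => /andP[ne _].
move: vb; rewrite inE => /andP[v0 v1].
have vp : v \notin peaks L by apply: contra ne; apply: peak_evtx.
have tv : (0 < ltime L v)%N by apply: leq_ltn_trans v0.
apply: leq_trans (nfilled_mono L (ltnW v1)); rewrite (nfilledS n_gt0 iL tv).
apply: leq_ltn_trans (nfilled_mono L (k' := (ltime L v).-1) _) _.
  by rewrite -ltnS prednK.
by rewrite -[X in (X < _)%N]addn0 ltn_add2l filled_by_gt0.
Qed.

Definition phase_entropy : R :=
  if ev_time L k0 < ev_time L k1 then
    - ((ev_time L k1 - ev_time L k0) *
    \sum_(w in arms_at L k0) aspeed L k0 k1 w * ln (aspeed L k0 k1 w))
  else 0.

(** [multinomial_le] with the run lengths of the arms and the phase duration, both multiplied by n;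
    their quotients are the speeds. *)
Lemma phase_count_le :
  ln ((#|phase_block L i|)`!)%:R - \sum_(w in arms_at L k0) ln ((#|phase_chain L i w|)`!)%:R
  <= n%:R * phase_entropy + phase_const * (1 + ln graph_size).
Proof.
have lB := ln_ge0 graph_size_ge1.
have s0 : 0 <= \sum_(w in arms_at L k0) ln ((#|phase_chain L i w|)`!)%:R :> R.
  by apply: sumr_ge0 => w _; rewrite ln_ge0 // ler1n fact_gt0.
rewrite /phase_entropy; case: ifPn => [lt|/phase_block_empty ->]; last first.
  rewrite cards0 fact0 ln1 mulr0 !add0r; apply: (@le_trans _ _ 0); first by rewrite oppr_le0.
  by rewrite mulr_ge0 ?phase_const_ge0 // addr_ge0.
pose x (w : larm) := n%:R * ((advance L k1 w)%:R * piece_len (tag w)).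
pose X := n%:R * (ev_time L k1 - ev_time L k0).
have dt0 : 0 < ev_time L k1 - ev_time L k0 by rewrite subr_gt0.
have X0 : 0 < X by rewrite mulr_gt0 // ltr0n.
have -> : n%:R * - ((ev_time L k1 - ev_time L k0) *
    \sum_(w in arms_at L k0) aspeed L k0 k1 w * ln (aspeed L k0 k1 w)) =
    - (\sum_(w in arms_at L k0) x w * ln (x w / X)).
  rewrite mulrN mulrA mulr_sumr; congr (- _); apply: eq_bigr => w _.
  have -> : aspeed L k0 k1 w = x w / X.
    rewrite /aspeed /x /X; field; rewrite !gt_eqF ?ltr0n //=.
  by rewrite mulrA; congr (_ * _); rewrite -/X mulrCA mulfV ?gt_eqF // mulr1.
have adv_le w : (advance L k1 w)%:R <= graph_size.
  rewrite ler_nat; apply: leq_trans (advance_le _ _ _) _.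
  apply: leq_trans (leq_trans (pieces_le_sedg (tag w)) (leq_addl _ _)).
  by rewrite /room; case: adir; rewrite ?leq_subr ?astart_le.
have xle w : x w <= (advance L k1 w)%:R by have /andP[] := advance_coord L k1 w.
have := @multinomial_le R larm (mem (arms_at L k0)) (fun w => #|phase_chain L i w|) x X graph_size 1.
rewrite (sum_phase_chain n_gt0 iL hi) => H.
apply: le_trans (H _ _ _ _ _ _ _ length_error _ _) _ => {H}.
- by move=> w _; rewrite mulr_ge0 // mulr_ge0 // ltW // piece_len_gt0.
- move=> w wa; have /andP[a b] := advance_coord L k1 w.
  have c1 := card_phase_chain_le n_gt0 iL hi w; have c2 := card_phase_chain_ge n_gt0 iL hi wa.
  have c1' : #|phase_chain L i w|%:R <= (advance L k1 w)%:R :> R by rewrite ler_nat.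
  have c2' : (advance L k1 w)%:R - 1 <= #|phase_chain L i w|%:R :> R.
    by rewrite lerBlDr natr1 ler_nat -ltnS; move: c2; case: (advance _ _ _).
  by rewrite ler_norml; apply/andP; split; rewrite /x; lra.
- by move=> w _; apply: le_trans (xle w) (adv_le w).
- rewrite ler_nat; apply: leq_trans (leq_addr _ _); exact: max_card.
- apply: (@le_trans _ _ (nfilled L k1)%:R).
    have /andP[b1 _] := ev_time_bounds n_gt0 L k1; apply: le_trans b1.
    rewrite /X ler_wpM2l // lerBlDr lerDl -(ev_time0 n_gt0 iL); exact: ev_time_mono.
  rewrite ler_nat; apply: leq_trans (leq_addl _ _); exact: max_card.
- exact: graph_size_ge1.
- exact: X0.
- have nlt : (nfilled L k0 < nfilled L k1)%N by rewrite -ev_time_lt // ltnW.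
  have [e he] := ev_time_gap n_gt0 (ltnW lt01) nlt.
  by apply: le_trans (piece_len_ge e) _; rewrite /X ler_wpM2l // lerBrDl.
- exact: phase_length.
rewrite lerD2l ler_wpM2r // ?addr_ge0 // /phase_const !lerD2r.
have -> : 1 + 1 *+ 2 = 3 :> R by rewrite -(natrD R 1 2).
by rewrite ler_wpM2r // ler_nat card_arms_at // ev_lt.
Qed.

End Phase.

Lemma label_entropyE :
  label_entropy L = \sum_(i < (size (events L)).-1) phase_entropy i.
Proof.
rewrite /label_entropy big_mkcond -sumrN /=; apply: eq_bigr => i _.
by rewrite /phase_entropy; case: ifP => // _; rewrite oppr0.
Qed.

(** The logarithm of the class size is a sum over blocks. Single event vertices contribute at most
    0, each phase at most its entropy times n plus O(log n), and there are boundedly many phases. *)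
Lemma class_size_le :
  ln (#|sorted_labs S|)%:R <=
  n%:R * label_entropy L + (event_bound L)%:R * phase_const * (1 + ln graph_size).
Proof.
have lB := ln_ge0 graph_size_ge1.
have /sorted_labsP[cL _] := label_schedule_sorted n_gt0 iL.
rewrite (ln_card_sorted R (label_schedule_inj n_gt0 iL) cL).
have lnf k : 0 <= ln (k`!)%:R :> R by rewrite ln_ge0 // ler1n fact_gt0.
pose T (b : 'I_nblk) : R := ln ((#|[set x | blk S x == b]%SET|)`!)%:R -
  \sum_a ln ((#|[set x | chain_of S x == (b, a)]%SET|)`!)%:R.
rewrite -[leLHS]/(\sum_b T b); pose s := (size (events L)).-1.
pose g (i : 'I_s) : 'I_nblk := inord i.+1.*2.
have hs (i : 'I_s) : (i.+1 < size (events L))%N by have := ltn_ord i; rewrite ltn_predRL.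
have gv (i : 'I_s) : g i = i.+1.*2 :> nat.
  rewrite inordK //; have := leq_trans (hs i) (size_events_le L).
  by move: #|svtx| (nat_of_ord i) => N j; lia.
have gi : injective g.
  by move=> i j /(congr1 val) /=; rewrite !gv => /double_inj [] /ord_inj.
(* A block that is not a phase contains at most one vertex. *)
have Tle0 b : b \notin g @: [set: 'I_s]%SET -> T b <= 0.
  move=> bg; rewrite subr_le0; apply: (@le_trans _ _ 0); last exact: sumr_ge0.
  suff : (#|[set x | blk S x == b]%SET| <= 1)%N by case: #|_| => [|[|]] //; rewrite ln1.
  apply/card_le1_eqP => u v; rewrite !inE => /eqP ub /eqP vb.
  have [eu iu] : evtx L u = evtx L v /\ ev_idx L u = ev_idx L v.
    by apply: blk_eq; rewrite ?ub ?vb.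
  have [e|ne] := boolP (evtx L u).
    by apply: (tm_inj iL); rewrite !evtx_tm // -?eu // iu.
  case/imsetP: bg; have [i0 _] := non_evtx_idx n_gt0 iL ne.
  have his : ((ev_idx L u).-1 < s)%N.
    by rewrite /s ltn_predRL prednK // ev_idx_le.
  exists (Ordinal his) => //; apply: val_inj; rewrite -ub /= blkE // gv /= prednK //.
  by rewrite (negbTE ne) addn0.
rewrite (bigID (fun b => b \in g @: [set: 'I_s]%SET)) /=.
apply: (@le_trans _ _ (\sum_(b in g @: [set: 'I_s]%SET) T b + 0)).
  by rewrite lerD2l; apply: sumr_le0 => b; apply: Tle0.
rewrite addr0 big_imset /=; last by move=> i j _ _; apply: gi.
rewrite label_entropyE mulr_sumr big_mkcond /=.
have Ti (i : 'I_s) : T (g i) <= n%:R * phase_entropy i + phase_const * (1 + ln graph_size).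
  apply: le_trans (phase_count_le (hs i)); rewrite /T blk_phase // lerD2l lerN2.
  rewrite (eq_bigr (fun w => ln ((#|[set x | chain_of S x == (g i, Some w)]%SET|)`!)%:R)); last first.
    by move=> w _; rewrite chain_phase.
  have si : injective (@Some larm) by move=> a b [].
  rewrite -(big_imset (fun a => ln ((#|[set x | chain_of S x == (g i, a)]%SET|)`!)%:R) (h := Some) (A := mem (arms_at L (ev L i)))) /=; last first.
    by move=> a b _ _; apply: si.
  rewrite [leRHS](bigID (fun a => a \in [set Some x | x in arms_at L (ev L i)]%SET)) /=.
  by rewrite lerDl; apply: sumr_ge0.
apply: (@le_trans _ _ (\sum_(i < s) (n%:R * phase_entropy i + phase_const * (1 + ln graph_size)))).
  by apply: ler_sum => i _; rewrite inE.
rewrite big_split /= lerD2l sumr_const card_ord -[leLHS]mulr_natl -[leRHS]mulrA.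
rewrite ler_wpM2r ?mulr_ge0 ?phase_const_ge0 ?addr_ge0 // ler_nat.
by apply: leq_trans (leq_pred _) (size_events n_gt0 iL).
Qed.

End OneLabeling.
End ClassSize.

(** * The number of classes is polynomial in n *)

Section SetCode.
Import fintype finset.
Local Open Scope nat_scope.
Variable T : finType.

(** Encodes sets of at most [c] elements by [c]-tuples, so that their number is polynomial in the
    size of [T] rather than exponential. *)
Definition set_code c (A : {set T}) : {ffun 'I_c -> option T} :=
  [ffun i : 'I_c => nth None (map Some (enum A)) i].

Lemma set_codeK c (A : {set T}) : #|A| <= c ->
  A = [set x | [exists i, set_code c A i == Some x]]%SET.
Proof.
move=> Ac; apply/setP => x; rewrite inE; apply/idP/existsP => [xA|[i]].
  have ix : index x (enum A) < #|A| by rewrite cardE index_mem mem_enum.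
  exists (Ordinal (leq_trans ix Ac)); rewrite ffunE /= (nth_map x) -?cardE //.
  by rewrite nth_index // mem_enum.
rewrite ffunE; have [lt|ge] := ltnP i (size (enum A)).
  by rewrite (nth_map x) // => /eqP[<-]; rewrite -(mem_enum A) mem_nth.
by rewrite nth_default // size_map.
Qed.

Lemma set_code_inj c (A B : {set T}) : #|A| <= c -> #|B| <= c ->
  set_code c A = set_code c B -> A = B.
Proof. by move=> Ac Bc e; rewrite (set_codeK Ac) e -set_codeK. Qed.

End SetCode.

Section ClassCount.
Import fintype finset.
Local Open Scope nat_scope.
Variables (R : realType) (G : metric_graph R) (n M : nat).
Hypothesis n_gt0 : 0 < n.
Local Notation pieces := (@pieces R G n).
Local Notation svtx := (@svtx R G n).
Local Notation svert := (@svert R G n).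
Local Notation sedg := (@sedg R G n).
Local Notation labeling := (@labeling R G n).
Local Notation larm := (@larm R G n).
Local Notation avert := (@avert R G n).
Local Notation degs := (#|edg G|.*2).

Definition max_sources := #|vtx G| + M.
Definition max_events := max_sources + degs * max_sources.
Definition max_front := degs * max_sources.

Lemma labelingsP (L : labeling) :
  reflect (injective L /\ #|peaks L| = M) (L \in labelings G n M).
Proof.
rewrite inE; apply: (iffP andP) => [[/injectiveP i /eqP p]|[i p]] //.
by split; [exact/injectiveP|exact/eqP].
Qed.

(** Boundedly many data with polynomially many values each. An occupied set is too large to be
    recorded, so its frontier and its original vertices are kept instead. *)
Definition class_key (L : labeling) :
    {ffun 'I_max_events -> 'I_#|svtx|.+1 * option svtx *
       {ffun 'I_max_front -> option larm} * {set vtx G}} *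
    'I_max_events.+1 * {ffun 'I_M -> option svtx} :=
  ([ffun i : 'I_max_events => (inord (ev L i), [pick v | newest L (ev L i) v],
      set_code max_front (front L (ev L i)), [set u | inl u \in occupied L (ev L i)]%SET)],
   inord (size (events L)), set_code M (peaks L)).

(** Along an edge, starting from its initial vertex, membership changes exactly across the
    frontier. *)
Lemma occupied_front (L L' : labeling) k : front L k = front L' k ->
  (forall u, (inl u \in occupied L k) = (inl u \in occupied L' k)) ->
  occupied L k = occupied L' k.
Proof.
move=> ef eo; apply/setP => v; have [e [p [pp ->]]] := svtx_on_edge n_gt0 v.
elim: p pp => [|p ih] pp; first by rewrite svert0 eo.
have ihp := ih (ltnW pp); have p1 : p < (pieces e).+1 by exact: ltnW.
pose w1 : larm := existT _ e (true, Ordinal p1).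
pose w2 : larm := existT _ e (false, Ordinal (pp : p.+1 < (pieces e).+1)).
have a1 (L0 : labeling) : (w1 \in front L0 k) =
    (svert e p \in occupied L0 k) && (svert e p.+1 \notin occupied L0 k).
  rewrite inE !occupiedE -ltnNge /room /Defs.avert /astart /= addn0 addn1.
  by rewrite subn_gt0 pp.
have a2 (L0 : labeling) : (w2 \in front L0 k) =
    (svert e p.+1 \in occupied L0 k) && (svert e p \notin occupied L0 k).
  by rewrite inE !occupiedE -ltnNge /room /Defs.avert /astart /= subn0 subn1.
have := a1 L; have := a2 L; rewrite ef a1 a2 ihp.
by case: (svert e p \in _) => /=; rewrite ?andbT ?andbF // => _ /negb_inj.
Qed.

Lemma class_keyP (L L' : labeling) : L \in labelings G n M -> L' \in labelings G n M ->
  class_key L = class_key L' -> same_schedule L L'.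
Proof.
move=> /labelingsP[iL pL] /labelingsP[iL' pL'] [/ffunP ek es ep].
have se (L0 : labeling) : injective L0 -> #|peaks L0| = M -> size (events L0) <= max_events.
  by move=> i0 p0; rewrite /max_events /max_sources -p0; apply: size_events.
have ss : size (events L) = size (events L').
  by move/(congr1 val): es; rewrite /= !inordK // ltnS se.
have pk : peaks L = peaks L' by apply: set_code_inj ep; rewrite ?pL ?pL'.
have evN (L0 : labeling) i : injective L0 -> i < size (events L0) -> ev L0 i < #|svtx|.
  by move=> i0 hi; apply: ev_lt.
have K i : i < size (events L) -> [/\ ev L i = ev L' i,
    newest L (ev L i) =1 newest L' (ev L i) & occupied L (ev L i) = occupied L' (ev L i)].
  move=> hi; have hi' := hi; rewrite ss in hi'.
  have hE : i < max_events by apply: leq_trans hi (se _ iL pL).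
  have := ek (Ordinal hE); rewrite !ffunE /= => -[] /(congr1 val) /=.
  rewrite !inordK; try (by apply: ltnW; rewrite ltnS evN).
  move=> ee pp ff oo; split=> //.
    move=> v; rewrite !newestE; move: pp; rewrite -ee.
    have [u <- _] := events_vtx n_gt0 iL (mem_ev hi).
    case: pickP => [a|/(_ u)]; last by rewrite newestE eqxx.
    rewrite newestE => /eqP /(tm_inj iL) ->; case: pickP => // b; rewrite newestE => /eqP hb [ub].
    by rewrite -{2}hb -ub (inj_eq (tm_inj iL)) (inj_eq (tm_inj iL')).
  apply: occupied_front; last first.
    by move=> u; have /setP/(_ u) := oo; rewrite !inE -ee.
  have fr (L0 : labeling) : injective L0 -> #|peaks L0| = M -> i < size (events L0) ->
      #|front L0 (ev L0 i)| <= max_front.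
    by move=> i0 p0 h; rewrite /max_front /max_sources -p0; apply: front_le => //; apply: evN.
  by rewrite [in RHS]ee; apply: set_code_inj ff; apply: fr.
have ev_eq : events L = events L'.
  by apply: (eq_from_nth (x0 := 0)) => // i hi; have [] := K i hi.
split=> // k /(nthP 0)[i hi <-]; have [_ h1 h2] := K i hi; [exact: h2|exact: h1].
Qed.

Definition max_classes : nat := #|{: {ffun 'I_max_events -> 'I_#|svtx|.+1 * option svtx *
       {ffun 'I_max_front -> option larm} * {set vtx G}} *
    'I_max_events.+1 * {ffun 'I_M -> option svtx}}|.

Lemma card_larm : #|larm| <= 4 * #|sedg|.
Proof.
rewrite card_tagged sumnE big_map big_enum /= card_sedg big_distrr /=.
apply: leq_sum => e _; rewrite card_prod card_bool card_ord.
have := pieces_gt0 n_gt0 e; move: (pieces e) => p; lia.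
Qed.

(** The exponent does not depend on n: only the graph size grows. *)
Lemma max_classes_le : max_classes <=
  (2 ^ (#|vtx G| * max_events) * max_events.+1) *
  (5 * (#|svtx| + #|sedg|)) ^ ((2 + max_front) * max_events + M).
Proof.
rewrite /max_classes !card_prod !card_ffun !card_prod !card_ord !card_option !card_ffun
  !card_option card_ord.
have -> : #|{set vtx G}| = 2 ^ #|vtx G|.
  by rewrite -[LHS]cardsT -powersetT card_powerset cardsT.
set Q := 5 * _; have N0 : 0 < #|sedg|.
  have [e _] := card_gt0P (edg_gt0 G).
  exact: leq_trans (pieces_gt0 n_gt0 e) (pieces_le_sedg n e).
have q1 : #|svtx|.+1 <= Q by rewrite /Q; move: N0; move: #|svtx| #|sedg| => a b; lia.
have q2 : #|larm|.+1 <= Q.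
  have := card_larm; rewrite /Q; move: N0; move: #|svtx| #|sedg| #|larm| => a b c; lia.
have mono a b e : a <= b -> a ^ e <= b ^ e.
  by move=> ab; elim: e => // e ih; rewrite !expnS leq_mul.
rewrite expnMn -expnM expnD [X in _ <= X]mulnACA.
rewrite [X in X * _ * _ <= _]mulnC -!mulnA leq_mul2l; apply/orP; right.
rewrite mulnCA [X in _ <= X]mulnCA leq_mul2l; apply/orP; right.
apply: leq_mul; last exact: mono.
rewrite expnM; apply: (mono _ _ _); rewrite mulnA expnD; apply: leq_mul; last exact: mono.
by rewrite expnS expn1 leq_mul.
Qed.


End ClassCount.

(** * Chebyshev bound for labelings whose chains do not advance in proportion *)

Section Deviation.
Import fintype finset.
Local Open Scope ring_scope.
Variables (R : realType) (X I : finType) (B : nat) (S : schedule X I B).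
Local Notation lab := {ffun X -> 'I_#|X|}.
Hypothesis pos_inj : forall x y,
  chain_of S x = chain_of S y -> pos S x = pos S y -> x = y.

Definition sblock (b : 'I_B) : {set X} := [set x | blk S x == b]%SET.
Definition schain (c : 'I_B * I) : {set X} := [set x | chain_of S x == c]%SET.

Definition early (L : lab) (D : {set X}) (t : nat) : nat :=
  #|[set x in D | (ltime L x < t)%N]%SET|.

Lemma early_perm (L : lab) (D : {set X}) t (s : {perm X}) :
  (forall x, (s x \in D) = (x \in D)) -> early (lperm L s) D t = early L D t.
Proof.
move=> sD; rewrite /early -[RHS](card_imset _ (@perm_inj _ s^-1%g)).
apply: eq_card => x; apply/idP/imsetP => [|[y + ->]]; rewrite !inE /ltime ffunE.
  by move=> h; exists (s x); rewrite ?permK // !inE sD /ltime.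
by rewrite permKV -{1}(permKV s y) sD.
Qed.

Variables (step J : nat) (delta : R).
Hypothesis delta_gt0 : 0 < delta.

(** The early part of the chain differs from its proportional share of the early part of the block
    by at least [delta], after multiplying by the block size. Only multiples of [step] are tested,
    so that the union bound runs over [J] thresholds. *)
Definition deviates (L : lab) (c : 'I_B * I) (j : nat) : bool :=
  (0 < #|sblock c.1|)%N && (delta * #|sblock c.1|%:R <=
   `|#|sblock c.1|%:R * (early L (schain c) (j * step))%:R -
     #|schain c|%:R * (early L (sblock c.1) (j * step))%:R|).

Definition irregular (L : lab) : bool :=
  [exists c : 'I_B * I, [exists j : 'I_J, deviates L c j]].

Lemma schain_sub c : schain c \subset sblock c.1.
Proof. by apply/subsetP => x; rewrite !inE => /eqP <-. Qed.

Lemma sum_schain : (\sum_(c : 'I_B * I) #|schain c| = #|X|)%N.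
Proof.
rewrite -[RHS]sum1_card (partition_big (chain_of S) xpredT) //=.
by apply: eq_bigr => c _; rewrite -sum1_card; apply: eq_bigl => x; rewrite inE.
Qed.

Lemma irregular_perm (L : lab) h : L \in compat S -> h \in fibre_perm (chain_of S) ->
  irregular (lperm L h) = irregular L.
Proof.
move=> _ /fibre_permP hh; apply: eq_existsb => c; apply: eq_existsb => j.
rewrite /deviates !early_perm //.
  by move=> x; rewrite !inE; have [->] := hh x.
by move=> x; rewrite !inE hh.
Qed.

Lemma card_deviates (L0 : lab) c j : L0 \in compat S ->
  #|[set L in compat S | deviates L c j]%SET|%:R * delta ^+ 2 <=
  #|compat S|%:R * #|schain c|%:R :> R.
Proof.
move=> cL0; have [A0|A0] := posnP #|sblock c.1|.
  rewrite (_ : [set L in _ | _]%SET = finset.set0) ?cards0 ?mul0r ?mulr_ge0 //.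
  by apply/setP => L; rewrite !inE /deviates A0 ltnn andbF.
have A0' : 0 < #|sblock c.1|%:R :> R by rewrite ltr0n.
have := block_concentration R cL0 (j * step) (schain_sub c).
move=> H; rewrite -(ler_pM2r (exprn_gt0 2 A0')) -mulrA -exprMn; apply: le_trans H.
have -> : #|[set L in compat S | deviates L c j]%SET|%:R * (delta * #|sblock c.1|%:R) ^+ 2 =
    \sum_(L in compat S | deviates L c j) (delta * #|sblock c.1|%:R) ^+ 2.
  rewrite mulr_natl -sumr_const; apply: eq_bigl => L; by rewrite inE.
rewrite [leRHS](bigID (fun L => deviates L c j)) /= -[leLHS]addr0.
apply: lerD; last by apply: sumr_ge0 => L _; exact: sqr_ge0.
apply: ler_sum => L /andP[cL /andP[_ dL]].
have dA : 0 <= delta * #|sblock c.1|%:R by rewrite mulr_ge0 // ltW.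
rewrite -(real_normK (num_real (_ - _))) ler_sqr ?nnegrE ?normr_ge0 //.
apply: le_trans dL _; rewrite le_eqVlt; apply/orP; left; apply/eqP.
congr (`|_ - _ * _%:R|).
have [s /fibre_permP sY ->] := compat_lperm cL0 cL.
by rewrite early_perm // => x; rewrite !inE sY.
Qed.

(** Union bound over chains and thresholds. The bound for a chain is proportional to its length and
    the lengths sum to [#|X|], so the number of chains does not enter. *)
Lemma card_irregular_compat (L0 : lab) : L0 \in compat S ->
  #|[set L in compat S | irregular L]%SET|%:R * delta ^+ 2 <=
  #|compat S|%:R * (#|X| * J)%:R :> R.
Proof.
move=> cL0; apply: (@le_trans _ _ (\sum_(c : 'I_B * I) \sum_(j < J)
   #|[set L in compat S | deviates L c j]%SET|%:R * delta ^+ 2)).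
  under eq_bigr do rewrite -mulr_suml -natr_sum.
  rewrite -mulr_suml -natr_sum ler_wpM2r ?sqr_ge0 // ler_nat.
  have sub : [set L in compat S | irregular L]%SET \subset
     \bigcup_(c : 'I_B * I) \bigcup_(j < J) [set L in compat S | deviates L c j]%SET.
    apply/subsetP => L; rewrite inE => /andP[cL /existsP[c /existsP[j dj]]].
    by apply/bigcupP; exists c => //; apply/bigcupP; exists j => //; rewrite inE cL.
  apply: leq_trans (subset_leq_card sub) _.
  apply: (big_ind2 (fun (A : {set lab}) m => (#|A| <= m)%N)); first by rewrite cards0.
    by move=> A a A' b hA hB; apply: leq_trans (leq_card_setU _ _) (leq_add hA hB).
  move=> c _; apply: (big_ind2 (fun (A : {set lab}) m => (#|A| <= m)%N)); first by rewrite cards0.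
    by move=> A a A' b hA hB; apply: leq_trans (leq_card_setU _ _) (leq_add hA hB).
  by [].
have -> : (#|X| * J)%:R = \sum_(c : 'I_B * I) #|schain c|%:R * J%:R :> R.
  by rewrite -mulr_suml -natr_sum sum_schain natrM.
rewrite mulr_sumr; apply: ler_sum => c _; rewrite mulrA.
apply: (@le_trans _ _ (\sum_(j < J) #|compat S|%:R * #|schain c|%:R)).
  by apply: ler_sum => j _; exact: (card_deviates _ _ cL0).
by rewrite sumr_const card_ord [leRHS]mulr_natr.
Qed.

(** Irregularity depends only on the sets of times occupied by the chains, which rearranging along
    chains preserves; [card_sorted_compat] transfers the estimate. *)
Lemma card_irregular_sorted (L0 : lab) : L0 \in compat S ->
  #|[set L in sorted_labs S | irregular L]%SET|%:R * delta ^+ 2 <=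
  #|sorted_labs S|%:R * (#|X| * J)%:R :> R.
Proof.
move=> cL0; have h := card_irregular_compat cL0.
have h0 : 0 < #|fibre_perm (chain_of S)|%:R :> R.
  by rewrite ltr0n; apply/card_gt0P; exists 1%g; apply/fibre_permP => x; rewrite perm1.
rewrite -(ler_pM2r h0); move: h.
rewrite -(card_sorted_compat pos_inj irregular_perm) -(card_sorted_perm pos_inj) !natrM.
by rewrite ![_ * #|fibre_perm _|%:R * _]mulrAC.
Qed.

End Deviation.

(** * The labelings with M peaks, partitioned into classes *)

Section Classes.
Import fintype finset.
Local Open Scope ring_scope.
Variables (R : realType) (G : metric_graph R) (n M : nat).
Hypothesis n_gt0 : (0 < n)%N.
Local Notation labeling := (@labeling R G n).
Local Notation svtx := (@svtx R G n).
Local Notation lab := (labelings G n M).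

Definition label_class (L : labeling) : {set labeling} := sorted_labs (label_schedule L).

Lemma label_class_schedule L L' : L \in lab -> L' \in label_class L ->
  label_schedule L' = label_schedule L.
Proof.
move=> /labelingsP[iL _] cL'; have iL' := sorted_inj cL'.
by rewrite (same_schedule_eq n_gt0 iL iL' (sorted_same_schedule n_gt0 iL cL')).
Qed.

Lemma label_class_labelings L L' : L \in lab -> L' \in label_class L ->
  L' \in lab /\ label_class L' = label_class L.
Proof.
move=> Ll cL'; have /labelingsP[iL pL] := Ll; have iL' := sorted_inj cL'.
split; first by apply/labelingsP; split=> //; rewrite -(sorted_peaks n_gt0 iL cL').
by rewrite /label_class (label_class_schedule Ll cL').
Qed.

Lemma label_class_refl L : L \in lab -> L \in label_class L.
Proof. by move=> /labelingsP[iL _]; apply: label_schedule_sorted. Qed.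

(** All members of a class have that same class, so the classes partition the labelings, and a bound
    on proportions in each class passes to the whole. *)
Lemma class_average (P : pred labeling) (eta : R) :
  (forall L, L \in lab ->
     #|[set L' in label_class L | P L']%SET|%:R <= eta * #|label_class L|%:R) ->
  #|[set L in lab | P L]%SET|%:R <= eta * #|lab|%:R.
Proof.
move=> H; rewrite -!sum1_card !natr_sum mulr_sumr.
rewrite (eq_bigl (fun L => (L \in lab) && P L)); last by move=> L; rewrite inE.
rewrite (partition_big label_class xpredT) //= [leRHS](partition_big label_class xpredT) //=.
apply: ler_sum => C _.
have [/existsP[L0 /andP[L0l /eqP L0C]]|no] := boolP [exists L, (L \in lab) && (label_class L == C)].
  have E L : (L \in lab) && (label_class L == C) = (L \in C).
    apply/andP/idP => [[Ll /eqP <-]|]; first exact: label_class_refl.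
    by rewrite -L0C => /(label_class_labelings L0l)[-> ->].
  have := H L0 L0l; rewrite L0C -!sum1_card !natr_sum mulr_sumr.
  rewrite [X in X <= _](eq_bigl (fun L => (L \in lab) && P L && (label_class L == C))).
    by move=> h; apply: le_trans h _; rewrite [leRHS](eq_bigl (mem C)).
  by move=> L; rewrite inE -E andbAC.
rewrite !big_pred0 // => L; apply/negbTE; apply: contra no => /andP[].
  by move=> h1 h2; apply/existsP; exists L; rewrite h1.
by move=> /andP[h1 _] h2; apply/existsP; exists L; rewrite h1.
Qed.

Hypothesis n_big : forall e : edg G, 1 <= n%:R * len e.
Local Notation degs := (#|edg G|.*2).
Local Notation max_events := (max_events G M).
Local Notation max_sources := (max_sources G M).

Definition max_arms : nat := degs * max_sources + degs * M.
Definition max_error : R := (#|edg G| + degs * max_events)%:R *+ 2 + 1.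
Definition class_error : R :=
  max_events%:R * (max_arms%:R * 3 + max_error + max_error ^+ 2 *+ 2 + 1).

Lemma label_class_size L : L \in lab ->
  #|label_class L|%:R <= expR (n%:R * label_entropy L + class_error * (1 + ln (graph_size G n))).
Proof.
move=> Ll; have /labelingsP[iL pL] := Ll.
have p : 0 < #|label_class L|%:R :> R.
  by rewrite ltr0n; apply/card_gt0P; exists L; apply: label_class_refl.
rewrite -[leLHS]lnK ?posrE // ler_expR; apply: le_trans (class_size_le n_gt0 n_big iL) _.
by rewrite /class_error /max_error /max_arms -pL.
Qed.

(** Labelings with equal key lie in one class. If one of them has entropy at most [b], then
    [label_class_size] for that one bounds how many share its key. *)
Lemma card_low_entropy (b : R) :
  #|[set L in lab | label_entropy L <= b]%SET|%:R <=
  (max_classes G n M)%:R * expR (n%:R * b + class_error * (1 + ln (graph_size G n))).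
Proof.
rewrite -sum1_card natr_sum (partition_big (class_key M) xpredT) //=.
rewrite /max_classes -[in leRHS]sum1_card natr_sum mulr_suml.
apply: ler_sum => k _; rewrite mul1r.
have [/existsP[L0 /andP[+ /eqP L0k]]|no] := boolP [exists L, (L \in [set L in lab | label_entropy L <= b]%SET) && (class_key M L == k)]; last first.
  rewrite big_pred0 ?expR_ge0 // => L; apply/negbTE; apply: contra no => h.
  by apply/existsP; exists L.
rewrite inE => /andP[L0l L0b].
apply: (@le_trans _ _ #|label_class L0|%:R); last first.
  apply: le_trans (label_class_size L0l) _; rewrite ler_expR lerD2r ler_wpM2l //.
rewrite -sum1_card natr_sum big_mkcond [leRHS]big_mkcond /=; apply: ler_sum => L _.
case: ifP => [/andP[+ /eqP Lk]|_]; last by case: ifP.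
rewrite inE => /andP[Ll _]; have /labelingsP[iL0 _] := L0l; have /labelingsP[iL _] := Ll.
have ss : same_schedule L0 L.
  by apply: (class_keyP n_gt0 L0l Ll); rewrite Lk.
have Lc : L \in label_class L0 := same_schedule_sorted n_gt0 iL0 iL ss.
by rewrite Lc.
Qed.

Lemma card_irregular (step J : nat) (delta : R) : 0 < delta ->
  #|[set L in lab | irregular (label_schedule L) step J delta L]%SET|%:R <=
  ((#|svtx| * J)%:R / delta ^+ 2) * #|lab|%:R.
Proof.
move=> d0; apply: class_average => L Ll; have /labelingsP[iL _] := Ll.
have /sorted_labsP[cL _] := label_schedule_sorted n_gt0 iL.
have := card_irregular_sorted (label_schedule_inj n_gt0 iL) step J d0 cL.
rewrite -ler_pdivlMr ?exprn_gt0 // => h.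
rewrite mulrC mulrA; apply: le_trans h; rewrite ler_nat.
apply: subset_leq_card; apply/subsetP => L' /setIdP[cL' irr]; apply/setIdP; split; first exact: cL'.
by rewrite -(label_class_schedule Ll cL').
Qed.

End Classes.

(** * The vertices flooded at a given time *)

Section FloodedVertices.
Import fintype finset.
Local Open Scope ring_scope.
Variables (R : realType) (G : metric_graph R) (n : nat).
Hypothesis n_gt0 : (0 < n)%N.
Local Notation pieces := (@pieces R G n).
Local Notation piece_len := (@piece_len R G n).
Local Notation svert := (@svert R G n).
Local Notation labeling := (@labeling R G n).
Local Notation svtx := (@svtx R G n).
Local Notation larm := (@larm R G n).
Local Notation avert := (@avert R G n).
Local Notation spoint := (@spoint R G n).

Lemma coord_range e p : (p <= pieces e)%N -> 0 <= p%:R * piece_len e <= len e.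
Proof.
move=> pp; rewrite mulr_ge0 ?(ltW (piece_len_gt0 n_gt0 e)) //=.
by rewrite -(pieces_piece_len n_gt0 e) ler_wpM2r ?(ltW (piece_len_gt0 n_gt0 e)) // ler_nat.
Qed.

Lemma spoint_svert e p : (p <= pieces e)%N -> spoint (svert e p) = pt e (p%:R * piece_len e).
Proof.
move=> pp; have [->|p0] := posnP p; first by rewrite svert0 mul0r pt0.
have [lt|ge] := ltnP p (pieces e); last first.
  by rewrite svert_end //= (_ : p = pieces e) ?pieces_piece_len ?ptl //; apply/eqP; rewrite eqn_leq pp.
by have [j <- ->] := svert_inner n_gt0 p0 lt.
Qed.

Lemma coord_inner e p : (0 < p < pieces e)%N -> inner (e, p%:R * piece_len e).
Proof.
move=> /andP[p0 pp]; rewrite /inner /= mulr_gt0 ?piece_len_gt0 ?ltr0n //=.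
by rewrite -(pieces_piece_len n_gt0 e) ltr_pM2r ?piece_len_gt0 // ltr_nat.
Qed.

Lemma spointP v e x : 0 <= x <= len e -> spoint v = pt e x ->
  exists p, [/\ (p <= pieces e)%N, v = svert e p & x = p%:R * piece_len e].
Proof.
move=> rx; case: (svtxP n_gt0 v) => [u|e' p p0 pp] h.
  have [x0|xl|xi] := range_cases rx.
  - by exists 0; rewrite x0 mul0r; split=> //; move: h; rewrite x0 pt0 => -[->].
  - exists (pieces e); rewrite pieces_piece_len // svert_end //.
    by split=> //; move: h; rewrite xl ptl => -[->].
  by move: h; rewrite pt_inner.
move: h; rewrite spoint_svert 1?ltnW // => h.
have rp := coord_range (ltnW pp).
have [+ _] := pt_eqP rp rx; move=> /(_ h) [[<- <-]|[u [eu _]]].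
  by exists p; rewrite ltnW.
have : inner (e', p%:R * piece_len e') by apply: coord_inner; rewrite p0.
move: eu; rewrite /endpoint /inner /=; case: eqP => [->|_]; first by rewrite ltxx.
by case: eqP => [->|//]; rewrite ltxx andbF.
Qed.

Section OneLabeling.
Variable L : labeling.
Hypothesis iL : injective L.
Local Notation tml := (@ltime svtx L).

Lemma segment_ends d v : segment d (spoint v) -> v = ssrc d \/ v = stgt d.
Proof.
case: d => e p; rewrite /segment /ssrc /stgt /= => -[x /andP[x1 x2] h].
have pl0 := piece_len_gt0 n_gt0 e.
have rx : 0 <= x <= len e.
  have /andP[a _] := coord_range (ltnW (ltn_ord p)); have /andP[_ b] := coord_range (ltn_ord p).
  by rewrite (le_trans a x1) (le_trans x2 b).
have [q [qp -> xq]] := spointP rx h; move: x1 x2; rewrite xq !ler_pM2r // !ler_nat.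
move=> a b; have [->|ne] := eqVneq q p; first by left.
by right; congr svert; lia.
Qed.

Lemma ssrc_segment d : segment d (spoint (ssrc d)).
Proof.
case: d => e p; rewrite /segment /ssrc /=; exists (p%:R * piece_len e).
  by rewrite lexx ler_wpM2r ?ler_nat // ltW // piece_len_gt0.
by rewrite spoint_svert // ltnW.
Qed.

Lemma stgt_segment d : segment d (spoint (stgt d)).
Proof.
case: d => e p; rewrite /segment /stgt /=; exists (p.+1%:R * piece_len e).
  by rewrite lexx ler_wpM2r ?ler_nat // ltW // piece_len_gt0.
by rewrite spoint_svert.
Qed.

Lemma spoint_inj : injective spoint.
Proof.
move=> u v h; have [e [p [pp uE]]] := svtx_on_edge n_gt0 u.
have : spoint v = pt e (p%:R * piece_len e) by rewrite -h uE spoint_svert.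
move=> /(spointP (coord_range pp))[q [qp -> /mulIf]].
by rewrite gt_eqF ?piece_len_gt0 // => /(_ isT) /eqP; rewrite eqr_nat => /eqP <-.
Qed.

Lemma ev_state_sub k v : ev_state L k (spoint v) -> v \in peaks L \/ (tml v <= k)%N.
Proof.
case=> [[u pu /spoint_inj ->]|[d]]; first by left.
rewrite filledE => /andP[a b] /segment_ends[]->; by right.
Qed.

(** A vertex that is not a peak has an earlier neighbor, and the edge between the two is filled as
    soon as the vertex joins. *)
Lemma ev_state_sup k v : (v \in peaks L) || (tml v <= k)%N -> ev_state L k (spoint v).
Proof.
have [pv _|pv /= vk] := boolP (v \in peaks L); first by left; exists v.
have /card_gt0P[d] := filled_by_gt0 n_gt0 iL pv; rewrite inE => h; right; exists d.
  rewrite filledE; case/orP: h => /andP[/eqP -> lt]; rewrite vk ?andbT /=; exact: leq_trans (ltnW lt) vk.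
case/orP: h => /andP[/eqP <- _]; [exact: ssrc_segment|exact: stgt_segment].
Qed.

Definition phase_frac i (t : R) : R :=
  (t - ev_time L (ev L i)) / (ev_time L (ev L i.+1) - ev_time L (ev L i)).

Lemma acoordE i w s : ev_time L (ev L i) < ev_time L (ev L i.+1) ->
  acoord L (ev L i) (ev L i.+1) w s =
  (if adir w then (astart w)%:R + (advance L (ev L i.+1) w)%:R * phase_frac i s
   else (astart w)%:R - (advance L (ev L i.+1) w)%:R * phase_frac i s) * piece_len (tag w).
Proof.
move=> lt; have d : ev_time L (ev L i.+1) - ev_time L (ev L i) != 0 by rewrite gt_eqF // subr_gt0.
rewrite /acoord /aspeed /phase_frac; case: (adir w); field; exact: d.
Qed.

Lemma arm_point i w s v : ev_time L (ev L i) < ev_time L (ev L i.+1) ->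
  ev_time L (ev L i) <= s <= ev_time L (ev L i.+1) ->
  spoint v = pt (tag w) (acoord L (ev L i) (ev L i.+1) w s) ->
  exists j, [/\ (j <= advance L (ev L i.+1) w)%N, v = avert w j
     & j%:R = (advance L (ev L i.+1) w)%:R * phase_frac i s].
Proof.
move=> lt /andP[s0 s1]; rewrite acoordE //.
have d : 0 < ev_time L (ev L i.+1) - ev_time L (ev L i) by rewrite subr_gt0.
have f0 : 0 <= phase_frac i s by rewrite divr_ge0 ?subr_ge0 // ltW.
have f1 : phase_frac i s <= 1 by rewrite ler_pdivrMr // mul1r lerD2r.
set a := (advance L (ev L i.+1) w)%:R; set th := phase_frac i s in f0 f1 *.
have a0 : 0 <= a * th by rewrite mulr_ge0.
have a1 : a * th <= a by rewrite -[leRHS]mulr1 ler_wpM2l.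
have ar := advance_le L (ev L i.+1) w; have sp := astart_le w.
have pl0 := piece_len_gt0 n_gt0 (tag w).
have P0 : pieces (tag w) = pieces (tag w) by [].
move: ar; rewrite /room /Defs.avert; case: (adir w) => ar h.
  have rx : 0 <= ((astart w)%:R + a * th) * piece_len (tag w) <= len (tag w).
    rewrite mulr_ge0 ?addr_ge0 ?(ltW pl0) //= -(pieces_piece_len n_gt0 (tag w)) ler_pM2r //.
    apply: (@le_trans _ _ ((astart w)%:R + a)); first by rewrite lerD2l.
    by rewrite /a -natrD ler_nat -leq_subRL.
  have [q [qp vq /(mulIf (lt0r_neq0 pl0)) e]] := spointP rx h.
  have aq : (astart w <= q)%N by rewrite -(ler_nat R) -e lerDl.
  have jE : (q - astart w)%:R = a * th by rewrite natrB // -e addrC addKr.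
  exists (q - astart w)%N; split=> //; last by rewrite subnKC.
  by rewrite -(ler_nat R) jE.
have rx : 0 <= ((astart w)%:R - a * th) * piece_len (tag w) <= len (tag w).
  rewrite mulr_ge0 ?(ltW pl0) //=; last first.
    by rewrite subr_ge0 (le_trans a1) // /a ler_nat.
  rewrite -(pieces_piece_len n_gt0 (tag w)) ler_pM2r //.
  apply: (@le_trans _ _ (astart w)%:R); first by rewrite gerBl.
  by rewrite ler_nat.
have [q [qp vq /(mulIf (lt0r_neq0 pl0)) e]] := spointP rx h.
have qa : (q <= astart w)%N by rewrite -(ler_nat R) -e gerBl.
have jE : (astart w - q)%:R = a * th by rewrite natrB // -e opprB addrC subrK.
exists (astart w - q)%N; split=> //; last by rewrite subKn.
by rewrite -(ler_nat R) jE.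
Qed.

Variables (i : nat) (t : R).
Hypothesis hi : (i.+1 < size (events L))%N.
Hypothesis ti : ev_time L (ev L i) <= t < ev_time L (ev L i.+1).
Local Notation k0 := (ev L i).
Local Notation k1 := (ev L i.+1).
Local Notation adv := (advance L k1).

Let lt_t : ev_time L k0 < ev_time L k1.
Proof. by case/andP: ti => a b; apply: le_lt_trans b. Qed.

Let ev_le j j' : (j <= j')%N -> (j' < size (events L))%N -> (ev L j <= ev L j')%N.
Proof.
rewrite leq_eqVlt => /predU1P[->//|jj] hj; apply: ltnW; apply: ev_ltn; by rewrite jj.
Qed.

Let k_le j : (j < size (events L))%N -> ev_time L (ev L j) <= t -> (ev L j <= k0)%N.
Proof.
move=> hj jt; have [/ev_le le|lt] := leqP j i; first by apply: le; exact: ltnW.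
case/andP: ti => _ /(le_lt_trans jt); rewrite ltNge ev_time_mono //.
exact: ev_le.
Qed.

(** Arms of earlier phases reach only peaks and vertices already occupied at [k0]; an arm of the
    current phase has covered the elapsed fraction of its run. *)
Lemma flooded_sub v : v \in flooded L t ->
  [\/ v \in peaks L, (tml v <= k0)%N |
   exists w j, [/\ w \in arms_at L k0, (j <= adv w)%N, v = avert w j &
                   j%:R <= (adv w)%:R * phase_frac i t]].
Proof.
rewrite inE => /asboolP[[k [kE kt /ev_state_sub[]]]|]; first by constructor 1.
  move=> vk; constructor 2; apply: leq_trans vk _.
  by move: kE kt => /(nthP 0)[j hj <-]; apply: k_le.
move=> [i' [w [s [hi' lt' wa [/andP[s0 st] ti'] h]]]].
have s1 : s <= ev_time L (ev L i'.+1) by apply: le_trans ti'.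
have rs : ev_time L (ev L i') <= s <= ev_time L (ev L i'.+1) by rewrite s0.
have [j [ja vj jE]] := arm_point lt' rs h.
have [ii|ne] := eqVneq i' i.
  subst i'; constructor 3; exists w, j; split=> //; rewrite jE ler_wpM2l //.
  by rewrite /phase_frac ler_pM2r ?invr_gt0 ?subr_gt0 // lerD2r.
have lti : (i' < i)%N.
  rewrite ltn_neqAle ne /= leqNgt; apply/negP => lti.
  have : ev_time L k1 <= ev_time L (ev L i') by apply: ev_time_mono => //; apply: ev_le => //; exact: ltnW.
  by case/andP: ti => _ b c; have := lt_le_trans b c; rewrite ltNge (le_trans s0 st).
have le1 : (ev L i'.+1 <= k0)%N by apply: ev_le => //; exact: ltnW.
case: j ja vj {jE} => [|j] ja vj.
  have /arms_atP[_ /orP[a|a] _] := wa; last by constructor 1; rewrite vj.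
  by constructor 2; rewrite vj (leq_trans a) // ev_le // ltnW.
constructor 2; rewrite vj; apply: leq_trans le1.
by have [] := advance_reach ja.
Qed.

Lemma flooded_occupied v : (tml v <= k0)%N -> v \in flooded L t.
Proof.
move=> vk; rewrite inE; apply/asboolP; left; exists k0; split.
- by apply: mem_ev; exact: ltnW.
- by case/andP: ti.
- by apply: ev_state_sup; rewrite vk orbT.
Qed.

Lemma flooded_arm w j : w \in arms_at L k0 -> (j < adv w)%N ->
  j.+1%:R <= (adv w)%:R * phase_frac i t -> avert w j.+1 \in flooded L t.
Proof.
move=> wa ja jt; rewrite inE; apply/asboolP; right.
have a0 : 0 < (adv w)%:R :> R by rewrite ltr0n; apply: leq_ltn_trans ja.
have d : 0 < ev_time L k1 - ev_time L k0 by rewrite subr_gt0.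
(* The moment at which the arm, moving at constant speed, passes its vertex number [j.+1]. *)
pose s := ev_time L k0 + j.+1%:R / (adv w)%:R * (ev_time L k1 - ev_time L k0).
have fs : phase_frac i s = j.+1%:R / (adv w)%:R.
  by rewrite /phase_frac /s addrC addKr mulfK // gt_eqF.
exists i, w, s; split=> //.
  split; last by case/andP: ti => _ /ltW.
  rewrite lerDl mulr_ge0 ?divr_ge0 ?(ltW d) //=.
  have : phase_frac i s <= phase_frac i t by rewrite fs ler_pdivrMr // mulrC.
  by rewrite /phase_frac ler_pM2r ?invr_gt0 // lerD2r.
rewrite acoordE // fs.
have -> : (adv w)%:R * (j.+1%:R / (adv w)%:R) = j.+1%:R :> R.
  by rewrite mulrCA mulfV ?mulr1 // gt_eqF.
have jr : (j.+1 <= room w)%N by apply: leq_trans ja (advance_le _ _ _).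
rewrite avertE spoint_svert; last exact: apos_le.
move: jr; rewrite /apos /room; case: (adir w) => jr; first by rewrite natrD.
by rewrite natrB.
Qed.

End OneLabeling.
End FloodedVertices.

(** * Discrepancy along the arms of one phase *)

Lemma down_closed_ord (a : nat) (A : {set 'I_a}) :
  (forall i j : 'I_a, (i <= j)%N -> j \in A -> i \in A) ->
  forall j : 'I_a, (j \in A) = (j < #|A|)%N.
Proof.
move=> dc j; apply/idP/idP => [jA|].
  rewrite -[X in (X <= _)%N](card_ord_lt (ltn_ord j)); apply: subset_leq_card.
  by apply/fintype.subsetP => i; rewrite !inE ltnS => ij; apply: dc jA.
apply: contraTT => jA; rewrite -leqNgt -[X in (_ <= X)%N](card_ord_lt (ltnW (ltn_ord j))).
apply: subset_leq_card; apply/fintype.subsetP => i iA; rewrite !inE ltnNge.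
by apply: contra jA => ji; apply: dc iA.
Qed.

Section Discrepancy.
Import fintype finset.
Local Open Scope ring_scope.
Variables (R : realType) (G : metric_graph R) (n M : nat).
Hypothesis n_gt0 : (0 < n)%N.
Local Notation pieces := (@pieces R G n).
Local Notation labeling := (@labeling R G n).
Local Notation svtx := (@svtx R G n).
Local Notation larm := (@larm R G n).
Local Notation avert := (@avert R G n).

Variable L : labeling.
Hypothesis iL : injective L.
Local Notation tml := (@ltime svtx L).

Variables (step J : nat) (delta : R).
Hypotheses (step_gt0 : (0 < step)%N) (J_big : (#|svtx| < J * step)%N).
Hypothesis regular : ~~ irregular (label_schedule L) step J delta L.

Lemma early_step (D : {set svtx}) s t : (s <= t)%N -> (t <= #|svtx|)%N ->
  (early L D s <= early L D t)%N /\ (early L D t <= early L D s + (t - s))%N.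
Proof.
move=> st tN; split.
  apply: subset_leq_card; apply/subsetP => v; rewrite !inE => /andP[-> /leq_trans]; exact.
have <- : #|[set v | (tml v < t)%N]%SET :\: [set v | (tml v < s)%N]%SET| = (t - s)%N.
  rewrite cardsDS ?(card_tm_lt iL) // ?(leq_trans st) //.
  by apply/subsetP => v; rewrite !inE => /leq_trans; apply.
apply: leq_trans (leq_card_setU _ _); apply: subset_leq_card; apply/subsetP => v.
by rewrite !inE => /andP[-> ->]; case: ltnP.
Qed.

Section Phase.
Variables (i : nat) (t : R).
Hypothesis hi : (i.+1 < size (events L))%N.
Local Notation k0 := (ev L i).
Local Notation k1 := (ev L i.+1).
Local Notation adv := (advance L k1).
Local Notation A := #|phase_block L i|.

(** Regularity is known at multiples of [step]; between two of them each count grows by at most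
    [step]. *)
Lemma early_proportional w k : w \in arms_at L k0 -> (k <= #|svtx|)%N ->
  `|A%:R * (early L (phase_chain L i w) k)%:R -
    #|phase_chain L i w|%:R * (early L (phase_block L i) k)%:R| <= A%:R * (delta + step%:R).
Proof.
move=> wa kN; have [A0|A0] := posnP A.
  have sub : phase_chain L i w \subset phase_block L i by apply/subsetP => v; rewrite inE => /andP[].
  have m0 : #|phase_chain L i w| = 0%N by apply/eqP; rewrite -leqn0 -A0 subset_leq_card.
  by rewrite A0 m0 !mul0r subrr normr0.
have jJ : (k %/ step < J)%N by rewrite ltn_divLR // (leq_ltn_trans kN).
move: regular; rewrite negb_exists => /forallP/(_ (inord i.+1.*2, Some w)).
rewrite negb_exists => /forallP/(_ (Ordinal jJ)); rewrite /deviates /=.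
have -> : sblock (label_schedule L) (inord i.+1.*2) = phase_block L i by apply: blk_phase.
have -> : schain (label_schedule L) (inord i.+1.*2, Some w) = phase_chain L i w by apply: chain_phase.
rewrite A0 /= -ltNge; set s := (k %/ step * step)%N => dev.
have sk : (s <= k)%N by apply: leq_trunc_div.
have ks : (k - s <= step)%N by rewrite leq_subLR {1}(divn_eq k step) leq_add2l ltnW // ltn_mod.
have [c1 c2] := early_step (phase_chain L i w) sk kN.
have [b1 b2] := early_step (phase_block L i) sk kN.
have mA : #|phase_chain L i w|%:R <= A%:R :> R.
  by rewrite ler_nat; apply: subset_leq_card; apply/subsetP => v; rewrite inE => /andP[].
move: c1 c2 b1 b2; rewrite -!(ler_nat R) !natrD.
have : (k - s)%:R <= step%:R :> R by rewrite ler_nat.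
have := ler0n R #|phase_chain L i w|; have := ler0n R A; move: mA dev.
move: (A%:R) (#|phase_chain L i w|%:R) (early L (phase_chain L i w) k)%:R
  (early L (phase_chain L i w) s)%:R (early L (phase_block L i) k)%:R
  (early L (phase_block L i) s)%:R (k - s)%:R step%:R => a m x x0 q q0 r st.
rewrite ltr_norml => ma /andP[d1 d2] a0 m0 rs x1 x2 q1 q2.
have h1 : a * (x - x0) <= a * st by rewrite ler_wpM2l //; lra.
have h2 : 0 <= a * (x - x0) by rewrite mulr_ge0 // subr_ge0.
have h3 : m * (q - q0) <= a * st by rewrite ler_pM //; lra.
have h4 : 0 <= m * (q - q0) by rewrite mulr_ge0 // subr_ge0.
by rewrite ler_norml; apply/andP; split; lra.
Qed.

(** The vertices of the arm that are covered, when it has run over [y] pieces, but have not joined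
    by [k], or the reverse. *)
Definition misplaced (w : larm) (y : R) (k : nat) : {set svtx} :=
  [set v | [exists j : 'I_(adv w), (v == avert w j.+1) &&
     ((j.+1%:R <= y) (+) (tml (avert w j.+1) <= k)%N)]]%SET.

(** Covered and joined vertices are both initial segments of the arm, so they differ by the
    difference of their lengths. The 2 pays for rounding [y] down and for the last vertex. *)
Lemma card_misplaced w y k : w \in arms_at L k0 -> 0 <= y -> y <= (adv w)%:R ->
  #|misplaced w y k|%:R <= `|(early L (phase_chain L i w) k.+1)%:R - y| + 2.
Proof.
move=> wa y0 ya; have [a0|a0] := posnP (adv w).
  rewrite (_ : misplaced w y k = finset.set0) ?cards0 ?addr_ge0 //.
  apply/setP => v; rewrite !inE; apply/negbTE/existsP => -[j]; by have := ltn_ord j; rewrite {2}a0.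
have gap u : (k0 < tml u < k1)%N -> ~~ evtx L u by apply: ev_gap.
have [_ ct] := chain_time n_gt0 iL gap wa a0.
have mono (j j' : 'I_(adv w)) : (j < j')%N -> (tml (avert w j.+1) < tml (avert w j'.+1))%N.
  case: j' => j' /= ja'; elim: j' ja' => // j' ih ja'; rewrite ltnS leq_eqVlt => /predU1P[->|jj].
    by have [] := ct _ ja'.
  by apply: ltn_trans (ih (ltnW ja') jj) _; have [] := ct _ ja'.
pose f (j : 'I_(adv w)) := avert w j.+1.
have fi : injective f.
  move=> j j' ff; apply: ord_inj; have [lt|lt|//] := ltngtP j j'.
    by have := mono _ _ lt; rewrite -/(f j) -/(f j') ff ltnn.
  by have := mono _ _ lt; rewrite -/(f j) -/(f j') ff ltnn.
pose X := [set j : 'I_(adv w) | (tml (f j) <= k)%N]%SET.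
have Xdc (j j' : 'I_(adv w)) : (j <= j')%N -> j' \in X -> j \in X.
  rewrite !inE leq_eqVlt => /predU1P[/ord_inj -> //|/mono lt] h.
  by apply: leq_trans (ltnW lt) h.
have Xlt := down_closed_ord Xdc.
have tr_le : (Num.truncn y <= adv w)%N by rewrite -ltnS truncn_lt_nat // (le_lt_trans ya) // ltr_nat.
have xor_le : (#|misplaced w y k| <= (#|X| - Num.truncn y) + (Num.truncn y - #|X|))%N.
  have sub : misplaced w y k \subset f @: ([set j : 'I_(adv w) | (j < #|X|)%N]%SET :\: [set j : 'I_(adv w) | (j < Num.truncn y)%N]%SET)
      :|: f @: ([set j : 'I_(adv w) | (j < Num.truncn y)%N]%SET :\: [set j : 'I_(adv w) | (j < #|X|)%N]%SET).
    apply/subsetP => v; rewrite inE => /existsP[j /andP[/eqP ->]].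
    rewrite -truncn_gt_nat -/(f j); have -> : (tml (f j) <= k)%N = (j < #|X|)%N by rewrite -Xlt inE.
    move=> xor; rewrite finset.in_setU !(mem_imset _ _ fi) !inE.
    by move: xor; case: (j < _)%N; case: (j < _)%N.
  apply: leq_trans (subset_leq_card sub) _; apply: leq_trans (leq_card_setU _ _) _.
  have XA : (#|X| <= adv w)%N by rewrite -[leqRHS]card_ord max_card.
  have cD a b : (a <= adv w)%N -> (b <= adv w)%N ->
      (#|[set j : 'I_(adv w) | (j < a)%N]%SET :\: [set j : 'I_(adv w) | (j < b)%N]%SET| <= a - b)%N.
    move=> aa ba; have [ab|ba'] := leqP a b.
      rewrite (_ : _ :\: _ = finset.set0) ?cards0 //; apply/setP => j; rewrite !inE.
      by apply/negbTE/negP => /andP[/negP nb ja]; apply: nb; apply: leq_trans ab.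
    rewrite cardsDS ?card_ord_lt //; apply/subsetP => j; rewrite !inE => /leq_trans; apply; exact: ltnW.
  by apply: leq_add; apply: leq_trans (leq_imset_card _ _) _; apply: cD.
(* The last vertex of the run may be the event vertex, which is missing from the chain. *)
have eX : (early L (phase_chain L i w) k.+1 <= #|X|)%N /\ (#|X| <= (early L (phase_chain L i w) k.+1).+1)%N.
  pose X' := [set j in X | (tml (f j) < k1)%N]%SET.
  have <- : #|X'| = early L (phase_chain L i w) k.+1.
    rewrite /early -(card_imset _ fi); apply: eq_card => v; apply/imsetP/idP => [[j + ->]|].
      move=> /setIdP[jX jlt]; apply/setIdP.
      have [fc _] := phase_chain_mem n_gt0 iL hi wa (ltn_ord j) jlt.
      by split; [exact: fc | move: jX; rewrite inE ltnS].
    move=> /setIdP[/(phase_chain_spec n_gt0 iL hi)[j [_ ja vj _ vk]]]; rewrite ltnS => tk.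
    exists (Ordinal ja); last exact: vj.
    by apply/setIdP; rewrite inE /f /= -vj tk vk.
  split; first by apply: subset_leq_card; apply/subsetP => j; rewrite inE => /andP[].
  have last : ((adv w).-1 < adv w)%N by rewrite prednK.
  have sub : X \subset X' :|: [set Ordinal last]%SET.
    apply/subsetP => j jX; rewrite finset.in_setU; apply/orP.
    have [lt|ge] := ltnP j.+1 (adv w).
      by left; apply/setIdP; have [_ _ h] := ct j (ltn_ord j); split=> //; apply: h.
    right; rewrite inE; apply/eqP/ord_inj => /=; apply/eqP.
    by rewrite eqn_leq -ltnS prednK // ltn_ord -subn1 leq_subLR add1n ge.
  by apply: leq_trans (subset_leq_card sub) _; apply: leq_trans (leq_card_setU _ _) _; rewrite cards1 addn1.
have /andP[t1 t2] := truncn_itv y0.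
case: eX => e1 e2; move: xor_le e1 e2 t1 t2.
move: (early _ _ _) #|X| (Num.truncn y) #|misplaced w y k| => a x b c h e1 e2 t1 t2.
have e1' : a%:R <= x%:R :> R by rewrite ler_nat.
have e2' : x%:R <= a%:R + 1 :> R by rewrite natr1 ler_nat.
have t2' : y < b%:R + 1 by rewrite natr1.
have h' : c%:R <= (x - b)%:R + (b - x)%:R :> R by rewrite -natrD ler_nat.
apply: le_trans h' _; have [xb|bx] := leqP x b.
  rewrite (eqP xb) add0r natrB //; have := ler_norm (y - a%:R); rewrite distrC; lra.
rewrite (eqP (ltnW bx)) addr0 natrB ?(ltnW bx) //; have := ler_norm (a%:R - y); lra.
Qed.

End Phase.
End Discrepancy.

(** * Discrepancy of a regular labeling at an arbitrary time *)

Section RegularDiscrepancy.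
Import fintype finset.
Local Open Scope ring_scope.
Variables (R : realType) (G : metric_graph R) (n M : nat).
Hypothesis n_gt0 : (0 < n)%N.
Local Notation pieces := (@pieces R G n).
Local Notation labeling := (@labeling R G n).
Local Notation svtx := (@svtx R G n).
Local Notation larm := (@larm R G n).
Local Notation avert := (@avert R G n).

Lemma total_len_gt0 : 0 < total_len G.
Proof.
have [e _] := card_gt0P (edg_gt0 G); rewrite /total_len (bigD1 e) //=.
by rewrite ltr_pwDl ?len_gt0 //; apply: sumr_ge0 => e' _; rewrite ltW // len_gt0.
Qed.

Definition size_error : R := #|vtx G|%:R + #|edg G|%:R.

Lemma card_svtx_bounds : `|#|svtx|%:R - n%:R * total_len G| <= size_error.
Proof.
have /(congr1 (fun k : nat => k%:R : R)) := card_svtx G n_gt0; rewrite !natrD => h.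
have /andP[h1 h2] := sum_pieces_bounds G n; rewrite ler_norml /size_error.
have := ler0n R #|vtx G|; have := ler0n R #|edg G|.
by move=> e0 v0; apply/andP; split; lra.
Qed.

Variable L : labeling.
Hypothesis iL : injective L.
Local Notation tml := (@ltime svtx L).

Variables (step J : nat) (delta : R).
Hypotheses (step_gt0 : (0 < step)%N) (J_big : (#|svtx| < J * step)%N) (delta_gt0 : 0 < delta).
Hypothesis regular : ~~ irregular (label_schedule L) step J delta L.

Variable t : R.
Hypothesis t_range : 0 <= t < total_len G.

Definition ceil_label := nat_ceil (#|svtx|%:R * (1 - t / total_len G)).

(** The joining time up to which vertices belong to the set of top labels; it equals n t up to a
    constant. *)
Definition cut_time : nat := (#|svtx| - ceil_label)%N.

Let N0 : 0 < #|svtx|%:R :> R.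
Proof.
by rewrite ltr0n; apply/card_gt0P; have [v _] := card_gt0P (edg_gt0 G); exists (inl (src v)).
Qed.

Let frac_range : 0 <= t / total_len G < 1.
Proof.
case/andP: t_range => t0 t1; have z := total_len_gt0.
by rewrite divr_ge0 ?(ltW z) //= ltr_pdivrMr // mul1r.
Qed.

Lemma ceil_label_bounds : (0 < ceil_label <= #|svtx|)%N /\
  `|cut_time%:R - n%:R * t| <= size_error + 1.
Proof.
have /andP[f0 f1] := frac_range.
have x0 : 0 <= #|svtx|%:R * (1 - t / total_len G) by rewrite mulr_ge0 // subr_ge0 ltW.
have /andP[c1 c2] := nat_ceilP x0; rewrite -/ceil_label in c1 c2.
have cl : (ceil_label <= #|svtx|)%N.
  rewrite -ltnS -(ltr_nat R) -natr1; apply: lt_le_trans c2 _.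
  rewrite lerD2r -[leRHS]mulr1 ler_wpM2l //; lra.
have c0 : (0 < ceil_label)%N.
  rewrite -(ltr0n R); apply: lt_le_trans c1; rewrite mulr_gt0 // subr_gt0 //.
rewrite c0 cl; split=> //; rewrite /cut_time natrB //.
have h := card_svtx_bounds; have z := total_len_gt0.
have e : n%:R * t = (n%:R * total_len G) * (t / total_len G) by field; rewrite gt_eqF.
rewrite e; move: c1 c2 h f0 f1; rewrite mulrBr mulr1.
move: (#|svtx|%:R) (ceil_label%:R) (t / total_len G) (n%:R * total_len G) => N c f z'.
rewrite !ler_norml => c1 c2 /andP[h1 h2] f0 f1.
have s0 : 0 <= size_error by rewrite /size_error addr_ge0.
have p1 : f * (N - z') <= size_error by apply: (@le_trans _ _ (f * size_error)); [rewrite ler_wpM2l | rewrite -[leRHS]mul1r ler_wpM2r // ltW].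
have p2 : - size_error <= f * (N - z').
  rewrite lerNl -mulrN; apply: (@le_trans _ _ (f * size_error)); first by rewrite ler_wpM2l // lerNl.
  by rewrite -[leRHS]mul1r ler_wpM2r // ltW.
by apply/andP; split; nra.
Qed.

Lemma cut_time_lt : (cut_time < #|svtx|)%N.
Proof.
have [/andP[c0 cl] _] := ceil_label_bounds.
by rewrite /cut_time ltn_subrL c0; move: N0; rewrite ltr0n.
Qed.

Lemma top_labelsE v : (v \in top_labels L ceil_label) = (tml v <= cut_time)%N.
Proof.
have [/andP[c0 cl] _] := ceil_label_bounds.
by rewrite -occupiedE /occupied /cut_time subKn.
Qed.

Lemma phase_exists : exists i, [/\ (i.+1 < size (events L))%N,
  ev_time L (ev L i) <= t & t < ev_time L (ev L i.+1)].
Proof.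
case/andP: t_range => t0 t1.
pose P i := (i < size (events L))%N && (ev_time L (ev L i) <= t).
have P0 : exists i, P i by exists 0%N; rewrite /P /= ev0 ev_time0.
have ub i : P i -> (i <= size (events L))%N by move=> /andP[/ltnW].
case: (ex_maxnP P0 ub) => i /andP[hi it] imax.
have hi1 : (i.+1 < size (events L))%N.
  rewrite ltn_neqAle hi andbT; apply/negP => /eqP e.
  have := ev_last n_gt0 iL; rewrite -e /= => el.
  by move: it; rewrite el ev_time_last // leNgt t1.
exists i; split=> //; rewrite ltNge; apply/negP => h.
by have := imax i.+1; rewrite /P hi1 h => /(_ isT); rewrite ltnn.
Qed.

Lemma card_times (D : {set svtx}) (a b : nat) : (b <= #|svtx|)%N ->
  (forall v, v \in D -> (a <= tml v < b)%N) -> (#|D| <= b - a)%N.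
Proof.
move=> bN h; have [ba|ab] := leqP b a.
  have -> : (b - a = 0)%N by apply/eqP; rewrite subn_eq0.
  rewrite leqn0 cards_eq0; apply/eqP/setP => v; rewrite inE; apply/negbTE/negP => /h /andP[av vb].
  by have := leq_ltn_trans av vb; rewrite ltnNge ba.
rewrite -(card_tm_lt iL bN) -[X in (_ <= _ - X)%N](card_tm_lt iL (leq_trans (ltnW ab) bN)).
rewrite -cardsDS; last by apply/subsetP => v; rewrite !inE => /leq_trans; apply; exact: ltnW.
by apply: subset_leq_card; apply/subsetP => v /h /andP[av vb]; rewrite !inE -leqNgt av.
Qed.

Definition time_error : R := size_error + 1 + (#|edg G| + fill_error L)%:R.
Definition frac_error : R := time_error + length_error L.
Definition discrepancy_const : R :=
  #|peaks L|%:R + time_error + (time_error + 1) + (arm_bound L)%:R * (frac_error + 3).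

(** Locate [t] in a phase. Apart from the peaks, a vertex on which the two sets disagree was
    occupied at the start of the phase but joined after the cut, or joined between the end of the
    phase and the cut, or is misplaced on an arm. The first two kinds are bounded since n t and
    [cut_time] nearly agree; the third is controlled by regularity. *)
Lemma discrepancy_le : (discrepancy L t)%:R <=
  discrepancy_const + (arm_bound L)%:R * (delta + step%:R).
Proof.
have [i [hi ti0 ti1]] := phase_exists.
have hi0 : (i < size (events L))%N by apply: ltnW.
set k0 := ev L i in ti0 *; set k1 := ev L i.+1 in ti1 *.
have ti : ev_time L (ev L i) <= t < ev_time L (ev L i.+1) by rewrite ti0.
have k01 : (k0 < k1)%N by apply: ev_ltn; rewrite ltnSn.
have k0N := ev_lt n_gt0 iL hi0; have k1N := ev_lt n_gt0 iL hi.
rewrite -/k0 in k0N; rewrite -/k1 in k1N.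
set K := cut_time; have KN := cut_time_lt; rewrite -/K in KN.
have [_ Kt] := ceil_label_bounds; rewrite -/K in Kt.
set th := phase_frac L i t.
have d0 : 0 < ev_time L k1 - ev_time L k0 by rewrite subr_gt0 (le_lt_trans ti0).
have th0 : 0 <= th by rewrite divr_ge0 ?(ltW d0) // subr_ge0.
have th1 : th <= 1 by rewrite ler_pdivrMr // mul1r lerD2r ltW.
have tE : n%:R * t = n%:R * ev_time L k0 + th * (n%:R * (ev_time L k1 - ev_time L k0)).
  by rewrite /th /phase_frac -/k0 -/k1; field; rewrite gt_eqF.
have b0 := length_bounds n_gt0 iL k0N; have b1 := length_bounds n_gt0 iL k1N.
have bA := phase_length n_gt0 iL hi; rewrite -/k0 -/k1 in bA.
set A := #|phase_block L i| in bA *.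
have AE : A = (k1 - k0.+1)%N by apply: (card_phase_block_full n_gt0 iL hi).
have AE' : A%:R = k1%:R - k0%:R - 1 :> R by rewrite AE natrB // -natr1 opprD addrA.
have se0 : 0 <= size_error by rewrite /size_error addr_ge0.
have le0 := length_error_ge0 L.
have te0 : 0 <= time_error by rewrite /time_error !addr_ge0.
have fe0 : 0 <= frac_error by rewrite /frac_error addr_ge0.
have e2 : #|edg G|%:R + (fill_error L)%:R = (#|edg G| + fill_error L)%:R :> R by rewrite natrD.
rewrite e2 in b0 b1.
(* The cut can fall outside the phase of [t], but only by the error of converting lengths into
   counts. *)
have Kk0 : (k0 - K)%:R <= time_error.
  have [le|lt] := leqP k0 K; first by rewrite (eqP le).
  rewrite natrB ?(ltnW lt) //; have : n%:R * ev_time L k0 <= n%:R * t by rewrite ler_wpM2l.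
  move: Kt b0; rewrite /time_error !ler_norml => /andP[a b] /andP[c d]; lra.
have Kk1 : (K.+1 - k1)%:R <= time_error + 1.
  have [le|lt] := leqP K.+1 k1; first by rewrite (eqP le) addr_ge0.
  rewrite natrB ?(ltnW lt) // -natr1; have : n%:R * t <= n%:R * ev_time L k1 by rewrite ler_wpM2l // ltW.
  move: Kt b1; rewrite /time_error !ler_norml => /andP[a b] /andP[c d]; lra.
have thA : 0 <= th * A%:R <= A%:R.
  by rewrite mulr_ge0 //= -[leRHS]mul1r ler_wpM2r.
(* At the cut, the phase is completed to the fraction [th], in vertices as well as in time. *)
have uE : `|K%:R - k0%:R - th * A%:R| <= frac_error.
  have : `|th * (n%:R * (ev_time L k1 - ev_time L k0) - A%:R)| <= length_error L.
    rewrite normrM (ger0_norm th0); apply: le_trans bA.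
    by rewrite -[leRHS]mul1r ler_wpM2r.
  move: Kt b0; rewrite tE mulrBr /frac_error /time_error !ler_norml.
  by move=> /andP[a b] /andP[c d] /andP[e f]; apply/andP; split; lra.
set q := early L (phase_block L i) K.+1.
have qE : `|q%:R - th * A%:R| <= frac_error.
  move: uE thA; rewrite !ler_norml => /andP[u1 u2] /andP[a1 a2].
  have [Kk|kK] := leqP K k0.
    have -> : q = 0%N.
      apply/eqP; rewrite cards_eq0; apply/eqP/setP => v; rewrite !inE -/k0 ltnS.
      by apply/negbTE/negP => /andP[/andP[a _] b]; have := leq_trans a (leq_trans b Kk); rewrite ltnn.
    have : K%:R <= k0%:R :> R by rewrite ler_nat.
    by move=> h; apply/andP; split; lra.
  have [kK1|Kk1'] := leqP k1 K.
    have -> : q = A.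
      apply: eq_card => v; rewrite !inE -/k0 -/k1 ltnS; apply/andb_idr => /andP[_ /ltnW h].
      exact: leq_trans kK1.
    have : k1%:R <= K%:R :> R by rewrite ler_nat.
    by move=> h; apply/andP; split; lra.
  have -> : q = (K - k0)%N by rewrite /q /early card_phase_block // -/k0 -/k1 ltnS (ltnW kK) Kk1'.
  by rewrite natrB ?(ltnW kK) //; apply/andP; split; lra.
pose y w := (advance L k1 w)%:R * th.
have y0 w : 0 <= y w by rewrite mulr_ge0.
have y1 w : y w <= (advance L k1 w)%:R by rewrite -[leRHS]mulr1 ler_wpM2l.
have mis w : w \in arms_at L k0 ->
    #|misplaced L i w (y w) K|%:R <= (delta + step%:R) + (frac_error + 3).
  move=> wa; apply: le_trans (card_misplaced n_gt0 iL hi K wa (y0 w) (y1 w)) _.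
  have prop := early_proportional n_gt0 iL step_gt0 J_big regular hi wa KN.
  rewrite -/A -/q in prop; set X := early L (phase_chain L i w) K.+1 in prop *.
  set m := #|phase_chain L i w| in prop.
  have m1 : m%:R <= (advance L k1 w)%:R :> R by rewrite ler_nat card_phase_chain_le.
  have m2 : (advance L k1 w)%:R <= m%:R + 1 :> R.
    rewrite natr1 ler_nat; have := card_phase_chain_ge n_gt0 iL hi wa; rewrite -/m -/k1.
    by case: (advance _ _ _).
  have mA : (m <= A)%N by apply: subset_leq_card; apply/subsetP => v; rewrite inE => /andP[].
  have Xm : (X <= m)%N by apply: subset_leq_card; apply/subsetP => v; rewrite inE => /andP[].
  have st0 : 0 <= step%:R :> R by [].
  suff : `|X%:R - y w| <= delta + step%:R + frac_error + 1.
    by move=> h; apply: le_trans (lerD h (lexx 2)) _; lra.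
  have [A0|A0] := posnP A.
    have m0 : m = 0%N by apply/eqP; rewrite -leqn0 -A0.
    have X0 : X = 0%N by apply/eqP; rewrite -leqn0 -m0.
    rewrite X0 sub0r normrN ger0_norm //; apply: le_trans (y1 w) _; apply: le_trans m2 _.
    by rewrite m0 add0r lerDr !addr_ge0 // ltW.
  have A0' : 0 < A%:R :> R by rewrite ltr0n.
  have mA' : m%:R <= A%:R :> R by rewrite ler_nat.
  rewrite -(ler_pM2l A0') -{1}(ger0_norm (ltW A0')) -normrM.
  have s1 : `|m%:R * (q%:R - th * A%:R)| <= A%:R * frac_error.
    by rewrite normrM ger0_norm // ler_pM.
  have s2 : `|th * A%:R * (m%:R - (advance L k1 w)%:R)| <= A%:R.
    case/andP: thA => a1 a2; rewrite normrM (ger0_norm a1) -[leRHS]mulr1 ler_pM //.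
    by rewrite ler_norml; apply/andP; split; lra.
  (* Three errors: regularity of the chain, the completed part of the block against [th], and the
     length of the chain against the run of the arm. *)
  have -> : A%:R * (X%:R - y w) = (A%:R * X%:R - m%:R * q%:R) + m%:R * (q%:R - th * A%:R) +
      th * A%:R * (m%:R - (advance L k1 w)%:R) by rewrite /y; ring.
  apply: le_trans (ler_normD _ _) _; apply: (@le_trans _ _ (A%:R * (delta + step%:R) + A%:R * frac_error + A%:R)).
    by rewrite lerD //; apply: le_trans (ler_normD _ _) _; rewrite lerD.
  by rewrite !mulrDr mulr1; lra.
pose U := \bigcup_(w in arms_at L k0) misplaced L i w (y w) K.
pose D1 := [set v | (K.+1 <= tml v < k0.+1)%N]%SET.
pose D2 := [set v | (k1 <= tml v < K.+1)%N]%SET.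
have sub : (flooded L t :\: top_labels L ceil_label) :|: (top_labels L ceil_label :\: flooded L t)
    \subset (peaks L :|: D1) :|: (D2 :|: U).
  apply/subsetP => v; rewrite finset.in_setU !finset.in_setD !top_labelsE -/K => /orP[]/andP[h1 h2].
    rewrite -ltnNge in h1.
    have lowD u : u = v -> (tml u <= k0)%N -> v \in peaks L :|: D1 :|: (D2 :|: U).
      by move=> -> vk; rewrite !finset.in_setU [v \in D1]inE h1 ltnS vk orbT.
    case: (flooded_sub n_gt0 hi ti h2) => [pv|vk|[w [[|j] [wa ja vw jy]]]].
    - by rewrite !finset.in_setU pv.
    - exact: (lowD v).
    - have /arms_atP[_ /orP[a|a] _] := wa; first exact: (lowD (avert w 0)).
      by rewrite !finset.in_setU vw a.
    rewrite !finset.in_setU; apply/orP; right; apply/orP; right; apply/bigcupP; exists w => //.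
    rewrite inE; apply/existsP; exists (Ordinal ja); rewrite /= -vw eqxx.
    by rewrite /y jy leqNgt h1.
  have [vk1|vk1] := leqP k1 (tml v).
    by rewrite !finset.in_setU [v \in D2]inE vk1 ltnS h2 !orbT.
  have [vk0|k0v] := leqP (tml v) k0.
    by move: h1; rewrite (flooded_occupied n_gt0 iL hi ti).
  have gap u : (k0 < tml u < k1)%N -> ~~ evtx L u by apply: ev_gap.
  have hv : (k0 < tml v < k1)%N by rewrite k0v.
  have [w [j [wa ja vw]]] := chain_exists n_gt0 iL gap hv.
  rewrite !finset.in_setU; apply/orP; right; apply/orP; right; apply/bigcupP; exists w => //.
  rewrite inE; apply/existsP; exists (Ordinal ja); rewrite /= -vw eqxx h2 addbT /=.
  apply: contra h1 => jy; rewrite vw; exact: (flooded_arm n_gt0 hi ti wa ja jy).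
rewrite /discrepancy -/ceil_label.
apply: (@le_trans _ _ ((#|peaks L| + (k0 - K) + ((K.+1 - k1) + #|U|))%N%:R)).
  rewrite ler_nat; apply: leq_trans (subset_leq_card sub) _.
  apply: leq_trans (leq_card_setU _ _) _; apply: leq_add; apply: leq_trans (leq_card_setU _ _) _.
    rewrite leq_add2l -subSS; apply: card_times => // v; by rewrite inE.
  by rewrite leq_add2r; apply: card_times => // v; rewrite inE.
have Ub : #|U|%:R <= (arm_bound L)%:R * ((delta + step%:R) + (frac_error + 3)).
  apply: (@le_trans _ _ (\sum_(w in arms_at L k0) ((delta + step%:R) + (frac_error + 3)))).
    apply: (@le_trans _ _ (\sum_(w in arms_at L k0) #|misplaced L i w (y w) K|%:R)).
      rewrite -natr_sum ler_nat.
      apply: (big_ind2 (fun (B : {set svtx}) m => (#|B| <= m)%N)); first by rewrite cards0.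
        by move=> B b B' b' hB hB'; apply: leq_trans (leq_card_setU _ _) (leq_add hB hB').
      by [].
    by apply: ler_sum => w wa; exact: mis.
  rewrite sumr_const -[leLHS]mulr_natl ler_wpM2r ?ler_nat ?card_arms_at //.
  by rewrite !addr_ge0 // ltW.
have natE (a b c d : nat) : (a + b + (c + d))%:R = a%:R + b%:R + (c%:R + d%:R) :> R.
  by rewrite !natrD.
rewrite natE /discrepancy_const; move: Ub Kk0 Kk1; rewrite mulrDr.
move: (_ * (frac_error + 3)) (_ * (delta + step%:R)) #|U|%:R (k0 - K)%:R (K.+1 - k1)%:R => a b c d e.
lra.
Qed.

End RegularDiscrepancy.

(** * Labelings with exactly M peaks exist and are abundant *)

Section RankLabeling.
Import fintype finset.
Local Open Scope nat_scope.
Variables (X : finType) (r : X -> nat).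
Hypothesis r_inj : injective r.

Lemma rank_labeling : exists L : {ffun X -> 'I_#|X|},
  injective L /\ forall u v, (ltime L u < ltime L v) = (r u < r v).
Proof.
pose k v := #|[set u | r u < r v]%SET|.
have kN v : k v < #|X|.
  rewrite -cardsT; apply: proper_card; apply/properP; split; first by apply/subsetP.
  by exists v; rewrite !inE ?ltnn.
pose L : {ffun X -> 'I_#|X|} := [ffun v => rev_ord (Ordinal (kN v))].
have mono u v : r u < r v -> k u < k v.
  move=> uv; apply: proper_card; apply/properP; split.
    by apply/subsetP => w; rewrite !inE => /ltn_trans; apply.
  by exists u; rewrite !inE ?ltnn.
have kE u v : (k u < k v) = (r u < r v).
  apply/idP/idP => [h|/mono //]; rewrite ltnNge leq_eqVlt; apply/negP => /predU1P[/r_inj e|/mono].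
    by move: h; rewrite e ltnn.
  by move=> h'; have := ltn_trans h h'; rewrite ltnn.
have ltE u v : (ltime L u < ltime L v) = (r u < r v).
  rewrite ltime_lt -kE !ffunE /=; have := kN u; have := kN v.
  by move: (k u) (k v) #|X| => a b c; lia.
exists L; split=> // u v e; apply: r_inj; apply/eqP.
have [lt|gt|//] := ltngtP (r u) (r v).
  by move: lt; rewrite -ltE /ltime e ltnn.
by move: gt; rewrite -ltE /ltime e ltnn.
Qed.

End RankLabeling.

Lemma raise_aux1 (e : bool) (a b m : nat) :
  (a < m -> (if e then m.-1 else a - (b < a)) < m)%N.
Proof. by case: e; lia. Qed.

Lemma raise_aux2 (u y : bool) (a b c m : nat) :
  (a < m -> c < m -> b < m -> (~~ u -> a != b) -> (~~ y -> c != b) ->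
  ((if u then m.-1 else a - (b < a)) < (if y then m.-1 else c - (b < c))) =
  (if u then false else if y then true else a < c))%N.
Proof. by case: u; case: y => /= ? ? ? h1 h2; try have := h1 isT; try have := h2 isT; lia. Qed.

Lemma raise_aux3 (a b c : nat) :
  (a != c -> b != c -> a - (c < a) = b - (c < b) -> a = b)%N.
Proof. lia. Qed.

Section ExistLabelings.
Import fintype finset.
Local Open Scope nat_scope.
Variables (R : realType) (G : metric_graph R) (n : nat).
Hypothesis n_gt0 : 0 < n.
Local Notation svtx := (@svtx R G n).
Local Notation labeling := (@labeling R G n).
Local Notation neighbors := (@neighbors R G n).
Local Notation lab := (labelings G n).
Local Notation N := #|svtx|.
Local Notation degs := (#|edg G|.*2).

(** An exploration from [v0]: until every vertex is listed, connectivity provides an edge leaving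
    the list. Labeling along it makes [v0] the only peak. *)
Lemma connected_growth (v0 : svtx) k : 0 < k <= N -> exists s : seq svtx,
  [/\ uniq s, size s = k, head v0 s = v0 &
   forall v, v \in s -> v = v0 \/ exists2 u, neighbors u v & index u s < index v s].
Proof.
case: k => // k /=; elim: k => [|k ih] kN.
  by exists [:: v0]; split=> // v; rewrite inE => /eqP ->; left.
have [s [us ss hs gs]] := ih (ltnW kN).
pose C := [set v in s]%SET.
have [u [v [nuv uC vC]]] : exists u v, [/\ neighbors u v, u \in s & v \notin s].
  apply: contrapT => no; have : C = [set: svtx]%SET.
    apply: (svtx_ind_connected n_gt0); last first.
      by apply/set0Pn; exists v0; rewrite inE; case: (s) ss hs => //= a s' _ ->; rewrite mem_head.
    move=> u v nuv; rewrite !inE => us'; apply: contrapT => vs; apply: no.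
    by exists u, v; split=> //; apply/negP.
  move=> /(congr1 (fun A : {set svtx} => #|A|)); rewrite cardsT cardsE (card_uniqP us) ss => e.
  by move: kN; rewrite -e ltnn.
exists (rcons s v); split.
- by rewrite rcons_uniq vC.
- by rewrite size_rcons ss.
- by case: (s) ss hs.
move=> w; rewrite mem_rcons inE => /predU1P[->|ws].
  right; exists u => //; rewrite -!cats1 !index_cat uC (negbTE vC) /= eqxx addn0 index_mem //.
have [->|[x nxw lt]] := gs w ws; first by left.
right; exists x => //; have xs : x \in s by rewrite -index_mem (ltn_trans lt) // index_mem.
by rewrite -!cats1 !index_cat xs ws.
Qed.

Lemma peak_first (L : labeling) v : injective L -> (forall u, ltime L v <= ltime L u) ->
  v \in peaks L.
Proof.
move=> iL h; rewrite peaksE; apply/forallP => y; apply/implyP => nvy.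
rewrite ltn_neqAle h andbT (inj_eq (tm_inj iL)).
by apply: contraTneq nvy => ->; rewrite neighbors_irr.
Qed.

Lemma labelings1 : exists L, L \in lab 1.
Proof.
have [v0 _] : exists v0 : svtx, true by have [e _] := card_gt0P (edg_gt0 G); exists (inl (src e)).
have N0 : 0 < N by apply/card_gt0P; exists v0.
have [|s [us ss hs gs]] := @connected_growth v0 N; first by rewrite N0 leqnn.
have ms v : v \in s.
  have : [set x in s]%SET = [set: svtx]%SET.
    apply/eqP; rewrite eqEcard cardsT cardsE (card_uniqP us) ss leqnn andbT.
    by apply/subsetP => x; rewrite !inE.
  by move=> /setP/(_ v); rewrite !inE.
have ri : injective (fun v => index v s).
  by move=> u v e; rewrite -(nth_index v0 (ms u)) e nth_index.
have [L [iL Lr]] := rank_labeling ri.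
exists L; rewrite inE; apply/andP; split; first exact/injectiveP.
suff -> : peaks L = [set v0]%SET by rewrite cards1.
have i0 : index v0 s = 0 by case: (s) hs => [//|a s'] /= ->; rewrite eqxx.
apply/setP => v; rewrite [RHS]inE; apply/idP/eqP => [|->]; last first.
  by apply: peak_first => // u; rewrite leqNgt Lr i0 ltn0.
rewrite peaksE => /forallP h; have [//|[u nuv lt]] := gs v (ms v).
have := h u; rewrite neighbors_sym nuv /= => lt'.
by move: lt; rewrite -Lr ltnNge (ltnW lt').
Qed.

Definition raise_val (L : labeling) v u : nat :=
  if u == v then N.-1 else L u - (L v < L u).

Lemma raise_val_lt (L : labeling) v u : raise_val L v u < N.
Proof.
exact: raise_aux1 (ltn_ord (L u)).
Qed.

(** Moves [v] to the top label and shifts the labels above it down by one, so the order of all other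
    vertices is kept. *)
Definition raise (L : labeling) v : labeling := [ffun u => Ordinal (raise_val_lt L v u)].

Lemma raise_lt (L : labeling) v u y : injective L ->
  (raise L v u < raise L v y) =
  (if u == v then false else if y == v then true else L u < L y).
Proof.
move=> iL; rewrite !ffunE /= /raise_val.
have ne w : w != v -> (L w : nat) != L v.
  by move=> wv; apply: contra wv => /eqP /ord_inj /iL ->.
by apply: raise_aux2 (ltn_ord (L u)) (ltn_ord (L y)) (ltn_ord (L v)) _ _; exact: ne.
Qed.

Lemma raise_inj (L : labeling) v : injective L -> injective (raise L v).
Proof.
move=> iL u y e; apply/eqP/negPn/negP => uy.
have h1 := raise_lt v u y iL; have h2 := raise_lt v y u iL.
move: h1 h2; rewrite e ltnn.
have [uv|uv] := eqVneq u v; first by have [yv|//] := eqVneq y v; move: uy; rewrite uv yv eqxx.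
have [//|yv] := eqVneq y v; have : (L u : nat) != L y by apply: contra uy => /eqP /ord_inj /iL ->.
by rewrite neq_ltn => /orP[] -> .
Qed.

Lemma raise_peaks (L : labeling) v : injective L ->
  (forall u, u \in peaks L -> ~~ neighbors u v) ->
  peaks (raise L v) = v |: peaks L.
Proof.
move=> iL h; apply/setP => u; rewrite finset.in_setU1.
have E w : (w \in peaks (raise L v)) =
    [forall y, neighbors w y ==> if y == v then false else if w == v then true else L y < L w].
  rewrite inE; apply: eq_forallb => y; rewrite /label ltnS raise_lt //.
have [->|uv] /= := eqVneq u v.
  rewrite E; apply/forallP => y; apply/implyP; rewrite eqxx.
  by have [->|//] := eqVneq y v; rewrite neighbors_irr.
rewrite E (negbTE uv); apply/forallP/idP => [H|pu y].
  rewrite inE; apply/forallP => y; apply/implyP => nuy; have := H y; rewrite nuy /= /label ltnS.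
  by case: eqP.
apply/implyP => nuy; have [yv|yv] := eqVneq y v.
  by have := h u pu; rewrite -yv nuy.
by move: pu; rewrite inE => /forallP/(_ y); rewrite nuy /label ltnS.
Qed.

Lemma raise_label_inj (L L' : labeling) v : injective L -> injective L' ->
  raise L v = raise L' v -> L v = L' v -> L = L'.
Proof.
move=> iL iL' e ev; apply/ffunP => u; apply: ord_inj.
have := congr1 (fun f : labeling => f u : nat) e; rewrite !ffunE /= /raise_val -ev.
have [->|uv] := eqVneq u v; first by rewrite ev.
have ne (L0 : labeling) : injective L0 -> (L0 u : nat) != L0 v.
  by move=> i0; apply: contra uv => /eqP /ord_inj /i0 ->.
have n1 := ne L iL; have n2 := ne L' iL'; rewrite -ev in n2.
exact: raise_aux3 n1 n2.
Qed.

(** The peaks and their neighbors are too few to exhaust the graph. *)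
Lemma far_vertex (L : labeling) K : #|peaks L| <= K -> K * degs.+1 < N ->
  exists2 v, v \notin peaks L & forall u, u \in peaks L -> ~~ neighbors u v.
Proof.
move=> pK KN; pose D := \bigcup_(u in peaks L) (u |: [set y | neighbors u y]%SET).
have : #|D| < N.
  apply: leq_ltn_trans KN; apply: leq_trans (_ : #|peaks L| * degs.+1 <= _); last by rewrite leq_mul2r pK orbT.
  rewrite -sum_nat_const.
  apply: (big_ind2 (fun (B : {set svtx}) m => #|B| <= m)); first by rewrite cards0.
    by move=> B b B' b' hB hB'; apply: leq_trans (leq_card_setU _ _) (leq_add hB hB').
  move=> u _; apply: leq_trans (leq_card_setU _ _) _; rewrite cards1 add1n ltnS.
  exact: degree_le.
rewrite -cardsT => lt; have /subsetPn[v _ vD] : ~~ ([set: svtx]%SET \subset D).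
  by apply: contraL lt => /subset_leq_card; rewrite -leqNgt.
exists v => [|u pu]; apply: contra vD => h; apply/bigcupP; [exists v|exists u] => //.
  by rewrite !inE eqxx.
by rewrite !inE h orbT.
Qed.

(** Raise a vertex far from all peaks. The raised labeling, the vertex and its old label determine
    the original labeling, whence the factor N^2. *)
Lemma card_labelings_S K : K * degs.+1 < N -> #|lab K| <= N ^ 2 * #|lab K.+1|.
Proof.
move=> KN; have N0 : 0 < N by apply: leq_ltn_trans KN.
have [v0 _] := card_gt0P N0.
pose pv (L : labeling) := odflt v0 [pick v | (v \notin peaks L) &&
   [forall u, (u \in peaks L) ==> ~~ neighbors u v]].
have pvP L : L \in lab K -> pv L \notin peaks L /\ forall u, u \in peaks L -> ~~ neighbors u (pv L).
  move=> /labelingsP[iL pL]; rewrite /pv; case: pickP => [v /andP[a /forallP b]|no] /=.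
    by split=> // u pu; have := b u; rewrite pu.
  have [||v a b] := @far_vertex L K; rewrite ?pL //.
  have := no v; rewrite a => /negbT; rewrite negb_forall => /existsP[u].
  by rewrite negb_imply negbK => /andP[/b /negbTE ->].
pose f (L : labeling) := (raise L (pv L), pv L, L (pv L)).
rewrite -(card_in_imset (f := f)); last first.
  move=> L L' /labelingsP[iL _] /labelingsP[iL' _] [e1 e2 e3].
  apply: (@raise_label_inj _ _ (pv L)) => //; first by rewrite {2}e2.
  by rewrite e3 -e2.
have sub : f @: lab K \subset finset.setX (finset.setX (lab K.+1) [set: svtx]%SET) [set: 'I_N]%SET.
  apply/subsetP => _ /imsetP[L LK ->]; have [a b] := pvP L LK.
  have /labelingsP[iL pL] := LK.
  rewrite !finset.in_setX !finset.in_setT !andbT /f /=; apply/labelingsP.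
  by split; [apply: raise_inj | rewrite raise_peaks // cardsU1 a pL].
apply: leq_trans (subset_leq_card sub) _; rewrite !cardsX !cardsT card_ord.
by rewrite -mulnA mulnn mulnC.
Qed.

Lemma card_labelings_le K M : K <= M -> M * degs.+1 < N ->
  #|lab K| <= (N ^ 2) ^ M * #|lab M|.
Proof.
move=> KM MN; have N0 : 0 < N by apply: leq_ltn_trans MN.
rewrite -(subnK KM); move: (M - K) (subnKC KM) => d dE.
apply: (@leq_trans ((N ^ 2) ^ d * #|lab (d + K)|)); last first.
  by rewrite leq_mul2r leq_pexp2l ?leq_addr ?orbT // expn_gt0 N0.
have {MN} : (d + K) * degs.+1 < N by rewrite addnC dE.
elim: d {dE} => [|d ih] MN; first by rewrite expn0 mul1n.
apply: leq_trans (ih _) _; first by apply: leq_ltn_trans MN; rewrite leq_mul2r leq_add2r leqnSn orbT.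
rewrite [(N ^ 2) ^ d.+1]expnSr -mulnA leq_mul2l; apply/orP; right; rewrite addSn; apply: card_labelings_S.
by apply: leq_ltn_trans MN; rewrite leq_mul2r leq_add2r leqnSn orbT.
Qed.

Lemma labelings_neq0 M : 0 < M -> M * degs.+1 < N -> 0 < #|lab M|.
Proof.
move=> M0 MN; have := card_labelings_le M0 MN.
have [L L1] := labelings1; have : 0 < #|lab 1| by apply/card_gt0P; exists L.
by case: #|lab M| => //; rewrite muln0; case: #|lab 1|.
Qed.

Lemma card_few_peaks M (A : {set labeling}) : M * degs.+1 < N ->
  (forall L, L \in A -> injective L /\ #|peaks L| <= M) ->
  #|A| <= M.+1 * (N ^ 2) ^ M * #|lab M|.
Proof.
move=> MN hA; have sub : A \subset \bigcup_(K < M.+1) lab K.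
  apply/subsetP => L /hA[iL pL]; apply/bigcupP.
  by exists (Ordinal (pL : #|peaks L| < M.+1)) => //; apply/labelingsP.
apply: leq_trans (subset_leq_card sub) _.
have -> : M.+1 * (N ^ 2) ^ M * #|lab M| = \sum_(K < M.+1) (N ^ 2) ^ M * #|lab M|.
  by rewrite sum_nat_const card_ord mulnA.
apply: (big_ind2 (fun (B : {set labeling}) m => #|B| <= m)); first by rewrite cards0.
  by move=> B b B' b' hB hB'; apply: leq_trans (leq_card_setU _ _) (leq_add hB hB').
by move=> K _; apply: card_labelings_le => //; rewrite -ltnS.
Qed.

End ExistLabelings.

(** * Points, boundaries and outward normals along an edge *)

Section EdgePoints.
Local Open Scope classical_set_scope.
Local Open Scope ring_scope.
Variables (R : realType) (G : metric_graph R).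
Implicit Types (e : edg G) (x y : R) (A : set (mspace G)).

Lemma pt_dist e x y : 0 <= x <= len e -> 0 <= y <= len e ->
  mdist (pt e x) (pt e y) <= `|x - y|.
Proof.
move=> rx ry; have := @path_dist_le R G (pt e x) (pt e y) [:: (e, x, y)].
by rewrite /route_len big_seq1; apply.
Qed.

Lemma pt_ball e x y d : 0 <= x <= len e -> 0 <= y <= len e ->
  `|x - y| < d -> ball (pt e x) d (pt e y).
Proof. by move=> rx ry xy; rewrite ballEmdist; apply: le_lt_trans xy; apply: pt_dist. Qed.

Lemma closed_pt A e q : closed A -> 0 <= q <= len e ->
  (forall d, 0 < d -> exists y, [/\ 0 <= y <= len e, `|q - y| < d & A (pt e y)]) ->
  A (pt e q).
Proof.
move=> cA rq h; apply: cA => B /nbhs_ballP[d /= d0 dB].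
have [y [ry qy Ay]] := h d d0; exists (pt e y); split=> //.
exact/dB/pt_ball.
Qed.

Lemma not_interior_pt A e q : 0 <= q <= len e ->
  (forall d, 0 < d -> exists y, [/\ 0 <= y <= len e, `|q - y| < d & ~ A (pt e y)]) ->
  ~ A° (pt e q).
Proof.
move=> rq h /nbhs_ballP[d /= d0 dA]; have [y [ry qy nA]] := h d d0.
by apply/nA/dA/pt_ball.
Qed.

Lemma pt_inner_inj e x e' x' : inner (e, x) -> 0 <= x' <= len e' ->
  pt e x = pt e' x' -> e = e' /\ x = x'.
Proof.
move=> ix rx' h; have rx : 0 <= x <= len e.
  by move: ix => /andP[/= a b]; rewrite !ltW.
have [+ _] := pt_eqP rx rx'; move=> /(_ h) [[-> ->] //|[v [ev _]]].
move: ev ix; rewrite /endpoint /inner /=; case: eqP => [->|_]; first by rewrite ltxx.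
by case: eqP => [->|//]; rewrite ltxx andbF.
Qed.

Lemma nmove0 (w : Defs.normal G) : nmove w 0 = nbase w.
Proof. by rewrite /nmove mulr0 addr0. Qed.

Lemma nmoveD (w : Defs.normal G) r s : nmove w (r + s) = nmove w r + nsign w * s.
Proof. by rewrite /nmove mulrDr addrA. Qed.

Lemma nmove_dist (w : Defs.normal G) r s : `|nmove w r - nmove w s| = `|r - s|.
Proof.
rewrite /nmove /nsign; case: w.1.2; first by congr `|_|; ring.
by rewrite -normrN; congr `|_|; ring.
Qed.

Lemma nmove_range (w : Defs.normal G) r q : anchored w -> 0 <= nmove w q <= len (nedge w) ->
  0 <= r <= q -> 0 <= nmove w r <= len (nedge w).
Proof.
rewrite /anchored /nmove /nsign; case: w.1.2 => /andP[a1 a2] /andP[b1 b2] /andP[c1 c2];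
  by apply/andP; split; lra.
Qed.

Lemma anchored_range (w : Defs.normal G) : anchored w -> 0 <= nbase w <= len (nedge w).
Proof. by rewrite /anchored; case: w.1.2 => /andP[a b]; apply/andP; split=> //; apply: ltW. Qed.

Lemma outward_in A w : closed A -> outward_normal A w -> A (pt (nedge w) (nbase w)).
Proof. by move=> cA [_ [cl _] _]; apply: cA. Qed.

(** A point of [A] with uncovered points arbitrarily close along an edge lies on the boundary. *)
Lemma outward_intro A w : anchored w -> A (pt (nedge w) (nbase w)) ->
  (exists2 t1, 0 < t1 & forall t, 0 < t < t1 ->
     0 <= nmove w t <= len (nedge w) /\ ~ A (pt (nedge w) (nmove w t))) ->
  outward_normal A w.
Proof.
move=> aw Aw [t1 t10 h]; split=> //; last by exists t1.
split; first exact: subset_closure.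
apply: not_interior_pt; first exact: anchored_range.
move=> d d0; pose t := Num.min (t1 / 2) (d / 2).
have t0 : 0 < t by rewrite lt_min !divr_gt0.
have tt1 : t < t1 by rewrite gt_min; apply/orP; left; lra.
have td : t < d by rewrite gt_min; apply/orP; right; lra.
have [|a b] := h t; first by rewrite t0.
exists (nmove w t); split=> //.
by rewrite -(nmove0 w) nmove_dist sub0r normrN gtr0_norm.
Qed.

Definition opposite (w : Defs.normal G) (q : R) : Defs.normal G := (nedge w, ~~ w.1.2, nmove w q).

Lemma nmove_opposite w q r : nmove (opposite w q) r = nmove w (q - r).
Proof.
rewrite /opposite /nmove /nsign /nbase /=; case: w.1.2 => /=; by ring.
Qed.

(* The first point of A in front of an outward normal carries a normal that
   points back at it. *)
Lemma facing_normal A w r : closed A -> outward_normal A w -> 0 < r ->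
  0 <= nmove w r <= len (nedge w) -> A (pt (nedge w) (nmove w r)) ->
  exists q, [/\ 0 < q <= r, outward_normal A (opposite w q) &
    forall s, 0 < s < q -> ~ A (pt (nedge w) (nmove w s))].
Proof.
move=> cA ow r0 rr Ar; have [aw _ [t1 t10 ht1]] := ow.
pose Z := [set s | [/\ 0 < s, 0 <= nmove w s <= len (nedge w) & A (pt (nedge w) (nmove w s))]].
have Zr : Z r by [].
have Zt1 s : Z s -> t1 <= s.
  move=> [s0 rs As]; rewrite leNgt; apply/negP => st.
  by have [|_] := ht1 s; first by rewrite s0.
have lbZ : has_lbound Z by exists t1 => s /Zt1.
have hZ : has_inf Z by split=> //; exists r.
pose q := inf Z; have qr : q <= r by apply: ge_inf.
have tq : t1 <= q by apply: lb_le_inf; [exists r|move=> s /Zt1].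
have q0 : 0 < q by apply: lt_le_trans tq.
have rq : 0 <= nmove w q <= len (nedge w).
  by apply: (nmove_range aw rr); rewrite qr ltW.
have nA s : 0 < s < q -> ~ A (pt (nedge w) (nmove w s)).
  move=> /andP[s0 sq] As; have : Z s.
    by split=> //; apply: (nmove_range aw rq); rewrite !ltW.
  by move=> /(ge_inf lbZ); rewrite leNgt sq.
have Aq : A (pt (nedge w) (nmove w q)).
  apply: closed_pt => // d d0; have [s Zs sd] := inf_adherent d0 hZ.
  have [s0 rs As] := Zs; exists (nmove w s); split=> //.
  have := ge_inf lbZ Zs; rewrite -/q in sd *.
  by rewrite nmove_dist => qs; rewrite distrC ger0_norm ?subr_ge0 // ltrBlDl.
exists q; split=> //; first by rewrite q0.
apply: outward_intro => //.
  move: aw rq; rewrite /anchored /opposite /nbase /nedge /nmove /nsign /=.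
  by case: w.1.2 => /= /andP[a b] /andP[c d]; apply/andP; split; rewrite /nbase in a b c d *; lra.
exists q => // s /andP[s0 sq]; rewrite nmove_opposite.
split; last by apply: nA; rewrite subr_gt0 sq gtrBl.
by apply: (nmove_range aw rq); rewrite subr_ge0 (ltW sq) gerBl ltW.
Qed.

End EdgePoints.

Section AffineLimit.
Local Open Scope ring_scope.

(** Serves to pass from the open phase to its end: an arm is in its edge at the final time too. *)
Lemma affine_le_limit (R : realFieldType) (a b c d t0 : R) : a < b ->
  (forall t, a < t < b -> d + c * (t - t0) <= 0) -> d + c * (b - t0) <= 0.
Proof.
move=> ab h; rewrite leNgt; apply/negP => p.
have c0 : 0 < c.
  rewrite ltNge; apply/negP => cn; have := h ((a + b) / 2).
  have tr : a < (a + b) / 2 < b by apply/andP; split; lra.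
  move=> /(_ tr); apply/negP; rewrite -ltNge; apply: (lt_le_trans p); rewrite lerD2l ler_wnM2l // lerD2r; lra.
pose t := Num.max ((a + b) / 2) (b - (d + c * (b - t0)) / (c * 2)).
have hb : b - (d + c * (b - t0)) / (c * 2) < b by rewrite gtrBl divr_gt0 ?mulr_gt0.
have hm1 : a < (a + b) / 2 by lra.
have hm2 : (a + b) / 2 < b by lra.
have tr : a < t < b by rewrite /t lt_max gt_max hb hm1 hm2.
have tb : b - (d + c * (b - t0)) / (c * 2) <= t by rewrite le_max lexx orbT.
have := h t tr; apply/negP; rewrite -ltNge.
have : c * (b - (d + c * (b - t0)) / (c * 2)) <= c * t by rewrite ler_pM2l.
have -> : c * (b - (d + c * (b - t0)) / (c * 2)) = c * b - (d + c * (b - t0)) / 2.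
  by field; rewrite gt_eqF.
move: p; rewrite !mulrBr; move: (c * b) (c * t) (c * t0) => x y z; clear; move=> p q; lra.
Qed.

End AffineLimit.

(** * Motion of the arms of a flooding *)

Section FloodingDynamics.
Local Open Scope classical_set_scope.
Local Open Scope ring_scope.
Variables (R : realType) (G : metric_graph R).
Variables (f : R -> set (mspace G)) (F : flooding_data G).
Hypothesis fl : is_flooding f F.
Local Notation m := (fl_steps F).
Local Notation T := (fl_time F).
Local Notation A k := (f (fl_time F k)).
Local Notation co := (arm_coord F).
Local Notation arms := (fl_arms F).
Local Notation speed := (fl_speed F).
Local Notation normal := (Defs.normal G).

Lemma fl_phase k : (k < m)%N -> is_phase f F k.
Proof. by case: fl => _ _ _ + _; apply. Qed.

Lemma fl_time_lt k : (k < m)%N -> T k < T k.+1.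
Proof. by move=> /fl_phase[[]]. Qed.

Lemma fl_time_mono k l : (k <= l <= m)%N -> T k <= T l.
Proof.
move=> /andP[]; elim: l => [|l ih]; first by rewrite leqn0 => /eqP ->.
rewrite leq_eqVlt => /predU1P[->//|kl] lm.
by apply: le_trans (ih kl (ltnW lm)) _; apply/ltW/fl_time_lt.
Qed.

Lemma fl_time_ge0 k : (k <= m)%N -> 0 <= T k.
Proof. by move=> km; case: fl => _ _ <- _ _; apply: fl_time_mono. Qed.

Lemma fl_closed k : (k <= m)%N -> closed (A k).
Proof. by move=> /fl_time_ge0 k0; case: fl => h _ _ _ _; have [] := h _ k0. Qed.

Lemma fl_mono k l : (k <= l <= m)%N -> A k `<=` A l.
Proof.
move=> /[dup] klm /andP[kl lm]; case: fl => _ h _ _ _; apply: h; last exact: fl_time_mono.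
by apply: fl_time_ge0; apply: leq_trans lm.
Qed.

Lemma fl_end : A m = setT.
Proof. by case: fl => _ _ _ _; apply. Qed.

Section Phase.
Variable k : nat.
Hypothesis km : (k < m)%N.
Local Notation t0 := (T k).
Local Notation t1 := (T k.+1).

Let lt01 : t0 < t1. Proof. exact: fl_time_lt. Qed.
Let cA : closed (A k). Proof. by apply: fl_closed; exact: ltnW. Qed.

Lemma armsP w : w \in arms k <-> outward_normal (A k) w.
Proof. by have [_ [_ h] _ _ _] := fl_phase km. Qed.

Lemma speed_ge0 w : w \in arms k -> 0 <= speed k w.
Proof. by have [_ _ [h _] _ _] := fl_phase km; apply: h. Qed.

Lemma sum_speed : \sum_(w <- arms k) speed k w = 1.
Proof. by have [_ _ [_ h] _ _] := fl_phase km. Qed.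

Lemma arms_uniq : uniq (arms k).
Proof. by have [_ [h _] _ _ _] := fl_phase km. Qed.

Lemma fl_step : A k.+1 = A k `|` swept F k t1.
Proof. by have [_ _ _ _ h] := fl_phase km; apply: h; rewrite lexx ltW. Qed.

Lemma base_in w : w \in arms k -> A k (pt (nedge w) (nbase w)).
Proof. by move=> /armsP; apply: outward_in. Qed.

Lemma arm_anchored w : w \in arms k -> anchored w.
Proof. by move=> /armsP[]. Qed.

Lemma coE w t : co k w t = nmove w (speed k w * (t - t0)). Proof. by []. Qed.

Lemma no_phase_end t : t0 < t < t1 -> ~ phase_ends F k t.
Proof.
move=> /andP[a b] pe; have [_ _ _ te _] := fl_phase km.
have : inf (phase_ends F k) <= t by apply: ge_inf => //; exists t0 => s [/ltW].
by rewrite -te leNgt b.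
Qed.

Lemma arm_range_open w t : w \in arms k -> t0 < t < t1 -> 0 <= co k w t <= len (nedge w).
Proof.
move=> wa /[dup] ht /no_phase_end np; apply/negPn/negP => h; apply: np.
by case/andP: ht => a _; split=> //; left; exists w.
Qed.

Lemma arm_range w t : w \in arms k -> t0 <= t <= t1 -> 0 <= co k w t <= len (nedge w).
Proof.
move=> wa /andP[]; rewrite le_eqVlt => /predU1P[<- _|t0t].
  by rewrite coE subrr mulr0 nmove0; apply/anchored_range/arm_anchored.
rewrite le_eqVlt => /predU1P[->|tt1]; last by apply: arm_range_open; rewrite ?t0t.
have E t' : co k w t' = nbase w + nsign w * speed k w * (t' - t0) by rewrite coE /nmove mulrA.
apply/andP; split.
  rewrite -oppr_le0 E opprD -mulNr; apply: (affine_le_limit lt01) => s hs.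
  by rewrite mulNr -opprD oppr_le0 -E; have /andP[] := arm_range_open wa hs.
rewrite -subr_le0 E addrAC; apply: (affine_le_limit lt01) => s hs.
by rewrite addrAC subr_le0 -E; have /andP[] := arm_range_open wa hs.
Qed.

Lemma arms_no_meet w1 w2 t : w1 \in arms k -> w2 \in arms k -> w1 != w2 ->
  nedge w1 = nedge w2 -> t0 < t < t1 -> co k w1 t != co k w2 t.
Proof.
move=> a1 a2 ne ee ht; apply/eqP => e; apply: (no_phase_end ht).
by case/andP: ht => a _; split=> //; right; exists w1, w2.
Qed.

Lemma opposite_neq (w : normal) q : opposite w q != w.
Proof. by apply/eqP => /(congr1 (fun u : normal => u.1.2)) /=; case: w.1.2. Qed.

(** The first point of the old set in front of the arm would carry the opposite normal, which is an
    arm of the same phase; the two would meet before the phase ends. *)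
Lemma arm_avoids w t : w \in arms k -> 0 < speed k w -> t0 < t < t1 ->
  ~ A k (pt (nedge w) (co k w t)).
Proof.
move=> wa z0 ht At; have /andP[ta tb] := ht.
have r0 : 0 < speed k w * (t - t0) by rewrite mulr_gt0 // subr_gt0.
have [q [/andP[q0 qr] ow nA]] := facing_normal cA (proj1 (armsP w) wa) r0 (arm_range_open wa ht) At.
have oa : opposite w q \in arms k by apply/armsP.
set w' := opposite w q in oa *; pose z' := speed k w'.
have z'0 : 0 <= z' := speed_ge0 oa.
have zz : 0 < speed k w + z' by rewrite ltr_pwDl.
(* The time at which two arms facing each other at distance [q] meet. *)
pose s := t0 + q / (speed k w + z').
have hs : t0 < s < t1.
  rewrite /s ltrDl divr_gt0 //= -ltrBrDl ltr_pdivrMr //.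
  apply: le_lt_trans qr _; rewrite mulrC; apply: (@lt_le_trans _ _ ((t1 - t0) * speed k w)).
    by rewrite ltr_pM2r // ltrD2r.
  by rewrite ler_wpM2l ?lerDl // subr_ge0 ltW.
have := arms_no_meet wa oa (_ : w != w') erefl hs; rewrite eq_sym opposite_neq => /(_ isT) /eqP; apply.
rewrite !coE nmove_opposite -/z'; congr (nmove w _); rewrite /s addrC addKr.
by field; rewrite gt_eqF.
Qed.

Lemma normal_eq (w w' : normal) : nedge w = nedge w' -> w.1.2 = w'.1.2 -> nbase w = nbase w' -> w = w'.
Proof. by case: w w' => [[e b] x] [[e' b'] x'] /= ; rewrite /nedge /nbase /= => -> -> ->. Qed.

Lemma same_side (w w' : normal) : nedge w = nedge w' -> w.1.2 = w'.1.2 ->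
  exists d, forall r, nmove w' r = nmove w (d + r).
Proof.
move=> ee ss; exists (nsign w * (nbase w' - nbase w)) => r.
rewrite /nmove /nsign ss; case: w'.1.2; ring.
Qed.

Lemma other_side (w w' : normal) : nedge w = nedge w' -> w.1.2 != w'.1.2 ->
  exists d, forall r, nmove w' r = nmove w (d - r).
Proof.
move=> ee ss; exists (nsign w * (nbase w' - nbase w)) => r.
move: ss; rewrite /nmove /nsign; case: w'.1.2; case: w.1.2 => // _; ring.
Qed.

Lemma nmove_inj (w : normal) : injective (nmove w).
Proof.
move=> r s h; have := nmove_dist w r s; rewrite h subrr normr0 => /esym/normr0_eq0/eqP.
by rewrite subr_eq0 => /eqP.
Qed.

(** Two arms sweep disjoint pieces. In the same direction, the rear one would run over the base of
    the other, contradicting [arm_avoids]; in opposite directions, they would meet too early. *)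
Lemma arms_apart w w' s s' : w \in arms k -> w' \in arms k -> w != w' ->
  nedge w = nedge w' -> t0 < s < t1 -> 0 < speed k w -> t0 <= s' <= t1 ->
  co k w s <> co k w' s'.
Proof.
move=> wa wa' ne ee hs z0 hs'; have /andP[sa sb] := hs; have /andP[sa' sb'] := hs'.
have z'0 := speed_ge0 wa'.
have p0 : 0 < speed k w * (s - t0) by rewrite mulr_gt0 // subr_gt0.
have p0' : 0 <= speed k w' * (s' - t0) by rewrite mulr_ge0 // subr_ge0.
have [ss|ss] := eqVneq w.1.2 w'.1.2.
  have [d dE] := same_side ee ss; rewrite !coE dE => /nmove_inj e.
  have [d0|d0|d0] := ltgtP 0 d.
  - have d1 : d <= speed k w * (s - t0) by rewrite e lerDl.
    have hu : t0 < t0 + d / speed k w < t1.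
      rewrite ltrDl divr_gt0 //= -ltrBrDl ltr_pdivrMr // (le_lt_trans d1) // mulrC.
      by rewrite ltr_pM2r // ltrD2r.
    apply: (arm_avoids wa z0 hu); rewrite coE addrC addKr mulrCA mulfV ?gt_eqF // mulr1.
    by rewrite -[d]addr0 -dE nmove0 ee; apply: base_in.
  - have p1 : - d < speed k w' * (s' - t0) by rewrite -subr_gt0 opprK addrC -e.
    have z1 : 0 < speed k w'.
      rewrite lt_neqAle z'0 andbT; apply: contraTneq p1 => <-.
      by rewrite mul0r -leNgt oppr_ge0 ltW.
    have hu : t0 < t0 - d / speed k w' < t1.
      rewrite -mulNr ltrDl divr_gt0 ?oppr_gt0 //= -ltrBrDl ltr_pdivrMr //.
      apply: lt_le_trans p1 _; rewrite mulrC ler_pM2r // lerD2r //.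
    apply: (arm_avoids wa' z1 hu); rewrite coE addrC addKr mulrN mulrCA mulfV ?gt_eqF // mulr1.
    by rewrite dE subrr nmove0 -ee; apply: base_in.
  by move/eqP: ne; apply; apply: normal_eq => //; rewrite -nmove0 -(nmove0 w') dE -d0 addr0.
have [d dE] := other_side ee ss; rewrite !coE dE => /nmove_inj e.
have zz : 0 < speed k w + speed k w' by rewrite ltr_pwDl.
have dd : d = speed k w * (s - t0) + speed k w' * (s' - t0) by rewrite e subrK.
have d0 : 0 < d by rewrite dd ltr_pwDl.
have hu : t0 < t0 + d / (speed k w + speed k w') < t1.
  rewrite ltrDl divr_gt0 //= -ltrBrDl ltr_pdivrMr // dd [ltRHS]mulrDr.
  apply: ltr_leD; first by rewrite mulrC ltr_pM2r // ltrD2r.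
  by rewrite mulrC ler_wpM2r // lerD2r.
move/eqP: (arms_no_meet wa wa' ne ee hu); apply; rewrite !coE dE; congr (nmove w _).
by rewrite addrC addKr; field; rewrite gt_eqF.
Qed.

Lemma newly_covered p : A k.+1 p -> ~ A k p -> exists w s,
  [/\ w \in arms k, t0 < s <= t1, 0 < speed k w & p = pt (nedge w) (co k w s)].
Proof.
rewrite fl_step => -[//|[w [s [wa /andP[s0 s1] ->]]]] nA; exists w, s; split=> //.
  rewrite s1 andbT lt_neqAle s0 andbT; apply: contra_notN nA => /eqP <-.
  by rewrite coE subrr mulr0 nmove0; apply: base_in.
rewrite lt_neqAle speed_ge0 // andbT; apply: contra_notN nA => /eqP z.
by rewrite coE -z mul0r nmove0; apply: base_in.
Qed.

Lemma arm_covers w s : w \in arms k -> t0 <= s <= t1 -> A k.+1 (pt (nedge w) (co k w s)).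
Proof. by move=> wa hs; rewrite fl_step; right; exists w, s. Qed.

(* the arm sweeps everything between its base and its position *)
Lemma arm_covers_between w s r : w \in arms k -> t0 <= s <= t1 ->
  0 <= r <= speed k w * (s - t0) -> A k.+1 (pt (nedge w) (nmove w r)).
Proof.
move=> wa /andP[s0 s1] /andP[r0 rs].
have := speed_ge0 wa; rewrite le0r => /predU1P[z|z].
  have -> : r = 0 by apply/eqP; rewrite eq_le r0 andbT (le_trans rs) // z mul0r.
  by rewrite nmove0 fl_step; left; apply: base_in.
have -> : nmove w r = co k w (t0 + r / speed k w).
  by rewrite coE addrC addKr mulrCA mulfV ?gt_eqF // mulr1.
apply: arm_covers => //; rewrite lerDl divr_ge0 ?(ltW z) //= -lerBrDl.
by rewrite ler_pdivrMr // mulrC (le_trans rs) // ler_pM2l // lerD2r.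
Qed.

End Phase.

(* Uncovered points of an edge stay separated from covered ones by a source. *)
Lemma source_between k e a c y : (k <= m)%N -> 0 <= a -> c <= len e -> a < y < c ->
  ~ A k (pt e a) -> ~ A k (pt e c) -> A k (pt e y) ->
  exists2 x, a < x < c & A 0 (pt e x).
Proof.
elim: k y => [|k ih] y km a0 cl /andP[ay yc] nAa nAc Ay; first by exists y; rewrite ?ay.
have km' : (k < m)%N by [].
have sub : A k `<=` A k.+1 by apply: fl_mono; rewrite leqnSn.
have nAa' : ~ A k (pt e a) by move=> /sub.
have nAc' : ~ A k (pt e c) by move=> /sub.
have [Aky|nAky] := pselect (A k (pt e y)); first by apply: (ih y) => //; [exact: ltnW|rewrite ay].
have [w [s [wa /andP[s0 s1] z0 yE]]] := newly_covered km' Ay nAky.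
have hs : T k <= s <= T k.+1 by rewrite (ltW s0).
have iy : inner (e, y) by rewrite /inner /= (le_lt_trans a0 ay) (lt_le_trans yc cl).
have [ee ye] := pt_inner_inj iy (arm_range km' wa hs) yE.
have cov r : 0 <= r <= speed k w * (s - T k) -> A k.+1 (pt e (nmove w r)).
  by rewrite ee; apply: arm_covers_between.
have Ab : A k (pt e (nbase w)) by rewrite ee; apply: base_in.
(* The base of the arm that swept [y] also lies between [a] and [c], since otherwise the arm would
   have covered one of them. *)
apply: (ih (nbase w)) => //; first exact: ltnW.
set r := speed k w * (s - T k) in cov; rewrite coE -/r /nmove in ye.
have r0 : 0 <= r by rewrite mulr_ge0 ?(ltW z0) // subr_ge0 ltW.
have sgn x : nmove w (nsign w * (x - nbase w)) = x.
  by rewrite /nmove /nsign; case: w.1.2; ring.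
have nocov x : ~ A k.+1 (pt e x) -> ~ 0 <= nsign w * (x - nbase w) <= r.
  by move=> nAx /cov; rewrite sgn.
apply/andP; split; rewrite ltNge; apply/negP => h.
  apply: (nocov a nAa); move: ye h ay; rewrite /nsign; case: w.1.2;
    move: (nbase w) (r) r0 => b q; clear; move=> q0 -> ? ?; apply/andP; split; lra.
apply: (nocov c nAc); move: ye h yc; rewrite /nsign; case: w.1.2;
  move: (nbase w) (r) r0 => b q; clear; move=> q0 -> ? ?; apply/andP; split; lra.
Qed.

End FloodingDynamics.

(** * Bounds on the phases and arms of a flooding *)

Section PhaseCount.
Import fintype finset.
Local Open Scope classical_set_scope.
Local Open Scope ring_scope.
Variables (R : realType) (G : metric_graph R).
Local Notation normal := (Defs.normal G).

Lemma outward_uncovered (A : set (mspace G)) (w : normal) d : outward_normal A w -> 0 < d ->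
  ~ (forall t, 0 < t <= d -> A (pt (nedge w) (nmove w t))).
Proof.
move=> [_ _ [t1 t10 h]] d0 c; pose t := Num.min (t1 / 2) d.
have t0 : 0 < t by rewrite lt_min divr_gt0.
have tt1 : t < t1 by rewrite gt_min; apply/orP; left; lra.
have [|_] := h t; first by rewrite t0.
by apply; apply: c; rewrite t0 ge_min lexx orbT.
Qed.

Lemma common_radius (I : eqType) (s : seq I) (P : I -> R -> Prop) :
  (forall x, x \in s -> exists2 d, 0 < d & forall t, 0 <= t < d -> P x t) ->
  exists2 d, 0 < d & forall x, x \in s -> forall t, 0 <= t < d -> P x t.
Proof.
elim: s => [|x s ih] h; first by exists 1.
have [|d d0 hd] := ih; first by move=> y ys; apply: h; rewrite inE ys orbT.
have [|d' d'0 hd'] := h x; first by rewrite inE eqxx.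
exists (Num.min d d'); first by rewrite lt_min d0.
move=> y; rewrite inE => /predU1P[->|ys] t; rewrite lt_min => /andP[t0 /andP[a b]].
  by apply: hd'; rewrite t0.
by apply: hd; rewrite ?t0.
Qed.

Lemma uniq_map_inj (I J : eqType) (h : I -> J) (s : seq I) :
  uniq (map h s) -> {in s &, injective h}.
Proof.
elim: s => [//|x s ih] /= /andP[nx us] y z; rewrite !inE.
move=> /predU1P[->|ys] /predU1P[->|zs] // e; last exact: ih.
- by rewrite e map_f in nx.
- by rewrite -e map_f in nx.
Qed.

Lemma card_index (I : Type) (B : set I) K : (B #= `I_K)%card ->
  exists2 g : I -> nat, (forall p, B p -> g p < K)%N &
    (forall p q, B p -> B q -> g p = g q -> p = q).
Proof.
move=> /pcard_eqP[g]; exists g; first by move=> p Bp; exact: (@funS _ _ _ _ g p Bp).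
by move=> p q Bp Bq; apply: inj; apply: mem_set.
Qed.

Definition dstart (d : edg G * bool) : mspace G := inl (if d.2 then src d.1 else tgt d.1).
Definition start_normal (d : edg G * bool) : normal := (d, if d.2 then 0 else len d.1).

Lemma anchored_start (w : normal) : anchored w -> ~~ inner (nedge w, nbase w) ->
  w = start_normal w.1 /\ pt (nedge w) (nbase w) = dstart w.1.
Proof.
move=> aw; rewrite /inner /= => ni; move: aw ni; rewrite /anchored /start_normal /dstart.
case: w => [[e b] x] /=; rewrite /nedge /nbase /=; case: b => /= /andP[a1 a2] ni.
  have -> : x = 0 by apply/eqP; move: ni; rewrite a2 andbT -leNgt => h; rewrite eq_le h.
  by rewrite pt0.
have -> : x = len e by apply/eqP; move: ni; rewrite a1 /= -leNgt => h; rewrite eq_le a2.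
by rewrite ptl.
Qed.

Variables (f : R -> set (mspace G)) (F : flooding_data G).
Hypothesis fl : is_flooding f F.
Local Notation m := (fl_steps F).
Local Notation T := (fl_time F).
Local Notation A k := (f (fl_time F k)).
Local Notation co := (arm_coord F).
Local Notation arms := (fl_arms F).
Local Notation speed := (fl_speed F).

Definition continued k (w : normal) : normal := (nedge w, w.1.2, co k w (T k.+1)).

Definition covered_starts k : {set edg G * bool} := [set d | `[< A k (dstart d) >]]%SET.

Lemma nmove_continued k w r :
  nmove (continued k w) r = nmove w (speed k w * (T k.+1 - T k) + r).
Proof. by rewrite /continued /nmove /arm_coord /nmove /nbase /nsign /=; ring. Qed.

Section Step.
Variable k : nat.
Hypothesis km : (k.+1 < m)%N.
Let km' : (k < m)%N := ltnW km.
Let lt01 := fl_time_lt fl km'.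
Let sub : A k `<=` A k.+1.
Proof. by apply: (fl_mono fl); rewrite leqnSn. Qed.

Lemma stopped_continued w : w \in arms k -> speed k w = 0 -> continued k w = w.
Proof. by move=> wa z; rewrite /continued coE // z mul0r nmove0; case: w {wa z} => [[]]. Qed.

(** If the base was covered before the phase, the arm was there and stood still. If it is a newly
    covered vertex of the graph, the arm starts there. Otherwise some arm swept it, and an outward
    normal must look away from the swept segment, so it is that arm at its final position. *)
Lemma continued_or_started w' : w' \in arms k.+1 ->
  (exists2 w, w \in arms k & w' = continued k w) \/
  w' = start_normal w'.1 /\ w'.1 \in covered_starts k.+1 :\: covered_starts k.
Proof.
move=> /[dup] wa' /(armsP fl km) ow; have [aw _ [u u0 hu]] := ow.
have Ab' := base_in fl km wa'.
have [Ab|nAb] := pselect (A k (pt (nedge w') (nbase w'))).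
  have wa : w' \in arms k.
    apply/(armsP fl km'); apply: outward_intro => //; exists u => // t /hu[r nA].
    by split=> // /sub.
  left; exists w' => //; rewrite stopped_continued //; apply/eqP.
  rewrite eq_le (speed_ge0 fl km' wa) andbT leNgt; apply/negP => z0.
  apply: (outward_uncovered ow (_ : 0 < speed k w' * (T k.+1 - T k))).
    by rewrite mulr_gt0 // subr_gt0.
  move=> t /andP[t0 t1]; apply: (arm_covers_between fl km' wa (s := T k.+1)).
    by rewrite lexx ltW.
  by rewrite ltW.
have [iw|/(anchored_start aw)[wE pE]] := boolP (inner (nedge w', nbase w')); last first.
  right; split=> //; rewrite finset.in_setD !finset.in_set; apply/andP; split; apply/asboolP; by rewrite -pE.
have [w [s [wa /andP[s0 s1] z0 bE]]] := newly_covered fl km' Ab' nAb.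
have hs : T k <= s <= T k.+1 by rewrite (ltW s0).
have [ee xE] := pt_inner_inj iw (arm_range fl km' wa hs) bE.
have hT : T k <= T k.+1 <= T k.+1 by rewrite lexx ltW.
left; exists w => //; have [ss|ss] := eqVneq w.1.2 w'.1.2.
  have [d dE] := same_side (esym ee) ss.
  have dv : d = speed k w * (s - T k).
    by apply: (@nmove_inj _ _ w); rewrite -[d]addr0 -dE nmove0 xE.
  suff sT : s = T k.+1 by apply: normal_eq => //=; rewrite /nbase /= -sT -xE.
  apply/eqP; rewrite eq_le s1 leNgt; apply/negP => sT.
  apply: (outward_uncovered ow (_ : 0 < speed k w * (T k.+1 - s))).
    by rewrite mulr_gt0 // subr_gt0.
  move=> t /andP[t0 t1]; rewrite dE ee.
  apply: (arm_covers_between fl km' wa hT).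
  rewrite dv addr_ge0 ?(ltW t0) ?mulr_ge0 ?(ltW z0) ?subr_ge0 ?(ltW s0) //=.
  by apply: (le_trans (lerD (lexx _) t1)); rewrite -mulrDr addrC addrA subrK.
have [d dE] := other_side (esym ee) ss.
have dv : d = speed k w * (s - T k).
  by apply: (@nmove_inj _ _ w); rewrite -[d]subr0 -dE nmove0 xE.
exfalso; apply: (outward_uncovered ow (_ : 0 < d)).
  by rewrite dv mulr_gt0 // subr_gt0.
move=> t /andP[t0 t1]; rewrite dE ee; apply: (arm_covers_between fl km' wa hs).
by rewrite subr_ge0 t1 -dv gerBl ltW.
Qed.

(* Were all arms of a phase to continue separately, the phase would go on. *)
Lemma some_arm_stops : ~ ((forall w, w \in arms k -> continued k w \in arms k.+1) /\
  {in arms k &, injective (continued k)}).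
Proof.
move=> [ca inj]; have [_ _ _ te _] := fl_phase fl km'.
have T0 : 0 <= T k := fl_time_ge0 fl (ltnW km').
(* Were there no ending condition, the infimum would be 0 by convention, but it exceeds [T k], which
   is nonnegative. *)
have [[t pt]|ne] := pselect (exists t, phase_ends F k t); last first.
  have E : phase_ends F k = set0.
    by apply/seteqP; split=> // t h; apply: ne; exists t.
  by move: te; rewrite E inf0 => tE; move: lt01; rewrite tE ltNge T0.
have hi : has_inf (phase_ends F k).
  by split; [exists t|exists (T k) => s [/ltW]].
have aft w t' : w \in arms k -> co k w t' = nmove (continued k w) (speed k w * (t' - T k.+1)).
  by move=> wa; rewrite nmove_continued coE //; congr nmove; ring.
(* For a short while after [T k.+1], no arm leaves its edge and, next, no two arms coincide. *)
have [d1 d10 h1] : exists2 d, 0 < d & forall w, w \in arms k ->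
    forall t, 0 <= t < d -> 0 <= co k w (T k.+1 + t) <= len (nedge w).
  apply: common_radius => w wa; have [aw _ [u u0 hu]] := proj1 (armsP fl km _) (ca w wa).
  have z0 := speed_ge0 fl km' wa; have z1 : 0 < 1 + speed k w by rewrite ltr_pwDl.
  exists (u / (1 + speed k w)); first by rewrite divr_gt0.
  move=> t' /andP[t0 tu]; rewrite aft // addrC addKr.
  have [z|z] := eqVneq (speed k w * t') 0.
    by rewrite z nmove0; apply: (anchored_range aw).
  apply: (proj1 (hu _ _)); rewrite lt_neqAle eq_sym z mulr_ge0 //=.
  move: tu; rewrite ltr_pdivlMr //; apply: le_lt_trans; rewrite mulrDr mulr1 mulrC.
  by rewrite lerDr.
have [d2 d20 h2] : exists2 d, 0 < d & forall ww, ww \in [seq (w1, w2) | w1 <- arms k, w2 <- arms k] ->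
    forall t, 0 <= t < d -> ww.1 != ww.2 -> nedge ww.1 = nedge ww.2 ->
    co k ww.1 (T k.+1 + t) <> co k ww.2 (T k.+1 + t).
  apply: common_radius => _ /allpairsP[[w1 w2] /= [a1 a2 ->]] /=.
  have z1 := speed_ge0 fl km' a1; have z2 := speed_ge0 fl km' a2.
  have [->|ne] := eqVneq w1 w2; first by exists 1 => // ?; rewrite eqxx.
  have [ee|ne'] := eqVneq (nedge w1) (nedge w2); last by exists 1 => // ? _ _ /eqP; rewrite (negbTE ne').
  have [pe|pn] := eqVneq (co k w1 (T k.+1)) (co k w2 (T k.+1)); last first.
    have zz : 0 < 1 + speed k w1 + speed k w2 by rewrite ltr_pwDl // ltr_pwDl.
    exists (`|co k w1 (T k.+1) - co k w2 (T k.+1)| / (1 + speed k w1 + speed k w2)).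
      by rewrite divr_gt0 // normr_gt0 subr_eq0.
    move=> t' /andP[t0]; rewrite ltr_pdivlMr // => tu _ _; rewrite !aft // addrC addKr => E.
    have n1 w : w \in arms k ->
        `|co k w (T k.+1) - nmove (continued k w) (speed k w * t')| = speed k w * t'.
      move=> wa; rewrite -[co k w _]/(nbase (continued k w)) -(nmove0 (continued k w)).
      by rewrite nmove_dist sub0r normrN ger0_norm // mulr_ge0 // (speed_ge0 fl km').
    have := ler_distD (nmove (continued k w1) (speed k w1 * t')) (co k w1 (T k.+1)) (co k w2 (T k.+1)).
    rewrite n1 // E (distrC (nmove _ _)) n1 // leNgt => /negP; apply.
    apply: le_lt_trans tu; rewrite !mulrDr mulr1 (mulrC t') (mulrC t') -addrA.
    by rewrite lerDr.
  (* If two opposite arms end at the same point, then each looks into what the other swept, so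
     neither has moved; they would have coincided during the whole phase. *)
  have back w w' : w \in arms k -> w' \in arms k -> nedge w = nedge w' -> w.1.2 != w'.1.2 ->
      co k w (T k.+1) = co k w' (T k.+1) -> speed k w = 0.
    move=> aw aw' eww sww cww; apply/eqP; rewrite eq_le (speed_ge0 fl km' aw) andbT leNgt.
    apply/negP => z0; have ow := proj1 (armsP fl km _) (ca w' aw').
    have hT : T k <= T k.+1 <= T k.+1 by rewrite lexx ltW.
    apply: (outward_uncovered ow (_ : 0 < speed k w * (T k.+1 - T k))).
      by rewrite mulr_gt0 // subr_gt0.
    move=> t' /andP[t0 t1].
    have -> : nmove (continued k w') t' = nmove w (speed k w * (T k.+1 - T k) - t').
      rewrite -nmove_continued /nmove /nbase /nsign /= -cww; move: sww.
      by case: w.1.2; case: w'.1.2 => // _; ring.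
    rewrite -[nedge (continued k w')]/(nedge w') -eww.
    by apply: (arm_covers_between fl km' aw hT); rewrite subr_ge0 t1 gerBl ltW.
  have sne : w1.1.2 != w2.1.2.
    apply: contraNneq ne => ss; apply/eqP; apply: inj => //; apply: normal_eq => //.
  have y1 := back _ _ a1 a2 ee sne pe.
  have y2 : speed k w2 = 0 by apply: (back w2 w1) => //; rewrite eq_sym.
  have hm : T k < (T k + T k.+1) / 2 < T k.+1 by rewrite !midf_lt.
  have /eqP := arms_no_meet fl km' a1 a2 ne ee hm; case.
  by move: pe; rewrite /arm_coord y1 y2 !mul0r.
have [|t0 pe0 tlt] := inf_adherent (_ : 0 < Num.min d1 d2) hi; first by rewrite lt_min d10.
move: tlt; rewrite -te => tlt.
have tge : T k.+1 <= t0 by rewrite te; apply: ge_inf => //; case: hi.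
have tE : t0 = T k.+1 + (t0 - T k.+1) by rewrite addrC subrK.
have : 0 <= t0 - T k.+1 < Num.min d1 d2 by rewrite subr_ge0 tge ltrBlDl.
rewrite lt_min => /andP[r0 /andP[r1 r2]].
case: pe0 => _ [[w wa]|[w1 [w2 [a1 a2 ne ee]]]]; rewrite tE; first by rewrite h1 ?r0.
by apply: (h2 (w1, w2)) => //=; [apply: allpairs_f|rewrite r0].
Qed.

End Step.
Lemma covered_starts_mono k : (k < m)%N -> covered_starts k \subset covered_starts k.+1.
Proof.
move=> km; apply/subsetP => d; rewrite !finset.in_set => /asboolP h; apply/asboolP.
by move: h; apply: (fl_mono fl); rewrite leqnSn.
Qed.

(** The number of arms minus the number of covered edge ends strictly decreases: each new arm needs
    a newly covered end, and by [some_arm_stops] fewer arms survive than there were. *)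
Lemma arms_step k : (k.+1 < m)%N ->
  (size (arms k.+1) + #|covered_starts k| < size (arms k) + #|covered_starts k.+1|)%N.
Proof.
move=> km; have km' : (k < m)%N := ltnW km.
pose kept := [seq w <- map (continued k) (arms k) | w \in arms k.+1].
pose new := enum (covered_starts k.+1 :\: covered_starts k).
have le1 : (size (arms k.+1) <= size (undup kept ++ map start_normal new))%N.
  apply: uniq_leq_size; first exact: (arms_uniq fl).
  move=> w aw; rewrite mem_cat mem_undup mem_filter aw /=; apply/orP.
  have [[w' aw' ->]|[-> h]] := continued_or_started km aw; [left|right]; apply: map_f => //.
  by rewrite mem_enum.
have lt1 : (size (undup kept) < size (arms k))%N.
  rewrite ltnNge; apply/negP => le2; apply: (some_arm_stops km).
  have s1 : (size kept <= size (map (continued k) (arms k)))%N by rewrite size_filter count_size.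
  have s2 : (size (undup kept) <= size kept)%N := size_undup _.
  have e2 : size (undup kept) = size kept.
    by apply/eqP; rewrite eqn_leq s2 (leq_trans s1) // size_map.
  have e1 : size kept = size (map (continued k) (arms k)).
    by apply/eqP; rewrite eqn_leq s1 size_map -e2.
  have ka : kept = map (continued k) (arms k).
    by apply/all_filterP; rewrite all_count -size_filter; apply/eqP.
  split.
    by move=> w aw; have : continued k w \in kept; [rewrite ka map_f|rewrite mem_filter => /andP[]].
  have uk : uniq (map (continued k) (arms k)).
    by rewrite -ka -[uniq _]negbK -ltn_size_undup e2 ltnn.
  exact: uniq_map_inj.
have sub := subset_leq_card (covered_starts_mono km').
rewrite size_cat size_map /new -cardE cardsDS ?covered_starts_mono // in le1.
have aux (x y z a b : nat) : (x <= y + (b - a) -> y < z -> a <= b -> x + a < z + b)%N.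
  by clear; lia.
exact: aux le1 lt1 sub.
Qed.

Variable K : nat.
Hypothesis card0 : (f 0 #= `I_K)%card.

(** An initial arm either leaves a source inside an edge, in one of two directions, or starts at an
    end of an edge. *)
Lemma arms0_le : (0 < m)%N -> (size (arms 0) <= (#|edg G| + K).*2)%N.
Proof.
move=> m0; have T0 : T 0 = 0 by case: fl.
have [g gK gi] := card_index card0.
pose h (w : normal) : (edg G * bool) + nat * bool :=
  if inner (nedge w, nbase w) then inr (g (pt (nedge w) (nbase w)), w.1.2) else inl w.1.
have A0 w : w \in arms 0 -> f 0 (pt (nedge w) (nbase w)).
  by move=> wa; rewrite -T0; apply: (base_in fl).
pose img : seq ((edg G * bool) + nat * bool) :=
  map inl (enum {: edg G * bool}) ++ map inr [seq (i, b) | i <- iota 0 K, b <- [:: true; false]].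
rewrite -(size_map h) (@leq_trans (size img)) //; last first.
  rewrite size_cat (size_map inl) (size_map inr) size_allpairs size_iota -cardE.
  by rewrite card_prod card_bool -mulnDl muln2.
apply: uniq_leq_size.
  rewrite map_inj_in_uniq ?(arms_uniq fl) // => w w' wa wa'.
  have aw := arm_anchored fl m0 wa; have aw' := arm_anchored fl m0 wa'.
  rewrite /h; have [iw|nw] := boolP (inner _); have [iw'|nw'] := boolP (inner _) => //.
    case=> /(gi _ _ (A0 _ wa) (A0 _ wa')) pe ss.
    have [ee be] := pt_inner_inj iw (anchored_range aw') pe.
    exact: normal_eq.
  by case=> e; have [-> _] := anchored_start aw nw; have [-> _] := anchored_start aw' nw'; rewrite e.
move=> _ /mapP[w wa ->]; rewrite /h mem_cat; case: ifP => _; apply/orP; [right|left].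
  apply/map_f/allpairsP; exists (g (pt (nedge w) (nbase w)), w.1.2).
  split=> /=; [|by case: w.1.2|by []].
  by rewrite mem_iota gK //; apply: A0.
by apply: map_f; rewrite mem_enum.
Qed.

Lemma phase_bound k : (k < m)%N -> (size (arms k) + k <= #|edg G| * 4 + K * 2)%N.
Proof.
have cs l : (#|covered_starts l| <= #|edg G| * 2)%N.
  by apply: leq_trans (max_card _) _; rewrite card_prod card_bool.
move=> km; suff : (size (arms k) + k <= (#|edg G| + K).*2 + #|covered_starts k|)%N.
  have aux (x a b c : nat) : (x <= (a + b).*2 + c -> c <= a * 2 -> x <= a * 4 + b * 2)%N.
    by clear; lia.
  by move=> h; apply: aux h (cs k).
elim: k km => [|k ih] km; first by rewrite addn0 (leq_trans (arms0_le km)) // leq_addr.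
have aux (x y a b c d : nat) : (x + a < y + b -> y + d <= c + a -> x + d.+1 <= c + b)%N.
  by clear; lia.
exact: aux (arms_step km) (ih (ltnW km)).
Qed.

End PhaseCount.

(** * Labelings that follow a given flooding *)

Lemma sum_nth_pad (V : nmodType) (T : Type) (x0 : T) (s : seq T) C (h : T -> V) : (size s <= C)%N ->
  (\sum_(a < C) (if (a < size s)%N then h (nth x0 s a) else 0) = \sum_(w <- s) h w)%R.
Proof.
move=> sC; rewrite -big_mkcond big_ord_narrow // (big_nth x0) big_mkord.
by apply: eq_bigr.
Qed.

Section FloodSchedule.
Import fintype finset.
Local Open Scope classical_set_scope.
Local Open Scope ring_scope.
Variables (R : realType) (G : metric_graph R) (n : nat).
Hypothesis n_gt0 : (0 < n)%N.
Local Notation normal := (Defs.normal G).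
Local Notation pieces := (@pieces R G n).
Local Notation piece_len := (@piece_len R G n).
Local Notation svtx := (@svtx R G n).
Local Notation svert := (@svert R G n).
Local Notation neighbors := (@neighbors R G n).
Local Notation spoint := (@spoint R G n).

Variables (f : R -> set (mspace G)) (F : flooding_data G).
Hypothesis fl : is_flooding f F.
Local Notation m := (fl_steps F).
Local Notation T := (fl_time F).
Local Notation A k := (f (fl_time F k)).
Local Notation co := (arm_coord F).
Local Notation arms := (fl_arms F).
Local Notation speed := (fl_speed F).
Variable K : nat.
Hypothesis card0 : (f 0 #= `I_K)%card.
Local Notation C := (#|edg G| * 4 + K * 2)%N.

Lemma entry_exists v : exists l, `[< A l (spoint v) >].
Proof. by exists m; apply/asboolP; rewrite (fl_end fl). Qed.

(** The value 0 means that [v] is a source, and [k.+1] that phase number [k] covers it first. *)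
Definition entry v : nat := ex_minn (entry_exists v).

Lemma entry_in v : A (entry v) (spoint v).
Proof. by rewrite /entry; case: ex_minnP => l /asboolP. Qed.

Lemma entry_min v l : A l (spoint v) -> (entry v <= l)%N.
Proof. by move=> h; rewrite /entry; case: ex_minnP => l' _; apply; apply/asboolP. Qed.

Lemma entry_le v : (entry v <= m)%N.
Proof. by apply: entry_min; rewrite (fl_end fl). Qed.

Lemma entry_gt v k : (k < entry v)%N -> ~ A k (spoint v).
Proof. by move=> h /entry_min; rewrite leqNgt h. Qed.

(** The triple records an arm that sweeps [v] in its entry phase, the time of the passage, and the
    index of [v] on the edge; for sources it is unconstrained. *)
Definition enters (v : svtx) (q : normal * R * nat) : Prop :=
  forall k, entry v = k.+1 ->
  [/\ q.1.1 \in arms k, T k < q.1.2 <= T k.+1, 0 < speed k q.1.1 &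
      [/\ (q.2 <= pieces (nedge q.1.1))%N, v = svert (nedge q.1.1) q.2 &
          co k q.1.1 q.1.2 = q.2%:R * piece_len (nedge q.1.1)]].

Lemma enters_exists v : exists q, enters v q.
Proof.
have [e _] := card_gt0P (edg_gt0 G).
case E : (entry v) => [|k]; first by exists ((e, true, 0), 0, 0%N) => k; rewrite E.
have km : (k < m)%N by rewrite -E entry_le.
have [||w [s [wa hs z0 pE]]] := @newly_covered _ _ _ _ fl _ km (spoint v).
- by rewrite -E; apply: entry_in.
- by apply: entry_gt; rewrite E.
have hs' : T k <= s <= T k.+1 by move: hs => /andP[a ->]; rewrite ltW.
have [j [jp vE cE]] := spointP n_gt0 (arm_range fl km wa hs') pE.
by exists (w, s, j) => k'; rewrite E => -[<-].
Qed.

Variable q : svtx -> normal * R * nat.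
Hypothesis qP : forall v, enters v (q v).
Local Notation via v := (q v).1.1.

(** The blocks are the phases, preceded by the sources in block 0, which are put on one chain in an
    arbitrary order. The index set of arms has the size given by [phase_bound], so that it does not
    vary with the phase. *)
Definition flood_schedule : schedule svtx 'I_C.+1 m.+1 := Schedule
  (fun v => inord (entry v))
  (fun v => if entry v == 0%N then ord0 else inord (index (via v) (arms (entry v).-1)))
  (fun v => if entry v == 0%N then enum_rank v : nat else
            if (via v).1.2 then (q v).2 else (pieces (nedge (via v)) - (q v).2)%N).
Local Notation S := flood_schedule.

Lemma blk_entry v : blk S v = entry v :> nat.
Proof. by rewrite /= inordK // ltnS entry_le. Qed.

Lemma arms_size k : (k < m)%N -> (size (arms k) <= C)%N.
Proof. by move=> km; apply: leq_trans (phase_bound fl card0 km); apply: leq_addr. Qed.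

Lemma arm_index v k : entry v = k.+1 -> arm S v = index (via v) (arms k) :> nat.
Proof.
move=> E; have [va _ _ _] := qP E; have km : (k < m)%N by rewrite -E entry_le.
rewrite /= E /= inordK //; apply: leq_trans (_ : (size (arms k)).+1 <= _)%N.
  by rewrite ltnS index_size.
by rewrite ltnS arms_size.
Qed.

Lemma chain_via u v k : entry u = k.+1 ->
  (chain_of S u == chain_of S v) = (entry v == k.+1) && (via u == via v).
Proof.
move=> Eu; apply/eqP/andP => [[/(congr1 val) /= eb ea]|[/eqP Ev /eqP uv]].
  have Ev : entry v = k.+1.
    by move: eb; rewrite !inordK ?ltnS ?entry_le // Eu.
  split; first by rewrite Ev.
  have [ua _ _ _] := qP Eu; have [va _ _ _] := qP Ev.
  have : index (via u) (arms k) = index (via v) (arms k) by rewrite -!arm_index //= ea.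
  by move=> h; rewrite -(nth_index (via u) ua) h nth_index.
congr pair; apply: ord_inj; first by rewrite !blk_entry Eu Ev.
by rewrite (arm_index Eu) (arm_index Ev) uv.
Qed.

Lemma flood_schedule_inj x y : chain_of S x = chain_of S y -> pos S x = pos S y -> x = y.
Proof.
move=> ch; case Ex : (entry x) => [|k].
  have Ey : entry y = 0%N.
    by case: ch => /(congr1 val) /= + _; rewrite !inordK ?ltnS ?entry_le // Ex.
  by rewrite /= Ex Ey /= => /ord_inj/enum_rank_inj.
move/eqP: ch; rewrite (chain_via _ Ex) => /andP[/eqP Ey /eqP xy].
have [_ _ _ [jx xE _]] := qP Ex; have [_ _ _ [jy yE _]] := qP Ey.
rewrite /= Ex Ey /= -xy => h; rewrite xE yE -xy; congr (svert _ _).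
rewrite -xy in jy; move: h jx jy; case: (via x).1.2 => //.
by move: (q x).2 (q y).2 (pieces _); clear; move=> a b p; lia.
Qed.

Lemma flood_compat_exists : exists L, L \in compat S.
Proof.
pose r v := (entry v * #|svtx| + enum_rank v)%N.
have rlt u v : (entry u < entry v)%N -> (r u < r v)%N.
  have aux (a b c d N : nat) : (c < d -> a < N -> c * N + a < d * N + b)%N.
    move=> cd aN; apply: (@leq_trans (c.+1 * N)); first by rewrite mulSn addnC ltn_add2r.
    by apply: leq_trans (leq_addr _ _); rewrite leq_mul2r cd orbT.
  by move=> uv; apply: aux uv (ltn_ord _).
have ri : injective r.
  move=> u v e; have [uv|vu|uv] := ltngtP (entry u) (entry v).
  - by have := rlt _ _ uv; rewrite e ltnn.
  - by have := rlt _ _ vu; rewrite e ltnn.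
  by move: e; rewrite /r uv => /addnI/ord_inj/enum_rank_inj.
have [L [iL hL]] := rank_labeling ri; exists L; apply/compatP; split=> // x y.
by rewrite !blk_entry -ltime_lt hL; apply: rlt.
Qed.

(* A vertex strictly inside the interval swept by an arm belongs to its chain. *)
Lemma swept_chain k w j s : (k < m)%N -> w \in arms k -> 0 < speed k w -> T k < s < T k.+1 ->
  (0 < j < pieces (nedge w))%N -> co k w s = j%:R * piece_len (nedge w) ->
  entry (svert (nedge w) j) = k.+1 /\ via (svert (nedge w) j) = w.
Proof.
move=> km wa z0 hs /[dup] hj /andP[j0 jp] cE; set v := svert _ _.
have vp : spoint v = pt (nedge w) (co k w s) by rewrite cE spoint_svert // ltnW.
have hs' : T k <= s <= T k.+1 by case/andP: hs => *; rewrite !ltW.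
have Ev : entry v = k.+1.
  apply/eqP; rewrite eqn_leq; apply/andP; split.
    by apply: entry_min; rewrite vp; apply: (arm_covers fl km wa).
  rewrite ltnNge; apply/negP => ek; apply: (arm_avoids fl km wa z0 hs).
  by rewrite -vp; apply: (fl_mono fl) (entry_in v); rewrite ek ltnW.
split=> //; have [va /andP[a b] z0' [jv vE cv]] := qP Ev.
have ij : inner (nedge w, j%:R * piece_len (nedge w)) by apply: coord_inner.
have rv : T k <= (q v).1.2 <= T k.+1 by rewrite (ltW a).
have pE : pt (nedge w) (j%:R * piece_len (nedge w)) = pt (nedge (via v)) (co k (via v) (q v).1.2).
  by rewrite -cE -vp {1}vE spoint_svert // cv.
have [ee xE] := pt_inner_inj ij (arm_range fl km va rv) pE.
apply/eqP/negPn/negP => ne.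
by apply: (arms_apart fl km wa va _ ee hs z0 rv); rewrite 1?eq_sym // cE.
Qed.

Lemma swept_vertex k w j r : (k < m)%N -> w \in arms k -> (j <= pieces (nedge w))%N ->
  0 < r < speed k w * (T k.+1 - T k) -> nmove w r = j%:R * piece_len (nedge w) ->
  entry (svert (nedge w) j) = k.+1 /\ via (svert (nedge w) j) = w.
Proof.
move=> km wa jp /andP[r0 rz] wr; have lt01 := fl_time_lt fl km.
have D0 : 0 < T k.+1 - T k by rewrite subr_gt0.
have z0 : 0 < speed k w by rewrite -(pmulr_lgt0 _ D0) (lt_trans r0).
have cE : co k w (T k + r / speed k w) = j%:R * piece_len (nedge w).
  by rewrite coE // addrC addKr mulrCA mulfV ?gt_eqF // mulr1.
apply: (swept_chain km wa z0 _ _ cE).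
  by rewrite ltrDl divr_gt0 //= -ltrBrDl ltr_pdivrMr // mulrC.
have rb : 0 <= nbase w <= len (nedge w) := anchored_range (arm_anchored fl km wa).
have re : 0 <= nmove w (speed k w * (T k.+1 - T k)) <= len (nedge w).
  by apply: (arm_range fl km wa); rewrite lexx ltW.
have pl0 := piece_len_gt0 n_gt0 (nedge w).
have : 0 < nmove w r < len (nedge w).
  move: rb re r0 rz; rewrite /nmove /nsign; move: (nbase w) (speed k w * _) (len _) => b z l.
  by case: w.1.2; clear; move=> /andP[? ?] /andP[? ?] ? ?; apply/andP; split; lra.
by rewrite wr -(pieces_piece_len n_gt0) pmulr_lgt0 // ltr0n ltr_pM2r // ltr_nat.
Qed.

Section Peaks.
Variable L : labeling G n.
Hypothesis LS : L \in sorted_labs S.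

(** A vertex swept just before [v] by the same arm would have a larger label, against [v] being a
    peak. So the arm started within the last piece before [v], and both ends of that piece were
    uncovered. *)
Lemma behind_peak v k j' : v \in peaks L -> entry v = k.+1 ->
  (j' <= pieces (nedge (via v)))%N -> neighbors v (svert (nedge (via v)) j') ->
  (if (via v).1.2 then j' < (q v).2 else (q v).2 < j' <= pieces (nedge (via v)))%N ->
  nmove (via v) (speed k (via v) * ((q v).1.2 - T k) - piece_len (nedge (via v))) =
    j'%:R * piece_len (nedge (via v)) ->
  [/\ ~ A k (spoint v), ~ A k (spoint (svert (nedge (via v)) j')) &
   speed k (via v) * ((q v).1.2 - T k) < piece_len (nedge (via v))].
Proof.
have /sorted_labsP[/compatP[iL hB] hC] := LS.
move=> pv Ev; have [va /andP[a b] z0 [jv vE cv]] := qP Ev.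
set w := via v in va z0 jv vE cv *; set u := svert _ j' => jp nvu jj wr.
have km : (k < m)%N by rewrite -Ev entry_le.
have luv : (L u < L v)%N.
  by rewrite -ltime_lt; move: pv; rewrite peaksE => /forallP/(_ u)/implyP; apply.
have Eu : (k.+1 <= entry u)%N.
  rewrite leqNgt; apply/negP => h; have := hB u v; rewrite !blk_entry Ev => /(_ h).
  by move=> /(ltn_trans luv); rewrite ltnn.
have nAu : ~ A k (spoint u) by apply: entry_gt.
split=> //; first by apply: entry_gt; rewrite Ev.
rewrite -subr_lt0 ltNge; apply/negP; rewrite le0r => /predU1P[r0|r0].
  apply: nAu; rewrite spoint_svert // -wr r0 nmove0; exact: (base_in fl km va).
have pl0 := piece_len_gt0 n_gt0 (nedge w).
have [|Eu' uw] := swept_vertex km va jp (_ : 0 < _ < _) wr.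
  rewrite r0 /= (@lt_le_trans _ _ (speed k w * ((q v).1.2 - T k))) //.
    by rewrite gtrBl.
  by rewrite ler_pM2l // lerD2r.
have [_ _ _ [ju uE _]] := qP Eu'; rewrite -/u uw in ju uE.
have je : (q u).2 = j' by apply/esym; apply: (svert_inj n_gt0 jp ju).
have := hC u v; rewrite /= Ev Eu' /= uw je -/w.
have -> : chain_of S u = chain_of S v.
  by apply/eqP; rewrite (chain_via _ Eu') Ev eqxx uw eqxx.
move=> /(_ erefl) h; suff /h/(ltn_trans luv) : ((if w.1.2 then j' else pieces (nedge w) - j') <
    (if w.1.2 then (q v).2 else pieces (nedge w) - (q v).2))%N by rewrite ltnn.
move: jj; case: w.1.2 => // /andP[]; move: (q v).2 (pieces _) => x y; clear; lia.
Qed.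

Definition source_of (v : svtx) (p : mspace G) := p = spoint v \/
  exists e j x, [/\ (j < pieces e)%N, v = svert e j \/ v = svert e j.+1,
    j%:R * piece_len e < x < j.+1%:R * piece_len e & p = pt e x].

(** If [v] is not a source, the base of its arm is a covered point between two uncovered neighboring
    vertices, and [source_between] finds a source in that piece. *)
Lemma peak_source v : v \in peaks L -> exists2 p, f 0 p & source_of v p.
Proof.
move=> pv; have T0 : T 0 = 0 by case: fl.
case Ev : (entry v) => [|k].
  by exists (spoint v); [rewrite -T0 -Ev; apply: entry_in|left].
have [va /andP[a b] z0 [jv vE cv]] := qP Ev; have B := behind_peak pv Ev.
have km : (k < m)%N by rewrite -Ev entry_le.
set w := via v in va z0 jv vE cv B *; set e := nedge w in jv vE cv B *.
have pl0 := piece_len_gt0 n_gt0 e.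
have r0 : 0 < speed k w * ((q v).1.2 - T k) by rewrite mulr_gt0 // subr_gt0.
have Ab : A k (pt e (nbase w)) := base_in fl km va.
have rb : 0 <= nbase w <= len e := anchored_range (arm_anchored fl km va).
rewrite coE // in cv; set r := speed k w * _ in cv r0 B *.
have fin j : (j < pieces e)%N -> v = svert e j \/ v = svert e j.+1 ->
    ~ A k (spoint (svert e j)) -> ~ A k (spoint (svert e j.+1)) ->
    j%:R * piece_len e < nbase w < j.+1%:R * piece_len e ->
    exists2 p, f 0 p & source_of v p.
  move=> jp vj n1 n2 hb; rewrite !spoint_svert // 1?ltnW // in n1 n2.
  have /andP[c0 _] := coord_range n_gt0 (ltnW jp).
  have /andP[_ c1] := coord_range n_gt0 jp.
  have [x hx Ax] := source_between fl (ltnW km) c0 c1 hb n1 n2 Ab.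
  by exists (pt e x); [rewrite -T0|right; exists e, j, x].
move: B cv; rewrite /nmove /nsign; case: w.1.2 => B cv.
  case jE : (q v).2 => [|j].
    move: cv rb r0; rewrite jE mul0r mul1r; move: (nbase w) (r) => x y.
    by move=> ? /andP[? ?] ?; lra.
  rewrite jE in jv vE cv B.
  have [||||n1 n2 rp] := B j; rewrite ?ltnS ?(ltnW jv) //.
  - by rewrite neighbors_sym {1}vE neighbors_svert.
  - by rewrite -natr1 mulrDl mul1r in cv; move: cv; rewrite !mul1r; move: (j%:R * _) => y; lra.
  apply: (fin j) => //; [by right|by rewrite -vE|].
  move: cv rp r0; rewrite -natr1 mulrDl !mul1r; move: (j%:R * _) (nbase w) => y x.
  by move=> ? ? ?; apply/andP; split; lra.
have jlt : ((q v).2 < pieces e)%N.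
  rewrite ltnNge; apply/negP => h; have jE : (q v).2 = pieces e by apply/eqP; rewrite eqn_leq jv.
  move: cv rb r0; rewrite jE (pieces_piece_len n_gt0); move: (nbase w) (len e) (r) => x y z.
  by move=> ? /andP[? ?] ?; lra.
have [||||n1 n2 rp] := B (q v).2.+1; rewrite ?ltnS ?leqnn //.
- by rewrite {1}vE neighbors_svert.
- by move: cv; rewrite -natr1 mulrDl mul1r; move: (_ * piece_len e) => y; lra.
apply: (fin (q v).2) => //; [by left|by rewrite -vE|].
move: cv rp r0; rewrite -natr1 mulrDl !mul1r; move: (_ * piece_len e) (nbase w) => y x.
by move=> ? ? ?; apply/andP; split; lra.
Qed.

Lemma source_between_vertices e j x v : (j < pieces e)%N ->
  j%:R * piece_len e < x < j.+1%:R * piece_len e ->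
  inner (e, x) /\ pt e x <> spoint v.
Proof.
move=> jp /andP[x1 x2]; have pl0 := piece_len_gt0 n_gt0 e.
have /andP[c0 _] := coord_range n_gt0 (ltnW jp).
have /andP[_ c1] := coord_range n_gt0 jp.
have ix : inner (e, x) by rewrite /inner /= (le_lt_trans c0 x1) (lt_le_trans x2 c1).
split=> // h; have rx : 0 <= x <= len e by case/andP: ix => *; rewrite !ltW.
have [i [ip _ xE]] := spointP n_gt0 rx (esym h).
by move: x1 x2; rewrite xE !ltr_pM2r // !ltr_nat ltnS ltnNge => /negP.
Qed.

Lemma peaks_not_neighbors u v : u \in peaks L -> v \in peaks L -> ~~ neighbors u v.
Proof.
rewrite !peaksE => /forallP/(_ v) hu /forallP/(_ u) hv; apply/negP => h.
move: hu hv; rewrite h (neighbors_sym v) h /= => a b.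
by have := ltn_trans a b; rewrite ltnn.
Qed.

(** Two distinct peaks sharing a source would be the ends of one piece, but peaks are never
    neighbors. *)
Lemma source_inj u v p : u \in peaks L -> v \in peaks L ->
  source_of u p -> source_of v p -> u = v.
Proof.
move=> pu pv [->|[e [j [x [jp uE xj ->]]]]] [h|[e' [j' [x' [jp' vE xj' h]]]]].
- exact: (spoint_inj n_gt0 h).
- by have [_ []] := source_between_vertices u jp' xj'.
- by have [_ []] := source_between_vertices v jp xj.
have [ix _] := source_between_vertices u jp xj.
have [/andP[/= a b] _] := source_between_vertices u jp' xj'.
have rx' : 0 <= x' <= len e' by rewrite !ltW.
have [ee xx] := pt_inner_inj ix rx' h; rewrite -ee -xx in jp' vE xj'.
have pl0 := piece_len_gt0 n_gt0 e.
have jj : j = j'.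
  move: xj xj' => /andP[x1 x2] /andP[y1 y2].
  have := lt_trans x1 y2; have := lt_trans y1 x2.
  rewrite !ltr_pM2r // !ltr_nat !ltnS => h1 h2.
  by apply/eqP; rewrite eqn_leq h1 h2.
have nn := neighbors_svert jp; have := peaks_not_neighbors pu pv; rewrite -jj in vE.
case: uE vE => -> [->|->] //; first by rewrite nn.
by rewrite neighbors_sym nn.
Qed.

Lemma card_peaks_flood : (#|peaks L| <= K)%N.
Proof.
have [g gK gi] := card_index card0.
have /choice[s sP] : forall v, exists p, v \in peaks L -> f 0 p /\ source_of v p.
  move=> v; have [pv|npv] := boolP (v \in peaks L); last by exists (spoint v).
  by have [p fp sp] := peak_source pv; exists p.
rewrite cardE -(size_map (g \o s)) -[leqRHS](size_iota 0); apply: uniq_leq_size.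
  rewrite map_inj_in_uniq ?enum_uniq // => u v; rewrite !mem_enum => pu pv /= e.
  have [fu su] := sP u pu; have [fv sv] := sP v pv.
  by apply: (source_inj pu pv su); rewrite (gi _ _ fu fv e).
by move=> x /mapP[v]; rewrite mem_enum => /sP[fv _] ->; rewrite mem_iota /= gK.
Qed.

End Peaks.

(** The chain consists of the subdivision vertices in the interval swept by the arm; only those at
    its two ends are in doubt, and the rest of the constant is rounding. *)
Lemma card_chain_near k w : (k < m)%N -> w \in arms k ->
  `|n%:R * (speed k w * (T k.+1 - T k)) -
    (#|[set v | (entry v == k.+1) && (via v == w)]%SET|)%:R| <= 3.
Proof.
move=> km wa; set Q := [set v | _]%SET; have lt01 := fl_time_lt fl km.
have := speed_ge0 fl km wa; rewrite le0r => /predU1P[z|z0].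
  rewrite z mul0r mulr0 (_ : Q = finset.set0) ?cards0 ?subrr ?normr0 //.
  apply/setP => v; rewrite finset.in_set0 finset.in_set; apply/negbTE/negP.
  by move=> /andP[/eqP Ev /eqP vw]; have [_ _] := qP Ev; rewrite vw z ltxx.
set e := nedge w; set d := speed k w * _.
have d0 : 0 < d by rewrite mulr_gt0 // subr_gt0.
have pl0 := piece_len_gt0 n_gt0 e.
have rb : 0 <= nbase w <= len e := anchored_range (arm_anchored fl km wa).
have re : 0 <= nmove w d <= len e by apply: (arm_range fl km wa); rewrite lexx ltW.
(* The lower end of the swept interval, whichever way the arm moves. *)
pose a := Num.min (nbase w) (nmove w d).
have a0 : 0 <= a by rewrite le_min; case/andP: rb => ->; case/andP: re => ->.
have ab r : 0 <= r <= d -> a <= nmove w r <= a + d.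
  move=> /andP[r0 rd]; rewrite /a /nmove /nsign; move: (nbase w) => b.
  by case: w.1.2; rewrite ?mul1r ?mulN1r minElt; case: ltP => h; apply/andP; split; lra.
have ba x : a < x < a + d -> exists2 r, 0 < r < d & nmove w r = x.
  move=> /andP[x1 x2]; exists (nsign w * (x - nbase w)).
    move: x1 x2; rewrite /a /nmove /nsign; move: (nbase w) => b.
    by case: w.1.2; rewrite ?mul1r ?mulN1r minElt; case: (ltP b) => h x1 x2; apply/andP; split; lra.
  by rewrite /nmove /nsign; case: w.1.2; ring.
have adl : a + d <= len e.
  case/andP: rb re => _ rb /andP[_]; rewrite /a /nmove /nsign; move: (nbase w) (len e) rb => b l rb.
  by case: w.1.2; rewrite ?mul1r ?mulN1r minElt; case: ltP => h re; lra.
have inside j : a < j%:R * piece_len e < a + d -> (j <= pieces e)%N /\ svert e j \in Q.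
  move=> hj; have jp : (j <= pieces e)%N.
    have := lt_le_trans (proj2 (andP hj)) adl.
    by rewrite -(pieces_piece_len n_gt0) ltr_pM2r // ltr_nat => /ltnW.
  have [r hr rE] := ba _ hj; have [Ev vw] := swept_vertex km wa jp hr rE.
  by split=> //; rewrite finset.in_set Ev vw !eqxx.
have only v : v \in Q -> exists j, [/\ (j <= pieces e)%N, v = svert e j &
   a <= j%:R * piece_len e <= a + d].
  rewrite finset.in_set => /andP[/eqP Ev /eqP vw].
  have [_ /andP[s0 s1] _ [jp vE cE]] := qP Ev; exists (q v).2.
  rewrite vw in jp vE cE; rewrite -cE; split=> //; apply: ab.
  rewrite mulr_ge0 ?subr_ge0 ?(ltW z0) ?(ltW s0) //=.
  by rewrite ler_pM2l // lerD2r.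
clear re rb.
pose j0 := Num.truncn (a / piece_len e); pose j1 := Num.truncn ((a + d) / piece_len e).
have /andP[p1 p2] : j0%:R * piece_len e <= a < j0.+1%:R * piece_len e.
  rewrite -ler_pdivlMr // -ltr_pdivrMr //; apply: truncn_itv; apply: divr_ge0 => //; exact: ltW.
have /andP[q1 q2] : j1%:R * piece_len e <= a + d < j1.+1%:R * piece_len e.
  rewrite -ler_pdivlMr // -ltr_pdivrMr //; apply: truncn_itv; apply: divr_ge0; last exact: ltW.
  by rewrite addr_ge0 // ltW.
have j1p : (j1 <= pieces e)%N.
  by move: (le_trans q1 adl); rewrite -(pieces_piece_len n_gt0) ler_pM2r // ler_nat.
have le1 : (#|Q| <= (j1 - j0).+1)%N.
  rewrite cardE -[leqRHS](size_iota j0) -(size_map (svert e)); apply: uniq_leq_size.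
    exact: enum_uniq.
  move=> v; rewrite mem_enum => /only[j [jp -> /andP[h1 h2]]]; apply: map_f.
  have g1 : (j0 <= j)%N by move: (le_trans p1 h1); rewrite ler_pM2r // ler_nat.
  have g2 : (j <= j1)%N by move: (le_lt_trans h2 q2); rewrite ltr_pM2r // ltr_nat ltnS.
  by rewrite mem_iota g1 /= addnS ltnS subnKC // (leq_trans g1).
have le2 : ((j1 - j0).-1 <= #|Q|)%N.
  have hj j : j \in iota j0.+1 (j1 - j0).-1 -> (j <= pieces e)%N /\ svert e j \in Q.
    rewrite mem_iota => /andP[g1 g2]; apply: inside; rewrite (lt_le_trans p2) /=; last first.
      by rewrite ler_pM2r // ler_nat.
    rewrite (lt_le_trans _ q1) // ltr_pM2r // ltr_nat; move: g1 g2; move: (j0) (j1) => x y.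
    by clear; lia.
  rewrite -[leqLHS](size_iota j0.+1) -(size_map (svert e)) cardE; apply: uniq_leq_size.
    rewrite map_inj_in_uniq ?iota_uniq // => j j' /hj[jp _] /hj[jp' _].
    exact: svert_inj.
  by move=> x /mapP[j /hj[_ jQ] ->]; rewrite mem_enum.
have n0 : 0 <= n%:R :> R by [].
have j0p : (j0 <= pieces e)%N.
  have : a <= len e by apply: le_trans adl; rewrite lerDl ltW.
  by move=> /(le_trans p1); rewrite -(pieces_piece_len n_gt0) ler_pM2r // ler_nat.
have /andP[b0 _] := coord_bounds n_gt0 j0p; have /andP[b1 _] := coord_bounds n_gt0 j1p.
have np j : n%:R * (j%:R * piece_len e) <= j%:R.
  by rewrite mulrCA ler_piMr // piece_len_le1.
have c0 := ler_wpM2l n0 p1; have c1 := ler_wpM2l n0 q1.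
have c2 := le_trans (ler_wpM2l n0 (ltW p2)) (np _).
have c3 := le_trans (ler_wpM2l n0 (ltW q2)) (np _).
rewrite mulrDr in c1 c3; rewrite -(natr1 j0) in c2; rewrite -(natr1 j1) in c3.
move: b0 b1 c0 c1 c2 c3; rewrite ler_norml.
have aux (x y z : nat) : ((z - y).-1 <= x)%N -> z%:R - y%:R - 1 <= x%:R :> R.
  by move=> h; rewrite lerBlDr lerBlDr natr1 -natrD ler_nat; move: h; clear; lia.
have := aux _ _ _ le2.
have : (#|Q|%:R : R) <= j1%:R - j0%:R + 1.
  have j01 : (j0 <= j1)%N.
    have ad : a < a + d by rewrite ltrDl.
    by move: (lt_trans (le_lt_trans p1 ad) q2); rewrite ltr_pM2r // ltr_nat ltnS.
  by rewrite -natrB // natr1 ler_nat.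
move: (#|Q|%:R : R) (j0%:R : R) (j1%:R : R) (n%:R * a) (n%:R * d) => x y z u v.
move: (n%:R * _) (n%:R * _) => s t.
by move=> *; apply/andP; split; lra.
Qed.

Local Notation gs := (graph_size G n).
Local Notation B := (C.+1%:R * 4 * gs).
Let phase_error : R := C.+1%:R * (2 + 3 *+ 2) + 1.

Let block_size b : #|[set x | blk S x == b]%SET| =
  (\sum_a #|[set x | chain_of S x == (b, a)]%SET|)%N.
Proof.
rewrite -sum1dep_card (partition_big (arm S) predT) //=; apply: eq_bigr => a _.
by rewrite sum1dep_card; apply: eq_card => x; rewrite !finset.in_set.
Qed.

Let card_gs (Q : {set svtx}) : #|Q|%:R <= gs.
Proof. by rewrite /graph_size ler_nat (leq_trans (max_card _)) // leq_addr. Qed.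

(** [multinomial_ge] for one phase, with arms of speed 0 added to fill the index set. *)
Lemma phase_multinomial k (b : 'I_m.+1) : (k < m)%N -> b = k.+1 :> nat ->
  n%:R * ((T k.+1 - T k) * - \sum_(w <- arms k) speed k w * ln (speed k w)) -
    phase_error * (1 + ln B) <=
  ln ((#|[set x | blk S x == b]%SET|)`!)%:R -
  \sum_a ln ((#|[set x | chain_of S x == (b, a)]%SET|)`!)%:R.
Proof.
move=> km bk; have D0 : 0 < T k.+1 - T k by rewrite subr_gt0 (fl_time_lt fl).
have n0 : 0 < n%:R :> R by rewrite ltr0n.
have sC := arms_size km; have [e0 _] := card_gt0P (edg_gt0 G).
pose w0 : normal := (e0, true, 0).
pose mc a := #|[set x | chain_of S x == (b, a)]%SET|.
pose z a := if (a < size (arms k))%N then speed k (nth w0 (arms k) a) else 0.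
have z0 a : 0 <= z a by rewrite /z; case: ifP => // h; apply: (speed_ge0 fl km); rewrite mem_nth.
have blkE v : (blk S v == b) = (entry v == k.+1).
  by apply/eqP/eqP => h; [rewrite -blk_entry h|apply: ord_inj; rewrite blk_entry h].
have near (a : 'I_C.+1) : `|n%:R * (z a * (T k.+1 - T k)) - (mc a)%:R| <= 3.
  rewrite /z; case: ifPn => ha.
    rewrite (_ : mc a = #|[set v | (entry v == k.+1) && (via v == nth w0 (arms k) a)]%SET|).
      by apply: card_chain_near; rewrite // mem_nth.
    apply: eq_card => v; rewrite !finset.in_set -[chain_of S v == _]/((blk S v == b) && (arm S v == a)) blkE.
    apply: andb_id2l => /eqP Ev; have [va _ _ _] := qP Ev.
    apply/eqP/eqP => [<-|h]; first by rewrite (arm_index Ev) nth_index.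
    by apply: ord_inj; rewrite (arm_index Ev) h index_uniq // (arms_uniq fl km).
  rewrite (_ : mc a = 0%N) ?mul0r ?mulr0 ?subrr ?normr0 //; apply: eq_card0 => v.
  rewrite finset.in_set -[chain_of S v == _]/((blk S v == b) && (arm S v == a)) blkE; apply/negbTE/negP => /andP[/eqP Ev /eqP va].
  have [vk _ _ _] := qP Ev; move: ha; rewrite -va (arm_index Ev) index_mem.
  by rewrite vk.
have sz : \sum_(a < C.+1) z a = 1.
  by rewrite -(sum_speed fl km) -(@sum_nth_pad _ _ w0 _ C.+1) // leqW.
have gs1 : 1 <= gs := graph_size_ge1 G n_gt0.
have C1 : 1 <= C.+1%:R :> R by rewrite ler1n.
have gsB : gs <= B.
  rewrite ler_peMl ?(le_trans _ gs1) //; apply: mulr_ege1 => //; by rewrite ler1n.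
have B1 : 1 <= B := le_trans gs1 gsB.
have XE : n%:R * (T k.+1 - T k) = \sum_(a < C.+1) n%:R * (z a * (T k.+1 - T k)).
  by rewrite -mulr_sumr -mulr_suml sz mul1r.
have XB : n%:R * (T k.+1 - T k) <= B.
  rewrite XE (@le_trans _ _ (\sum_(a < C.+1) (gs * 4))) //.
    apply: ler_sum => a _; have := near a; have := card_gs [set x | chain_of S x == (b, a)]%SET.
    rewrite -/(mc a) ler_norml => h /andP[_ h']; move: h h' gs1.
    by move: (n%:R * _) ((mc a)%:R : R) (gs) => x y g; lra.
  by rewrite sumr_const card_ord -[_ *+ _]mulr_natl -mulrA (mulrC gs).
have := @multinomial_ge R 'I_C.+1 predT mc (fun a => n%:R * (z a * (T k.+1 - T k)))
  (n%:R * (T k.+1 - T k)) B 3 _ _ _ XB B1 _ XE.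
rewrite block_size card_ord => h; apply: le_trans (h _ _ _ _); last first.
- by rewrite mulr_gt0.
- by move=> a _; apply: le_trans gsB; apply: card_gs.
- by move=> a _; apply: near.
- by move=> a _; rewrite !mulr_ge0 // ltW.
rewrite lerD2r !mulrN lerN2 -(@sum_nth_pad _ _ w0 _ C.+1) ?leqW // !mulr_sumr.
apply: ler_sum => a _; rewrite /z; case: ifP => ha; last by rewrite !mul0r !mulr0 mul0r.
set s := speed k _; rewrite (_ : _ / _ = s); last by field; rewrite !gt_eqF.
by rewrite le_eqVlt; apply/orP; left; apply/eqP; ring.
Qed.

Lemma steps_le : (m <= C.+1)%N.
Proof.
case: m (@phase_bound _ _ _ _ fl _ card0) => // k /(_ k (ltnSn k)) h.
by rewrite ltnS (leq_trans _ h) // leq_addl.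
Qed.

(** Summing over the phases, whose number [phase_bound] limits; the block of sources contributes a
    nonnegative term. *)
Lemma flood_class_size L0 : L0 \in compat S ->
  n%:R * flooding_entropy F - C.+1%:R * (phase_error * (1 + ln B)) <=
  ln (#|sorted_labs S|)%:R.
Proof.
move=> cL; rewrite (ln_card_sorted R flood_schedule_inj cL) big_ord_recl.
have err0 : 0 <= phase_error * (1 + ln B).
  have B1 : 1 <= B by apply: mulr_ege1; [apply: mulr_ege1|exact: graph_size_ge1]; rewrite ler1n.
  apply: mulr_ge0; rewrite /phase_error; apply: addr_ge0 => //; last exact: ln_ge0.
  by rewrite mulr_ge0 ?addr_ge0 ?mulrn_wge0.
have first0 : 0 <= ln ((#|[set x | blk S x == ord0]%SET|)`!)%:R -
    \sum_a ln ((#|[set x | chain_of S x == (ord0, a)]%SET|)`!)%:R :> R.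
  rewrite (bigD1 ord0) //= big1 ?addr0 => [|a a0]; last first.
    rewrite (_ : [set x | _]%SET = finset.set0) ?cards0 ?ln1 //.
    apply/setP => v; rewrite finset.in_set0 finset.in_set; apply/negbTE/eqP.
    move=> [/(congr1 val) /= + h]; rewrite inordK ?ltnS ?entry_le // => Ev.
    by move: a0; rewrite -h Ev eqxx.
  rewrite subr_ge0 ler_ln ?posrE ?ltr0n ?fact_gt0 // ler_nat leq_fact //.
  apply: subset_leq_card; apply/subsetP => v; rewrite !finset.in_set.
  by move=> /eqP[-> _].
apply: le_trans (lerD first0 (lexx _)); rewrite add0r.
apply: (@le_trans _ _ (\sum_(k < m) (n%:R * ((T k.+1 - T k) *
    - \sum_(w <- arms k) speed k w * ln (speed k w)) - phase_error * (1 + ln B)))); last first.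
  by apply: ler_sum => k _; apply: phase_multinomial.
rewrite sumrB sumr_const card_ord -mulr_sumr -[_ *+ m]mulr_natl.
rewrite /flooding_entropy -sumrN; apply: lerB.
  by rewrite ler_pM2l ?ltr0n //; apply: ler_sum => k _; rewrite mulrN.
by rewrite ler_wpM2r // ler_nat steps_le.
Qed.

End FloodSchedule.

(** * From a flooding to a lower bound on the number of labelings *)

Section FloodLabelings.
Import fintype finset.
Local Open Scope classical_set_scope.
Local Open Scope ring_scope.
Variables (R : realType) (G : metric_graph R).

Definition flood_const (K : nat) : R :=
  let c := (#|edg G| * 4 + K * 2).+1%:R in c * ((c * (2 + 3 *+ 2) + 1) * (1 + c * 4)).

Lemma flood_const_ge0 K : 0 <= flood_const K.
Proof.
rewrite /flood_const; set c := _.+1%:R; have c0 : 0 <= c by [].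
have d0 : 0 <= 2 + 3 *+ 2 :> R by rewrite addr_ge0 ?mulrn_wge0.
by apply: mulr_ge0 => //; apply: mulr_ge0; apply: addr_ge0 => //; apply: mulr_ge0.
Qed.

Lemma flood_const_le K M : (K <= M)%N -> flood_const K <= flood_const M.
Proof.
move=> KM; rewrite /flood_const.
set b := (#|edg G| * 4 + K * 2).+1%:R; set a := (#|edg G| * 4 + M * 2).+1%:R.
have ba : b <= a by rewrite ler_nat ltnS leq_add2l leq_mul2r KM orbT.
have b0 : 0 <= b by [].
have d0 : 0 <= 2 + 3 *+ 2 :> R by rewrite addr_ge0 ?mulrn_wge0.
move: ba b0 d0; move: a b (2 + _) => a b d ba b0 d0.
apply: ler_pM => //; first by rewrite mulr_ge0 ?addr_ge0 ?mulr_ge0.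
by apply: ler_pM; rewrite ?addr_ge0 ?mulr_ge0 // ?lerD2l ?lerD2r ler_wpM2r.
Qed.

(** The labelings that follow the flooding have at most [K] peaks, and [card_few_peaks] compares
    them with those having exactly [M]. *)
Lemma flood_labelings n (f : R -> set (mspace G)) F K M : (0 < n)%N -> is_flooding f F ->
  (f 0 #= `I_K)%card -> (K <= M)%N -> (M * (#|edg G|.*2).+1 < #|svtx G n|)%N ->
  expR (n%:R * flooding_entropy F - flood_const M * (1 + ln (graph_size G n))) <=
  (M.+1 * (#|svtx G n| ^ 2) ^ M)%:R * (#|labelings G n M|)%:R.
Proof.
move=> n_gt0 fl card0 KM big; have gs1 := graph_size_ge1 G n_gt0.
have [q qP] := choice (enters_exists n_gt0 fl).
have [L0 cL0] := flood_compat_exists fl K q.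
have [h _ sL] := sorted_exists cL0.
set SS := sorted_labs _ in sL.
have S0 : (0 < #|SS|)%N by apply/card_gt0P; exists (lperm L0 h).
have le1 := flood_class_size n_gt0 card0 qP cL0.
have le2 : (#|SS| <= M.+1 * (#|svtx G n| ^ 2) ^ M * #|labelings G n M|)%N.
  apply: card_few_peaks => // L LS; split.
    by have /sorted_labsP[/compatP[]] := LS.
  exact: leq_trans (card_peaks_flood n_gt0 card0 qP LS) KM.
rewrite -natrM; apply: (@le_trans _ _ (#|SS|)%:R); last by rewrite ler_nat.
rewrite -[leRHS]lnK ?posrE ?ltr0n // ler_expR; apply: le_trans le1.
apply: lerB => //; apply: le_trans (_ : flood_const K * (1 + ln (graph_size G n)) <= _); last first.
  by rewrite ler_wpM2r ?flood_const_le // addr_ge0 // ln_ge0.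
rewrite /flood_const; set c := _.+1%:R; rewrite -!mulrA; apply: ler_wpM2l => //.
apply: ler_wpM2l; first by rewrite addr_ge0 ?mulr_ge0 ?addr_ge0 ?mulrn_wge0.
have c0 : 0 < c by rewrite ltr0n.
have g0 : 0 < graph_size G n by apply: lt_le_trans gs1.
rewrite mulrA lnM ?posrE ?mulr_gt0 //.
have c4 : 0 < c * 4 by rewrite mulr_gt0.
have := ln_sublinear c4; have := ln_ge0 gs1.
move: c4; move: (ln (c * 4)) (ln _) (c * 4) => x y z z0 y0 xz.
have : 0 <= z * y by rewrite mulr_ge0 // ltW.
by rewrite mulrDl mul1r mulrDr mulr1; move: (z * y) => u; lra.
Qed.

End FloodLabelings.

(** * Asymptotics: combining the two counts *)

Section Growth.
Local Open Scope ring_scope.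
Variable R : realType.

Lemma eventually_gt (x : R) : exists n0 : nat, forall n : nat, (n0 <= n)%N -> x < n%:R.
Proof.
exists (Num.truncn x).+1 => n h; have [x0|x0] := leP 0 x; last first.
  by apply: lt_le_trans x0 _.
have /andP[_ h1] := truncn_itv x0; apply: lt_le_trans h1 _.
by rewrite ler_nat.
Qed.

Lemma ln_growth (a b : R) : exists n0 : nat, forall n : nat, (n0 <= n)%N ->
  a + b * ln n%:R < 2 * ln n%:R ^+ 2.
Proof.
pose c := 1 + `|a| + `|b|; have [n0 h] := eventually_gt (expR c).
exists n0 => n /h nc; have n0' : 0 < n%:R :> R by apply: lt_trans nc; apply: expR_gt0.
have : c < ln n%:R by rewrite -[c]expRK ltr_ln ?posrE // expR_gt0.
move: (ln _) => l; rewrite /c => cl.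
have a0 := normr_ge0 a; have b0 := normr_ge0 b.
have al := ler_norm a; have bl := ler_norm b.
have l1 : 1 < l by apply: le_lt_trans cl; rewrite -addrA lerDl addr_ge0.
have h1 : b * l <= `|b| * l by rewrite ler_wpM2r // ltW // (lt_trans ltr01).
have h2 : `|a| <= `|a| * l by rewrite ler_peMr // ltW.
have h3 : (1 + `|a| + `|b|) * l < l * l by rewrite ltr_pM2r // (lt_trans ltr01).
have h4 : 0 <= `|b| * l by rewrite mulr_ge0 // ltW // (lt_trans ltr01).
rewrite expr2; move: h3; rewrite !mulrDl mul1r.
move: (`|a| * l) (`|b| * l) (l * l) h1 h2 h4 => x y z h1 h2 h4 h3; lra.
Qed.

End Growth.

Section Asymptotics.
Import fintype finset.
Local Open Scope classical_set_scope.
Local Open Scope ring_scope.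
Variables (R : realType) (G : metric_graph R) (M : nat).
Hypothesis M_gt0 : (0 < M)%N.

Definition size_const : R := total_len G *+ 2 + size_error G + #|edg G|%:R.

Lemma size_error_ge0 : 0 <= size_error G.
Proof. by rewrite /size_error addr_ge0. Qed.

Lemma size_const_gt0 : 0 < size_const.
Proof. by rewrite /size_const -addrA ltr_pwDl ?pmulrn_lgt0 ?total_len_gt0 // addr_ge0 // size_error_ge0. Qed.

Lemma graph_size_le n : (0 < n)%N -> graph_size G n <= size_const * n%:R.
Proof.
move=> n0; have n1 : 1 <= n%:R :> R by rewrite ler1n.
rewrite /graph_size natrD card_sedg /size_const.
have := card_svtx_bounds G n0; rewrite ler_norml => /andP[_ h1].
have /andP[_ h2] := sum_pieces_bounds G n.
have s0 : 0 <= size_error G * (n%:R - 1) by rewrite mulr_ge0 ?size_error_ge0 // subr_ge0.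
have e0 : 0 <= #|edg G|%:R * (n%:R - 1) :> R by rewrite mulr_ge0 // subr_ge0.
move: s0 h1; move: (size_error G) => d s0 h1.
move: s0 e0 h1 h2; rewrite mulr2n !mulrDl !mulrBr !mulr1 (mulrC (total_len G)).
move: (n%:R * total_len G) (d * n%:R) (#|edg G|%:R * n%:R) => a b c.
move: (#|edg G|%:R : R) (#|svtx _ _|%:R : R) ((\sum_e pieces n e)%N%:R : R) => e u v; lra.
Qed.

Definition large (n : nat) : Prop :=
  [/\ (0 < n)%N, forall e : edg G, 1 <= n%:R * len e &
      (M * (#|edg G|.*2).+1 < #|svtx G n|)%N].

Lemma eventually_large : exists n0 : nat, forall n, (n0 <= n)%N -> large n.
Proof.
have z0 := total_len_gt0 G.
have [n0 h0] := eventually_gt (\sum_(e : edg G) (len e)^-1).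
have [n1 h1] := eventually_gt (((M * (#|edg G|.*2).+1)%:R + size_error G) / total_len G).
exists (maxn 1 (maxn n0 n1)) => n; rewrite !geq_max => /andP[n_gt0 /andP[/h0 a /h1 b]].
split=> // [e|].
  rewrite -ler_pdivrMr ?len_gt0 // mul1r; apply: le_trans (ltW a).
  rewrite (bigD1 e) //= lerDl; apply: sumr_ge0 => e' _.
  by rewrite invr_ge0 ltW // len_gt0.
rewrite ltr_pdivrMr // in b; rewrite -(ltr_nat R).
have := card_svtx_bounds G n_gt0; rewrite ler_norml => /andP[c _].
by move: b c; move: (_%:R * total_len G) (size_error G) (#|svtx G n|%:R) (_%:R) => x y z u; lra.
Qed.

(** Choose a flooding whose entropy is within 1/n of the supremum; the factor n turns this into the
    loss of 1 in the exponent. *)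
Lemma labelings_lower n : large n ->
  expR (n%:R * max_entropy G M - 1 - flood_const G M * (1 + ln (graph_size G n))) <=
  (M.+1 * (#|svtx G n| ^ 2) ^ M)%:R * (#|labelings G n M|)%:R.
Proof.
move=> [n0 nb big]; have n0' : 0 < n%:R :> R by rewrite ltr0n.
rewrite /max_entropy; set E := [set b | _].
have [hE|nE] := pselect (has_sup E).
  have [|b [f [F [fl [K /andP[_ KM] fK] ->]]] hb] := sup_adherent (_ : 0 < n%:R^-1) hE.
    by rewrite invr_gt0.
  apply: le_trans (flood_labelings n0 fl fK KM big).
  rewrite ler_expR lerD2r lerBlDr -ler_pdivlMl // mulrDr mulKf ?gt_eqF // mulr1.
  by rewrite -lerBlDr ltW.
(* Without a supremum, [max_entropy] is 0 by convention, and it suffices that some labeling with [M]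
   peaks exists. *)
rewrite sup_out // mulr0 sub0r.
have c0 : 0 <= flood_const G M * (1 + ln (graph_size G n)).
  by rewrite mulr_ge0 ?flood_const_ge0 // addr_ge0 // ln_ge0 // graph_size_ge1.
apply: (@le_trans _ _ 1).
  by rewrite -[leRHS]expR0 ler_expR -opprD oppr_le0 addr_ge0.
rewrite -natrM ler1n muln_gt0 labelings_neq0 // andbT muln_gt0 /= !expn_gt0.
by rewrite (leq_ltn_trans _ big).
Qed.

Lemma class_error_ge0 : 0 <= class_error G M.
Proof.
have e0 : 0 <= max_error G M by rewrite /max_error addr_ge0 // mulrn_wge0.
by rewrite /class_error mulr_ge0 // !addr_ge0 // ?mulr_ge0 // mulrn_wge0 // sqr_ge0.
Qed.

(** The quotient of [card_low_entropy] and [labelings_lower]. All remaining factors are polynomial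
    in n, hence of the form exp(O(ln n)), and [ln_growth] absorbs them into 2 ln^2 n. *)
Lemma low_entropy_rare (eps : R) : exists n0 : nat, forall n, (n0 <= n)%N ->
  prob M (fun L : labeling G n => label_entropy L <= max_entropy G M - eps) <
  expR (- n%:R * eps + 2 * ln n%:R ^+ 2).
Proof.
pose p := ((2 + max_front G M) * max_events G M + M)%N.
have [A1 A1_gt0 mcb] : exists2 A1 : nat, (0 < A1)%N & forall n, (0 < n)%N ->
    (max_classes G n M <= A1 * (5 * (#|svtx G n| + #|sedg G n|)) ^ p)%N.
  exists (2 ^ (#|vtx G| * max_events G M) * (max_events G M).+1)%N.
    by rewrite muln_gt0 expn_gt0.
  by move=> n; apply: max_classes_le.
pose A := (A1 * M.+1 * 5 ^ p)%N; pose q := (p + 2 * M)%N.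
have A0 : (0 < A)%N by rewrite !muln_gt0 A1_gt0 expn_gt0.
pose err := class_error G M + flood_const G M.
have err0 : 0 <= err by rewrite addr_ge0 ?class_error_ge0 ?flood_const_ge0.
have [n0 large_n] := eventually_large.
have [n1 growth] := ln_growth (ln A%:R + err + 1 + (q%:R + err) * ln size_const) (q%:R + err).
exists (maxn n0 n1) => n; rewrite geq_max => /andP[/large_n ln_ /growth {}growth].
have [n_gt0 n_big N_big] := ln_; have n_pos : 0 < n%:R :> R by rewrite ltr0n.
have := labelings_lower ln_; have := card_low_entropy M n_gt0 n_big (max_entropy G M - eps).
have lab0 : 0 < #|labelings G n M|%:R :> R by rewrite ltr0n labelings_neq0.
rewrite /prob ltr_pdivrMr //; set low := (X in X%:R <= _).
set gs := graph_size G n; set lab := #|_|%:R in lab0 *; set P := (M.+1 * _)%N.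
move=> le1 le2.
have gs1 : 1 <= gs := graph_size_ge1 G n_gt0.
have gs0 : 0 < gs by apply: lt_le_trans gs1.
have P0 : 0 < P%:R :> R.
  by rewrite ltr0n muln_gt0 /= !expn_gt0 (leq_ltn_trans _ N_big).
have PM : P%:R <= M.+1%:R * gs ^+ (2 * M).
  have Ngs : #|svtx G n|%:R <= gs by rewrite /gs /graph_size ler_nat leq_addr.
  by rewrite /P natrM ler_wpM2l // -expnM natrX lerXn2r ?nnegrE ?(ltW gs0).
clearbody P.
have count : P%:R * (max_classes G n M)%:R <= expR (ln A%:R + q%:R * ln gs).
  rewrite expRD lnK ?posrE ?ltr0n // expRM_natl lnK ?posrE //.
  apply: (@le_trans _ _ (P%:R * (A1%:R * (5 * gs) ^+ p))).
    rewrite ler_wpM2l ?(ltW P0) //; have := mcb n n_gt0.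
    by rewrite -(ler_nat R) natrM natrX natrM.
  rewrite /q exprD exprMn /A !natrM natrX.
  rewrite (_ : A1%:R * _ * _ * _ = (M.+1%:R * gs ^+ (2 * M)) * (A1%:R * (5 ^+ p * gs ^+ p))).
    by apply: ler_wpM2r PM; rewrite !mulr_ge0 ?exprn_ge0 ?(ltW gs0).
  by ring.
rewrite -(ltr_pM2l P0).
apply: (@le_lt_trans _ _ (expR (ln A%:R + q%:R * ln gs +
    (n%:R * (max_entropy G M - eps) + class_error G M * (1 + ln gs))))).
  rewrite expRD; apply: le_trans (ler_wpM2l (ltW P0) le1) _.
  by rewrite mulrA ler_wpM2r ?expR_ge0.
rewrite mulrCA; apply: lt_le_trans (ler_wpM2l (expR_ge0 _) le2).
rewrite -expRD ltr_expR.
have lg : ln gs <= ln size_const + ln n%:R.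
  rewrite -lnM ?posrE ?size_const_gt0 // ler_ln ?posrE ?mulr_gt0 ?size_const_gt0 //.
  exact: graph_size_le.
have := ler_wpM2l (addr_ge0 (ler0n R q) err0) lg.
move: growth; rewrite /err; clear.
move: (max_entropy _ _) (class_error _ _) (flood_const _ _) (ln gs) => b c d l.
move: (ln (A%:R : R)) (ln size_const) (ln (n%:R : R)) (q%:R : R) (n%:R : R) => a s t u v.
by move: (t ^+ 2) => t2 h1 h2; lra.
Qed.

(** With [delta] proportional to n and [J] fixed, the proportion of irregular labelings is O(1/n),
    and regular ones have discrepancy below eps n. *)
Lemma discrepancy_small (eps : R) : 0 < eps -> exists n0 : nat, forall n, (n0 <= n)%N ->
  1 - eps < prob M (fun L : labeling G n =>
    sup [set (discrepancy L t)%:R | t in [set t : R | 0 <= t < total_len G]] < eps * n%:R).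
Proof.
move=> eps0; have z0 := total_len_gt0 G; have k0 := size_const_gt0.
(* The constant involves the labeling only through its number of peaks. *)
have [c cE] : exists c : R, forall n (L : labeling G n), #|peaks L| = M -> discrepancy_const L = c.
  eexists => n L pL; rewrite /discrepancy_const /frac_error /time_error /length_error.
  by rewrite /fill_error /arm_bound /event_bound /source_bound !pL; reflexivity.
have [b bE] : exists b : nat, forall n (L : labeling G n), #|peaks L| = M -> arm_bound L = b.
  by eexists => n L pL; rewrite /arm_bound /source_bound !pL; reflexivity.
have b1 : 0 < b%:R + 1 :> R by rewrite ltr_wpDl.
(* Chosen so that the arms account for at most half of eps n; the other half covers the constant
   [c]. *)
pose eta := eps / (4 * (b%:R + 1)); have eta0 : 0 < eta by rewrite divr_gt0 // mulr_gt0.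
have [J JE] : exists J : nat, size_const * 2 / eta < J%:R.
  by have [n0 h] := eventually_gt (size_const * 2 / eta); exists n0; apply: h.
have [n0 h0] := eventually_large; have [n1 h1] := eventually_gt (2 / eta).
have [n2 h2] := eventually_gt (c * 2 / eps).
have [n3 h3] := eventually_gt (size_const * J%:R / (eta ^+ 2 * eps)).
exists (maxn (maxn n0 n1) (maxn n2 n3)) => n; rewrite !geq_max.
move=> /andP[/andP[/h0 ln_ /h1 e1] /andP[/h2 e2 /h3 e3]].
have [n_gt0 n_big N_big] := ln_; have n_pos : 0 < n%:R :> R by rewrite ltr0n.
have lab0 : 0 < #|labelings G n M|%:R :> R by rewrite ltr0n labelings_neq0.
pose delta := eta * n%:R; have delta0 : 0 < delta by rewrite mulr_gt0.
(* For large n this is at least half of [delta], so a number [J] of thresholds independent of n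
   reaches past all vertices. *)
pose step := Num.truncn delta.
have /andP[s1 s2] : step%:R <= delta < step.+1%:R by apply/truncn_itv/ltW.
have s3 : delta <= step%:R * 2.
  rewrite ltr_pdivrMr // mulrC -/delta in e1.
  by rewrite -natr1 in s2; lra.
have step0 : (0 < step)%N by rewrite -(ltr0n R); lra.
have Nk : #|svtx G n|%:R <= size_const * n%:R.
  by apply: le_trans (graph_size_le n_gt0); rewrite /graph_size ler_nat leq_addr.
have J_big : (#|svtx G n| < J * step)%N.
  rewrite -(ltr_nat R) natrM; apply: le_lt_trans Nk _.
  apply: (@le_lt_trans _ _ (size_const * 2 / eta * step%:R)).
    rewrite (_ : _ * n%:R = size_const / eta * delta); last by rewrite /delta; field; rewrite gt_eqF.
    rewrite (_ : _ * step%:R = size_const / eta * (step%:R * 2)); last by ring.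
    by apply: ler_wpM2l => //; apply: divr_ge0; apply: ltW.
  by rewrite ltr_pM2r // ltr0n.
have irr := card_irregular G M n_gt0 step J delta0.
set bad := [set L in _ | _]%SET in irr.
rewrite /prob ltr_pdivlMr //; set good := [set L in _ | _]%SET.
have sub : labelings G n M \subset good :|: bad.
  apply/subsetP => L Ll; have /labelingsP[iL pL] := Ll.
  rewrite finset.in_setU [L \in good]finset.in_set [L \in bad]finset.in_set Ll /=.
  have [//|reg] := boolP (irregular _ _ _ _ _); first by rewrite orbT.
  rewrite orbF; apply: (@le_lt_trans _ _ (c + b%:R * (delta + step%:R))).
    apply: ge_sup; first by exists (discrepancy L 0)%:R, 0; rewrite /= ?lexx.
    move=> _ [t ht <-]; have := discrepancy_le n_gt0 iL step0 J_big delta0 reg ht.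
    by rewrite (cE n L pL) (bE n L pL).
  rewrite ltr_pdivrMr // in e2.
  have h : b%:R * (delta + step%:R) <= (b%:R + 1) * (delta + delta).
    by apply: ler_pM; rewrite ?lerD2l ?addr_ge0 ?(ltW delta0) // lerDl.
  have e : (b%:R + 1) * (delta + delta) = eps * n%:R / 2.
    by rewrite /delta /eta; field; rewrite gt_eqF.
  by rewrite e in h; rewrite (mulrC n%:R) in e2; lra.
have card_le : #|labelings G n M|%:R <= #|good|%:R + #|bad|%:R :> R.
  rewrite -natrD ler_nat; apply: leq_trans (subset_leq_card sub) _.
  exact: leq_card_setU.
have ratio : (#|svtx G n| * J)%:R / delta ^+ 2 < eps.
  rewrite ltr_pdivrMr ?exprn_gt0 // natrM.
  apply: (@le_lt_trans _ _ (size_const * n%:R * J%:R)); first by rewrite ler_wpM2r.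
  have ee : 0 < eta ^+ 2 * eps by apply: mulr_gt0 => //; apply: exprn_gt0.
  rewrite ltr_pdivrMr // in e3.
  rewrite mulrAC (_ : eps * delta ^+ 2 = n%:R * (eta ^+ 2 * eps) * n%:R).
    by rewrite ltr_pM2r.
  by rewrite /delta; ring.
have : #|bad|%:R < eps * #|labelings G n M|%:R :> R.
  by apply: le_lt_trans irr _; rewrite ltr_pM2r.
by rewrite mulrBl mul1r; lra.
Qed.

End Asymptotics.

Local Open Scope classical_set_scope.
Local Open Scope ring_scope.

Theorem theorem3p3 (R : realType) (G : metric_graph R) (M : nat)
    (M_gt0 : (0 < M)%N) (eps : R) (eps_gt0 : 0 < eps) :
  exists2 n1 : nat, (0 < n1)%N &
    forall n : nat, (n1 <= n)%N ->
      prob M (fun L : labeling G n => label_entropy L <= max_entropy G M - eps)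
        < expR (- n%:R * eps + 2 * ln n%:R ^+ 2)
      /\
      prob M (fun L : labeling G n =>
        sup [set (discrepancy L t)%:R | t in [set t : R | 0 <= t < total_len G]]
          < eps * n%:R)
        > 1 - eps.
Proof.
have [n0 low] := low_entropy_rare G M_gt0 eps.
have [n1 small] := discrepancy_small G M_gt0 eps_gt0.
exists (maxn 1 (maxn n0 n1)); first by rewrite leq_max.
by move=> n; rewrite !geq_max => /andP[_ /andP[/low h0 /small h1]].
Qed.
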